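(* Let $Y:\mathbb{R}\to[0,\infty)$ be convex and suppose that $$\int_0^\infty Y(x)e^{-x}\,dx=\infty.$$ If $f\in L^1(\mathbb{T})$ is a real-valued function such that $0<|f^{-1}([\pi/2,\infty))|<2\pi$ and $f^{-1}((-\pi/2,\pi/2))$ has measure zero, then $$Y(\tilde f)\notin L^1(\mathbb{T}).$$
   Context: $\mathbb{T}=\{e^{i\theta}:\theta\in[0,2\pi)\}$ is the unit circle, identified with $[0,2\pi)$; $|E|$ denotes the Lebesgue measure of $E\subset[0,2\pi)$ (so $|\mathbb{T}|=2\pi$). For $f\in L^1(\mathbb{T})$ the conjugate function $\tilde f$ is defined by $$\tilde f(s)=\frac1{2\pi}\int_0^{2\pi} f(t)\cot\frac{s-t}{2}\,dt$$ for almost every $s\in[0,2\pi)$, the integral being a Cauchy principal value. Equivalently, $\tilde f$ is the boundary function of the harmonic conjugate, normalized to vanish at the origin, of the Poisson extension of $f$ to the unit disk. $Y(\tilde f)$ denotes the composition $Y\circ\tilde f$. *)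

(* Defs.v *)
From HB Require Import structures.
From mathcomp Require Import all_boot all_order all_algebra.
From mathcomp Require Import all_classical all_reals all_analysis.
Import Order.TTheory GRing.Theory Num.Theory.
Import numFieldNormedType.Exports.

Set Implicit Arguments.
Unset Strict Implicit.
Unset Printing Implicit Defensive.

Local Open Scope classical_set_scope.
Local Open Scope ring_scope.

(* The unit circle identified with [0, 2pi) through theta |-> e^{i theta};
   functions on the circle are functions on R of which only the values on this
   set are used. *)
Definition circle (R : realType) : set R := `[0, 2 * pi[%classic.

Arguments circle R : clear implicits.

Definition cot (R : realType) (x : R) : R := cos x / sin x.

(* For s and t in [0, 2pi) the distance between them along the circle is
   min(|s - t|, 2pi - |s - t|), so this is the part of the circle at distance
   greater than e from s. *)
Definition circle_away (R : realType) (s e : R) : set R :=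
  [set t | circle R t /\ e < `|s - t| < 2 * pi - e].

Definition conj_trunc (R : realType) (f : R -> R) (s e : R) : R :=
  (2 * pi)^-1 *
  \int[@lebesgue_measure R]_(t in circle_away s e) (f t * cot ((s - t) / 2)).

(* Cauchy principal value: for integrable f the limit exists for almost every
   s; [lim] returns a default constant on the exceptional null set. *)
Definition conj_fun (R : realType) (f : R -> R) (s : R) : R :=
  lim (conj_trunc f s e @[e --> 0^'+]).

(* Main.v *)
(** Let [F] be the Herglotz integral of [f], the holomorphic function on the
    disc with real part the Poisson integral of [f] and [Im (F 0) = 0].
    Radially, [Re F] tends to [f] and [Im F] to the conjugate function almost
    everywhere.  For the second limit one needs a weak type bound: when
    [f >= 0], the function [ln |1 + F|] is harmonic and nonnegative, with mean
    at most the norm of [f], so the Hardy-Littlewood maximal inequality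
    controls [F] off a small set; step functions then give convergence.

    Write [f = f0 + fA - fB] with [f0 = +-pi/2] almost everywhere and
    [fA, fB >= 0] supported where [f0] is positive, resp. negative, and
    [F = F0 + A - B] accordingly.  As [f] takes both signs, [Re (F p) = 0] for
    some [p].  With [c = Im (A p - B p)] and [b = a + 4 - c] put
    [w = exp (- i F0 - b)], [q = w / (1 + w)] and [P = (q + q^2) / 2].  On the
    circle [w] is purely imaginary, which gives there
    [Im (P (A - B - i c)) <= (Im F - a)^+ - Re (q + 2 q^2)], whereas at [p] the
    left-hand side is nonnegative.  Integrating against the Poisson kernel of
    [p] bounds the integral of [(Im F - a)^+] from below by a multiple of
    [exp (- a)].  A convex [Y] dominates the sum of its second differences at
    the integers times the functions [(x - j)^+], so that after summation by
    parts the integral of [Y (Im F)] dominates the divergent series with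
    general term [Y j * exp (- j)]. *)

Require Import Defs.
From HB Require Import structures.
From mathcomp Require Import all_boot all_order all_algebra.
From mathcomp Require Import all_classical all_reals all_analysis.
From mathcomp Require Import measurable_realfun complex ring lra.
Import Order.TTheory GRing.Theory Num.Theory.
Import numFieldNormedType.Exports.
Import ComplexField.Normc.

Set Implicit Arguments.
Unset Strict Implicit.
Unset Printing Implicit Defensive.

Local Open Scope classical_set_scope.
Local Open Scope ring_scope.

Local Notation Re := complex.Re.
Local Notation Im := complex.Im.

(** * Complex numbers and curves in the plane *)

Section Complex.
Variable R : realType.
Implicit Types z w : R[i].

(** The obstacle is that [P (A - B - i c)] need not have an integrable boundary function, [A] and
    [B] being Herglotz integrals of functions that are only integrable; the Poisson formula cannot
    be applied to it directly. The factors [1 / (1 + e A)] and [1 / (1 + e B)] make the product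
    bounded. They rotate the boundary values and so disturb the pointwise inequality, but the
    Poisson integral of the error tends to zero with [e]. The constant [c] makes [A - B - i c] real
    at [p], equal to [- Re F0], and [Im P] has the sign of [Im w], which is that of [- sin (Re F0)]:
    hence the sign of the left-hand side at [p]. The rate [exp (- a)] is that of [|w|] at the fixed
    point [p]. The function [Re (q + 2 q^2)] is bounded and harmonic, so its Poisson integral is its
    value at [p], namely [Re w] up to a multiple of [|w|^2]; and [Re w] is a fixed positive multiple
    of [|w|] there, because [|Re F0| < pi / 2] holds strictly at [p] when [f] takes both signs. *)

Lemma CReM z w : Re (z * w) = Re z * Re w - Im z * Im w.
Proof. by case: z w => a b [c d]. Qed.

Lemma CImM z w : Im (z * w) = Re z * Im w + Im z * Re w.
Proof. by case: z w => a b [c d]. Qed.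

Lemma CReD z w : Re (z + w) = Re z + Re w.
Proof. by case: z w => a b [c d]. Qed.

Lemma CImD z w : Im (z + w) = Im z + Im w.
Proof. by case: z w => a b [c d]. Qed.

Lemma CReN z : Re (- z) = - Re z.
Proof. by case: z. Qed.

Lemma CImN z : Im (- z) = - Im z.
Proof. by case: z. Qed.

Definition sqn z : R := Re z ^+ 2 + Im z ^+ 2.

Lemma CReV z : Re z^-1 = Re z / sqn z.
Proof. by case: z. Qed.

Lemma CImV z : Im z^-1 = - Im z / sqn z.
Proof. by case: z => a b; rewrite /sqn /= mulNr. Qed.

Lemma complexP z w : Re z = Re w -> Im z = Im w -> z = w.
Proof. by case: z w => a b [c d] /= -> ->. Qed.

Definition Cexpr := (CReM, CImM, CReD, CImD, CReN, CImN).

Lemma normcE z : normc z = Num.sqrt (sqn z).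
Proof. by case: z. Qed.

Lemma sqn_ge0 z : 0 <= sqn z.
Proof. by rewrite addr_ge0 // sqr_ge0. Qed.

Lemma normc_ge0 z : 0 <= normc z.
Proof. by rewrite normcE sqrtr_ge0. Qed.

Lemma normc_sqr z : normc z ^+ 2 = sqn z.
Proof. by rewrite normcE sqr_sqrtr // sqn_ge0. Qed.

Lemma sqnM z w : sqn (z * w) = sqn z * sqn w.
Proof. by rewrite -!normc_sqr normcM exprMn. Qed.

Lemma sqn_eq0 z : (sqn z == 0) = (z == 0).
Proof.
apply/eqP/eqP => [h|->]; last by rewrite /sqn /= expr0n addr0.
by apply: eq0_normc; rewrite normcE h sqrtr0.
Qed.

Lemma sqn_gt0 z : (0 < sqn z) = (z != 0).
Proof. by rewrite lt_neqAle sqn_ge0 andbT eq_sym sqn_eq0. Qed.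

Lemma normc_gt0 z : (0 < normc z) = (z != 0).
Proof. by rewrite normcE sqrtr_gt0 sqn_gt0. Qed.

Lemma normRe_le z : `|Re z| <= normc z.
Proof.
by rewrite normcE -sqrtr_sqr ler_wsqrtr // lerDl sqr_ge0.
Qed.

Lemma normIm_le z : `|Im z| <= normc z.
Proof.
by rewrite normcE -sqrtr_sqr ler_wsqrtr // lerDr sqr_ge0.
Qed.

Lemma normc_le z : normc z <= `|Re z| + `|Im z|.
Proof.
rewrite -(ler_pXn2r (n := 2)) ?nnegrE ?normc_ge0 ?addr_ge0 //.
rewrite normc_sqr sqrrD !real_normK ?num_real //.
by rewrite /sqn lerD2r lerDl mulrn_wge0 // mulr_ge0.
Qed.

Lemma le_normcB z w : normc z - normc w <= normc (z - w).
Proof. by rewrite lerBlDr (le_trans _ (le_normcD _ _)) // subrK. Qed.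

Lemma normcR (x : R) : normc x%:C%C = `|x|.
Proof. by rewrite /normc /= expr0n addr0 sqrtr_sqr. Qed.

Lemma CReRM (x : R) z : Re (x%:C%C * z) = x * Re z.
Proof. by rewrite CReM /= mul0r subr0. Qed.

Lemma CImRM (x : R) z : Im (x%:C%C * z) = x * Im z.
Proof. by rewrite CImM /= mul0r addr0. Qed.

Definition cis (t : R) : R[i] := (cos t +i* sin t)%C.

Lemma normc_cis t : normc (cis t) = 1.
Proof. by rewrite normcE /sqn /= cos2Dsin2 sqrtr1. Qed.

Lemma cis_neq0 t : cis t != 0.
Proof. by rewrite -normc_gt0 normc_cis. Qed.

Definition cexp z : R[i] := ((expR (Re z))%:C * cis (Im z))%C.

Lemma Re_cexp z : Re (cexp z) = expR (Re z) * cos (Im z).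
Proof. by rewrite CReRM. Qed.

Lemma Im_cexp z : Im (cexp z) = expR (Re z) * sin (Im z).
Proof. by rewrite CImRM. Qed.

Lemma normc_cexp z : normc (cexp z) = expR (Re z).
Proof. by rewrite normcM normc_cis mulr1 normcR ger0_norm // expR_ge0. Qed.

(** This is the principal logarithm for [Re z > 0], where [atan (Im z / Re z)] is the argument; it
    is used on that half-plane alone. *)
Definition clog z : R[i] := (ln (sqn z) / 2 +i* atan (Im z / Re z))%C.

Definition cderive (w : R -> R[i]) (t : R) (d : R[i]) :=
  is_derive t 1 (fun x => Re (w x)) (Re d) /\
  is_derive t 1 (fun x => Im (w x)) (Im d).

Lemma fderiveM (f g : R -> R) (t a b : R) : is_derive t 1 f a -> is_derive t 1 g b ->
  is_derive t 1 (fun x => f x * g x) (f t * b + g t * a).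
Proof. exact: is_deriveM. Qed.

Lemma fderiveD (f g : R -> R) (t a b : R) : is_derive t 1 f a -> is_derive t 1 g b ->
  is_derive t 1 (fun x => f x + g x) (a + b).
Proof. exact: is_deriveD. Qed.

Lemma fderiveN (f : R -> R) (t a : R) : is_derive t 1 f a ->
  is_derive t 1 (fun x => - f x) (- a).
Proof. exact: is_deriveN. Qed.

Lemma fderiveV (f : R -> R) (t a : R) : f t != 0 -> is_derive t 1 f a ->
  is_derive t 1 (fun x => (f x)^-1) (- (f t) ^- 2 * a).
Proof. exact: is_deriveV. Qed.

Lemma fderive_comp (f g : R -> R) (t a b : R) :
  is_derive (g t) 1 f a -> is_derive t 1 g b ->
  is_derive t 1 (fun x => f (g x)) (a * b).
Proof. exact: is_derive1_comp. Qed.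

Lemma eq_cderive (w : R -> R[i]) t d d' : cderive w t d -> d = d' -> cderive w t d'.
Proof. by move=> + <-. Qed.

Lemma cderive_cst c t : cderive (fun=> c) t 0.
Proof. by split; exact: is_derive_cst. Qed.

Lemma cderiveR (f : R -> R) (t a : R) : is_derive t 1 f a ->
  cderive (fun x => (f x)%:C%C) t a%:C%C.
Proof. by split => //=; exact: is_derive_cst. Qed.

Lemma cderiveD (w v : R -> R[i]) t d e : cderive w t d -> cderive v t e ->
  cderive (fun x => w x + v x) t (d + e).
Proof.
move=> [wR wI] [vR vI]; split; rewrite !Cexpr.
  by under [X in is_derive _ _ X _]eq_fun do rewrite CReD; exact: fderiveD.
by under [X in is_derive _ _ X _]eq_fun do rewrite CImD; exact: fderiveD.
Qed.

Lemma cderiveN (w : R -> R[i]) t d : cderive w t d -> cderive (fun x => - w x) t (- d).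
Proof.
move=> [wR wI]; split; rewrite !Cexpr.
  by under [X in is_derive _ _ X _]eq_fun do rewrite CReN; exact: fderiveN.
by under [X in is_derive _ _ X _]eq_fun do rewrite CImN; exact: fderiveN.
Qed.

Lemma cderiveB (w v : R -> R[i]) t d e : cderive w t d -> cderive v t e ->
  cderive (fun x => w x - v x) t (d - e).
Proof. by move=> dw dv; apply: cderiveD => //; exact: cderiveN. Qed.

Lemma cderiveM (w v : R -> R[i]) t d e : cderive w t d -> cderive v t e ->
  cderive (fun x => w x * v x) t (d * v t + w t * e).
Proof.
move=> [wR wI] [vR vI]; split; rewrite !Cexpr.
  under [X in is_derive _ _ X _]eq_fun do rewrite CReM.
  refine (is_derive_eq (fderiveD (fderiveM wR vR) (fderiveN (fderiveM wI vI))) _).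
  by ring.
under [X in is_derive _ _ X _]eq_fun do rewrite CImM.
refine (is_derive_eq (fderiveD (fderiveM wR vI) (fderiveM wI vR)) _).
by ring.
Qed.

Lemma fderive_sqn (w : R -> R[i]) t d : cderive w t d ->
  is_derive t 1 (fun x => sqn (w x)) (2 * (Re (w t) * Re d + Im (w t) * Im d)).
Proof.
move=> [wR wI].
rewrite /sqn; under [X in is_derive _ _ X _]eq_fun do rewrite !expr2.
refine (is_derive_eq (fderiveD (fderiveM wR wR) (fderiveM wI wI)) _).
by ring.
Qed.

Lemma cderiveV (w : R -> R[i]) t d : w t != 0 -> cderive w t d ->
  cderive (fun x => (w x)^-1) t (- d / (w t) ^+ 2).
Proof.
move=> w0 dw; have [wR wI] := dw; have n0 : sqn (w t) != 0 by rewrite sqn_eq0.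
have e : - d / w t ^+ 2 = - d * ((w t)^-1 * (w t)^-1) by rewrite expr2 invfM.
have dV := @fderiveV (fun x => sqn (w x)) _ _ n0 (fderive_sqn dw).
have n2 : sqn (w t) = Re (w t) ^+ 2 + Im (w t) ^+ 2 by [].
split.
  under [X in is_derive _ _ X _]eq_fun do rewrite CReV.
  refine (is_derive_eq (fderiveM wR dV) _).
  rewrite e !Cexpr !CReV !CImV.
  by move: n0; rewrite n2 => n0; field.
under [X in is_derive _ _ X _]eq_fun do rewrite CImV.
refine (is_derive_eq (fderiveM (fderiveN wI) dV) _).
rewrite e !Cexpr !CReV !CImV.
by move: n0; rewrite n2 => n0; field.
Qed.

Lemma cderive_cis (f : R -> R) (t a : R) : is_derive t 1 f a ->
  cderive (fun x => cis (f x)) t (a%:C * 'i * cis (f t))%C.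
Proof.
move=> df; split; rewrite !Cexpr /=.
  by refine (is_derive_eq (fderive_comp (is_derive_cos _) df) _); ring.
by refine (is_derive_eq (fderive_comp (is_derive_sin _) df) _); ring.
Qed.

Lemma cderive_cexp (w : R -> R[i]) t d : cderive w t d ->
  cderive (fun x => cexp (w x)) t (cexp (w t) * d).
Proof.
move=> [wR wI].
refine (eq_cderive (cderiveM (cderiveR (fderive_comp (is_derive_expR _) wR))
  (cderive_cis wI)) _).
by apply: complexP; rewrite !Cexpr /cexp /= ?Cexpr /=; ring.
Qed.

Lemma cderive_clog (w : R -> R[i]) t d : 0 < Re (w t) -> cderive w t d ->
  cderive (fun x => clog (w x)) t (d / w t).
Proof.
move=> w0 dw; have [wR wI] := dw.
have Re0 : Re (w t) != 0 by rewrite gt_eqF.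
have n2 : sqn (w t) = Re (w t) ^+ 2 + Im (w t) ^+ 2 by [].
have n0 : 0 < sqn (w t) by rewrite n2 ltr_pwDl ?sqr_ge0 ?exprn_gt0.
have n0' : sqn (w t) != 0 by rewrite gt_eqF.
split; rewrite /= !Cexpr CReV CImV.
  refine (is_derive_eq (fderiveM (@fderive_comp _ (fun x => sqn (w x)) _ _ _
    (is_derive1_ln n0) (fderive_sqn dw)) (is_derive_cst _ _ _)) _).
  by rewrite mulr0 add0r -[cst _ _]/(2^-1 : R); field.
refine (is_derive_eq (@fderive_comp _ (fun x => Im (w x) / Re (w x)) _ _ _
  (is_derive1_atan _) (fderiveM wI (@fderiveV (fun x => Re (w x)) _ _ Re0 wR))) _).
have e : 1 + (Im (w t) / Re (w t)) ^+ 2 = sqn (w t) / Re (w t) ^+ 2.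
  by rewrite n2; field.
rewrite e; move: n0'; rewrite n2 => n0'; field; rewrite n0' Re0 /=.
by [].
Qed.

End Complex.

(** * Integration over the circle and differentiation under the integral sign *)

Section CircleIntegral.
Variable R : realType.
Notation mu := (@lebesgue_measure R).
Implicit Types f g : R -> R.

Lemma measurable_circle : measurable (circle R).
Proof. exact: measurable_itv. Qed.

Lemma measurable_circleR : measurable (circle R : set (measurableTypeR R)).
Proof. exact: measurable_circle. Qed.
Hint Resolve measurable_circle measurable_circleR : core.

Lemma mu_circle : mu (circle R) = (2 * pi)%:E.
Proof.
rewrite /circle lebesgue_measure_itv /= lte_fin ifT ?oppr0 ?adde0 //.
by rewrite mulr_gt0 // pi_gt0.
Qed.

Lemma mu_circle_lty : (mu (circle R) < +oo)%E.
Proof. by rewrite mu_circle ltry. Qed.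

Lemma boundedP (D : set R) f (B : R) : (forall s, D s -> `|f s| <= B) ->
  [bounded f x | x in D].
Proof.
move=> fB; exists B; split; first exact: num_real.
by move=> M BM s Ds; exact: le_trans (fB _ Ds) (ltW BM).
Qed.

Lemma circ_integrableM f g (B : R) : mu.-integrable (circle R) (EFin \o f) ->
  measurable_fun (circle R) g -> (forall s, circle R s -> `|g s| <= B) ->
  mu.-integrable (circle R) (EFin \o (fun s => f s * g s)).
Proof.
move=> fi mg gB.
have -> : EFin \o (fun s => f s * g s) = ((EFin \o f) \* (EFin \o g))%E.
  by apply/funext => s /=; rewrite EFinM.
by apply: integrableMl => //; exact: (boundedP gB).
Qed.

Lemma circ_integrable_bounded g (B : R) : measurable_fun (circle R) g ->
  (forall s, circle R s -> `|g s| <= B) ->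
  mu.-integrable (circle R) (EFin \o g).
Proof.
move=> mg gB; apply: measurable_bounded_integrable => //.
  exact: mu_circle_lty.
exact: (boundedP gB).
Qed.

Lemma derivable_continuous f (t d : R) : is_derive t 1 f d ->
  {for t, continuous f}.
Proof.
by move=> df; apply: differentiable_continuous; apply/derivable1_diffP; case: df.
Qed.

Lemma circ_measurable g : continuous g -> measurable_fun (circle R) g.
Proof.
by move=> cg; apply: measurable_funTS; exact: continuous_measurable_fun.
Qed.

Lemma circ_integrable_cont g : continuous g ->
  mu.-integrable (circle R) (EFin \o g).
Proof.
move=> cg.
have : mu.-integrable `[0%R, 2 * pi] (EFin \o g).
  apply: continuous_compact_integrable; first exact: segment_compact.
  exact: continuous_subspaceT.
apply: integrableS; [exact: measurable_itv|exact: measurable_circle|].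
exact: subset_itv_co_cc.
Qed.

Lemma circ_FTC F f : (forall t : R, is_derive t 1 F (f t)) -> continuous f ->
  F (2 * pi) = F 0 -> \int[mu]_(t in circle R) f t = 0.
Proof.
move=> dF cf F2; have p0 : (0 < 2 * pi :> R) by rewrite mulr_gt0 // pi_gt0.
have cF : continuous F by move=> t; exact: derivable_continuous (dF t).
rewrite /circle Rintegral_itv_bndo_bndc; last exact: circ_integrable_cont.
rewrite /Rintegral (@continuous_FTC2 _ f F) //.
- by rewrite F2 -EFinB subrr.
- exact: continuous_subspaceT.
- split.
  + by move=> x _; case: (dF x).
  + by apply: cvg_at_right_filter; exact: cF.
  + by apply: cvg_at_left_filter; exact: cF.
- by move=> x _; rewrite derive1E; exact: (@derive_val _ _ _ _ _ _ _ (dF x)).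
Qed.

Definition cint f (h : R -> R[i]) : R[i] :=
  ((\int[mu]_(s in circle R) (f s * Re (h s))) +i*
   (\int[mu]_(s in circle R) (f s * Im (h s))))%C.

Definition cmeas (h : R -> R[i]) :=
  measurable_fun (circle R) (fun s => Re (h s)) /\
  measurable_fun (circle R) (fun s => Im (h s)).

Definition ccont (w : R -> R[i]) t :=
  {for t, continuous (fun s => Re (w s))} /\
  {for t, continuous (fun s => Im (w s))}.

Lemma cderive_ccont w t d : cderive w t d -> ccont w t.
Proof. by move=> [a b]; split; exact: derivable_continuous. Qed.

Lemma ccont_cmeas h : (forall s, ccont h s) -> cmeas h.
Proof. by move=> c; split; apply: circ_measurable => s; case: (c s). Qed.

Lemma Re_bounded (z : R[i]) (B : R) : normc z <= B -> `|Re z| <= B.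
Proof. exact: le_trans (normRe_le z). Qed.

Lemma Im_bounded (z : R[i]) (B : R) : normc z <= B -> `|Im z| <= B.
Proof. exact: le_trans (normIm_le z). Qed.

Lemma cint_integrable f h (B : R) : mu.-integrable (circle R) (EFin \o f) ->
  cmeas h -> (forall s, circle R s -> normc (h s) <= B) ->
  mu.-integrable (circle R) (EFin \o (fun s => f s * Re (h s))) /\
  mu.-integrable (circle R) (EFin \o (fun s => f s * Im (h s))).
Proof.
move=> fi [mR mI] hB; split.
  by apply: (circ_integrableM (B := B)) => // s /hB; exact: Re_bounded.
by apply: (circ_integrableM (B := B)) => // s /hB; exact: Im_bounded.
Qed.

Lemma cintZ f h c (B : R) : mu.-integrable (circle R) (EFin \o f) ->
  cmeas h -> (forall s, circle R s -> normc (h s) <= B) ->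
  cint f (fun s => c * h s) = c * cint f h.
Proof.
move=> fi mh hB; have [iR iI] := cint_integrable fi mh hB.
have Zi (k : R) g : mu.-integrable (circle R) (EFin \o g) ->
    mu.-integrable (circle R) (EFin \o (fun s => k * g s)).
  by move=> gi; under [_ \o _]eq_fun do rewrite /= EFinM; exact: integrableZl.
apply: complexP; rewrite !Cexpr /=.
  under eq_Rintegral do rewrite CReM mulrBr !(mulrCA (f _)).
  by rewrite RintegralB ?RintegralZl //; exact: Zi.
under eq_Rintegral do rewrite CImM mulrDr !(mulrCA (f _)).
by rewrite RintegralD ?RintegralZl //; exact: Zi.
Qed.

Lemma cint_derive f (u v B : R) (h h' : R -> R -> R[i]) :
  mu.-integrable (circle R) (EFin \o f) ->
  (forall t, u < t < v -> cmeas (h t)) ->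
  (forall t s, u < t < v -> circle R s -> cderive (h^~ s) t (h' t s)) ->
  (forall t s, u < t < v -> circle R s -> normc (h t s) <= B) ->
  (forall t s, u < t < v -> circle R s -> normc (h' t s) <= B) ->
  forall t, u < t < v -> cderive (fun t => cint f (h t)) t (cint f (h' t)).
Proof.
move=> fi mh dh hB h'B t tuv.
have It : `]u, v[%classic t by rewrite /= in_itv.
have fi1 : mu.-integrable (circle R) (EFin \o (fun s => B * `|f s|)).
  under [_ \o _]eq_fun do rewrite /= EFinM; apply: integrableZl => //.
  exact: integrable_norm.
(* Real and imaginary parts are treated at once through a projection [p] bounded by the norm; the
   derivative in [t] is then dominated by [|B| * |f s|]. *)
have D (p : R[i] -> R) :
    (forall t s, u < t < v -> circle R s ->
      is_derive t 1 (fun t => p (h t s)) (p (h' t s))) ->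
    (forall t, u < t < v -> measurable_fun (circle R) (fun s => p (h t s))) ->
    (forall z, `|p z| <= normc z) ->
    is_derive t 1 (fun t => \int[mu]_(s in circle R) (f s * p (h t s)))
      (\int[mu]_(s in circle R) (f s * p (h' t s))).
  move=> dp mp pB.
  have d1 x s : u < x < v -> circle R s ->
      is_derive x 1 (fun t => f s * p (h t s)) (f s * p (h' x s)).
    move=> xuv cs; have dpx := dp _ _ xuv cs.
    refine (is_derive_eq (fderiveM (is_derive_cst (f s) _ _) dpx) _).
    by rewrite mulr0 addr0.
  have e x s : u < x < v -> circle R s ->
      partial1of2 (fun t s => f s * p (h t s)) x s = f s * p (h' x s).
    move=> xuv cs; rewrite partial1of2E.
    exact: (@derive_val _ _ _ _ _ _ _ (d1 x s xuv cs)).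
  have fint x : `]u, v[%classic x ->
      mu.-integrable (circle R) (EFin \o (fun s => f s * p (h x s))).
    rewrite /= in_itv /= => xuv; apply: (circ_integrableM (B := B)) => //.
      exact: mp.
    by move=> s cs; rewrite (le_trans (pB _)) // hB.
  have dd x y : `]u, v[%classic x -> circle R y ->
      derivable ((fun t s => f s * p (h t s))^~ y) x 1.
    by rewrite /= in_itv /= => xuv cy; case: (d1 x y xuv cy).
  have G0 y : 0 <= (fun s => `|B| * `|f s|) y by rewrite mulr_ge0.
  have Gi : mu.-integrable (circle R) (EFin \o (fun s => `|B| * `|f s|)).
    under [_ \o _]eq_fun do rewrite /= EFinM; apply: integrableZl => //.
    exact: integrable_norm.
  have Gub x y : `]u, v[%classic x -> circle R y ->
     `|partial1of2 (fun t s => f s * p (h t s)) x y| <=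
     (fun s => `|B| * `|f s|) y.
    rewrite /= in_itv /= => xuv cy; rewrite e // normrM mulrC ler_wpM2r //.
    by rewrite (le_trans (pB _)) // (le_trans (h'B _ _ xuv cy)) // ler_norm.
  have dF := @derivable_under_integral R _ _ mu _ _ measurable_circle _ _ _ It fint dd _ G0 Gi Gub.
  have eF := @differentiation_under_integral R _ _ mu _ _ measurable_circle _ _ _ It fint dd _ G0 Gi Gub.
  apply: DeriveDef; first exact: dF.
  rewrite -derive1E eF; apply: eq_Rintegral => s /set_mem cs; exact: e.
split; apply: D.
- by move=> x s xuv cs; have [] := dh x s xuv cs.
- by move=> x xuv; have [] := mh x xuv.
- exact: normRe_le.
- by move=> x s xuv cs; have [] := dh x s xuv cs.
- by move=> x xuv; have [] := mh x xuv.
- exact: normIm_le.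
Qed.

End CircleIntegral.
#[global] Hint Resolve measurable_circle measurable_circleR : core.

(** * Holomorphic functions on the unit disc *)

Section Holomorphic.
Variable R : realType.
Notation mu := (@lebesgue_measure R).
Implicit Types (X Y : R[i] -> R[i]) (w v : R -> R[i]).

Lemma ccont_cst (c : R[i]) (t : R) : ccont (fun=> c) t.
Proof. by split; exact: cvg_cst. Qed.

Lemma ccontD w v t : ccont w t -> ccont v t -> ccont (fun x => w x + v x) t.
Proof.
move=> [a b] [c d]; split; rewrite /prop_for /continuous_at !Cexpr.
  by under eq_fun do rewrite CReD; exact: cvgD.
by under eq_fun do rewrite CImD; exact: cvgD.
Qed.

Lemma ccontN w t : ccont w t -> ccont (fun x => - w x) t.
Proof.
move=> [a b]; split; rewrite /prop_for /continuous_at !Cexpr.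
  by under eq_fun do rewrite CReN; exact: cvgN.
by under eq_fun do rewrite CImN; exact: cvgN.
Qed.

Lemma ccontM w v t : ccont w t -> ccont v t -> ccont (fun x => w x * v x) t.
Proof.
move=> [a b] [c d]; split; rewrite /prop_for /continuous_at !Cexpr.
  by under eq_fun do rewrite CReM; apply: cvgB; exact: cvgM.
by under eq_fun do rewrite CImM; apply: cvgD; exact: cvgM.
Qed.

Lemma ccont_sqn w t : ccont w t -> {for t, continuous (fun x => sqn (w x))}.
Proof.
move=> [a b]; rewrite /prop_for /continuous_at /sqn.
under eq_fun do rewrite !expr2.
by rewrite !expr2; apply: cvgD; exact: cvgM.
Qed.

Lemma ccontV w t : w t != 0 -> ccont w t -> ccont (fun x => (w x)^-1) t.
Proof.
move=> w0 cw; have [a b] := cw; have := ccont_sqn cw => cs.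
split; rewrite /prop_for /continuous_at.
  under eq_fun do rewrite CReV; rewrite CReV.
  by apply: cvgM => //; apply: cvgV => //; rewrite sqn_eq0.
under eq_fun do rewrite CImV; rewrite CImV.
by apply: cvgM; [exact: cvgN|apply: cvgV => //; rewrite sqn_eq0].
Qed.

Lemma ccont_cexp w t : ccont w t -> ccont (fun x => cexp (w x)) t.
Proof.
move=> [a b].
have e : {for t, continuous (fun x => expR (Re (w x)))}.
  by apply: (continuous_comp a); exact: continuous_expR.
split; rewrite /prop_for /continuous_at.
  under eq_fun do rewrite Re_cexp; rewrite Re_cexp.
  by apply: cvgM => //; apply: (continuous_comp b); exact: continuous_cos.
under eq_fun do rewrite Im_cexp; rewrite Im_cexp.
by apply: cvgM => //; apply: (continuous_comp b); exact: continuous_sin.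
Qed.

Definition curve_in (u v r M : R) (w w' : R -> R[i]) :=
  forall t, u < t < v ->
    [/\ normc (w t) <= r, normc (w' t) <= M & cderive w t (w' t)].

(* [X'] is the complex derivative of [X] on the open unit disc, tested along
   differentiable curves. *)
Definition holo_with X X' :=
  (forall (u v r M : R) w w', r < 1 -> curve_in u v r M w w' ->
    forall t, u < t < v ->
      cderive (fun x => X (w x)) t (X' (w t) * w' t) /\
      ccont (fun x => X' (w x)) t) /\
  (forall r : R, r < 1 -> exists B : R, forall z, normc z <= r ->
    normc (X z) <= B /\ normc (X' z) <= B).

Definition holo X := exists X', holo_with X X'.

Lemma holo_cst c : holo (fun=> c).
Proof.
exists (fun=> 0); split=> [u v r M w w' _ cw t tuv|r r1].
  split; first by rewrite mul0r; exact: cderive_cst.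
  exact: ccont_cst.
by exists (normc c) => z _; rewrite lexx normc0 normc_ge0.
Qed.

Lemma holo_id : holo id.
Proof.
exists (fun=> 1); split=> [u v r M w w' _ cw t tuv|r r1].
  by split; [rewrite mul1r; case: (cw t tuv)|exact: ccont_cst].
exists 1 => z zr; rewrite normc1 lexx; split => //.
exact: le_trans zr (ltW r1).
Qed.

Lemma holoD X Y : holo X -> holo Y -> holo (fun z => X z + Y z).
Proof.
move=> [X' [dX bX]] [Y' [dY bY]]; exists (fun z => X' z + Y' z).
split=> [u v r M w w' r1 cw t tuv|r r1].
  have [a b] := dX _ _ _ _ _ _ r1 cw _ tuv.
  have [c d] := dY _ _ _ _ _ _ r1 cw _ tuv.
  by split; [rewrite mulrDl; exact: cderiveD|exact: ccontD].
have [B hB] := bX _ r1; have [C hC] := bY _ r1.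
exists (B + C) => z zr; have [b b'] := hB _ zr; have [c c'] := hC _ zr.
by split; apply: le_trans (le_normcD _ _) _; exact: lerD.
Qed.

Lemma holoN X : holo X -> holo (fun z => - X z).
Proof.
move=> [X' [dX bX]]; exists (fun z => - X' z).
split=> [u v r M w w' r1 cw t tuv|r r1].
  have [a b] := dX _ _ _ _ _ _ r1 cw _ tuv.
  by split; [rewrite mulNr; exact: cderiveN|exact: ccontN].
have [B hB] := bX _ r1.
by exists B => z zr; rewrite !normcN; exact: hB.
Qed.

Lemma holoB X Y : holo X -> holo Y -> holo (fun z => X z - Y z).
Proof. by move=> hX hY; apply: holoD => //; exact: holoN. Qed.

Lemma holoM X Y : holo X -> holo Y -> holo (fun z => X z * Y z).
Proof.
move=> [X' [dX bX]] [Y' [dY bY]]; exists (fun z => X' z * Y z + X z * Y' z).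
split=> [u v r M w w' r1 cw t tuv|r r1].
  have [a b] := dX _ _ _ _ _ _ r1 cw _ tuv.
  have [c d] := dY _ _ _ _ _ _ r1 cw _ tuv.
  split; first by apply: eq_cderive (cderiveM a c) _; ring.
  apply: ccontD; apply: ccontM => //.
    exact: cderive_ccont c.
  exact: cderive_ccont a.
have [B hB] := bX _ r1; have [C hC] := bY _ r1.
exists (B * C + B * C) => z zr; have [b b'] := hB _ zr; have [c c'] := hC _ zr.
have B0 : 0 <= B by apply: le_trans b; exact: normc_ge0.
have C0 : 0 <= C by apply: le_trans c; exact: normc_ge0.
split; last first.
  apply: le_trans (le_normcD _ _) _; rewrite !normcM.
  by apply: lerD; apply: ler_pM => //; exact: normc_ge0.
rewrite normcM (@le_trans _ _ (B * C)) ?lerDl ?mulr_ge0 //.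
by apply: ler_pM => //; exact: normc_ge0.
Qed.

Lemma holo_cexp X : holo X -> holo (fun z => cexp (X z)).
Proof.
move=> [X' [dX bX]]; exists (fun z => cexp (X z) * X' z).
split=> [u v r M w w' r1 cw t tuv|r r1].
  have [a b] := dX _ _ _ _ _ _ r1 cw _ tuv.
  split; first by apply: eq_cderive (cderive_cexp a) _; rewrite mulrA.
  by apply: ccontM => //; apply: ccont_cexp; exact: cderive_ccont a.
have [B hB] := bX _ r1.
exists (expR B * (1 + B)) => z zr; have [b b'] := hB _ zr.
have B0 : 0 <= B by apply: le_trans b; exact: normc_ge0.
have e : normc (cexp (X z)) <= expR B.
  rewrite normc_cexp ler_expR; apply: le_trans b.
  by apply: le_trans (normRe_le _); exact: ler_norm.
split; first by rewrite (le_trans e) // ler_peMr ?expR_ge0 // lerDl.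
rewrite normcM; apply: ler_pM => //; first exact: normc_ge0.
  exact: normc_ge0.
by rewrite (le_trans b') // lerDr.
Qed.

(** The uniform lower bound [c] supplies the bounds on smaller discs that [holo_with] asks of the
    inverse and of its derivative. *)
Lemma holoV X (c : R) : 0 < c -> (forall z, normc z < 1 -> c <= normc (X z)) ->
  holo X -> holo (fun z => (X z)^-1).
Proof.
move=> c0 cX [X' [dX bX]]; exists (fun z => - X' z / (X z) ^+ 2).
have X0 z : normc z < 1 -> X z != 0.
  by move=> /cX cz; rewrite -normc_gt0 (lt_le_trans c0).
split=> [u v r M w w' r1 cw t tuv|r r1].
  have [a b] := dX _ _ _ _ _ _ r1 cw _ tuv.
  have w1 : normc (w t) < 1 by have [wr _ _] := cw _ tuv; exact: le_lt_trans r1.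
  split; first by apply: eq_cderive (cderiveV (X0 _ w1) a) _; ring.
  apply: ccontM; first exact: ccontN.
  apply: ccontV; first by rewrite expf_neq0 // X0.
  by apply: ccontM; exact: cderive_ccont a.
have [B hB] := bX _ r1.
exists (c^-1 + B * (c^-1 * c^-1)) => z zr; have [b b'] := hB _ zr.
have B0 : 0 <= B by apply: le_trans b; exact: normc_ge0.
have z1 : normc z < 1 by exact: le_lt_trans r1.
have e : normc (X z)^-1 <= c^-1.
  by rewrite normcV lef_pV2 ?posrE ?cX // normc_gt0 X0.
have ci : 0 <= c^-1 by rewrite invr_ge0 ltW.
split; first by rewrite (le_trans e) // lerDl !mulr_ge0.
rewrite expr2 invfM !normcM normcN (@le_trans _ _ (B * (c^-1 * c^-1))) ?lerDr //.
by rewrite !ler_pM ?mulr_ge0 ?normc_ge0.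
Qed.

Lemma holo_clog X (c : R) : 0 < c -> (forall z, normc z < 1 -> c <= Re (X z)) ->
  holo X -> holo (fun z => clog (X z)).
Proof.
move=> c0 cX [X' [dX bX]]; exists (fun z => X' z / X z).
have nX z : normc z < 1 -> c <= normc (X z).
  by move=> /cX cz; rewrite (le_trans cz) // (le_trans _ (normRe_le _)) // ler_norm.
split=> [u v r M w w' r1 cw t tuv|r r1].
  have [a b] := dX _ _ _ _ _ _ r1 cw _ tuv.
  have w1 : normc (w t) < 1 by have [wr _ _] := cw _ tuv; exact: le_lt_trans r1.
  have X0 : X (w t) != 0 by rewrite -normc_gt0 (lt_le_trans c0) // nX.
  split; first by apply: eq_cderive (cderive_clog (lt_le_trans c0 (cX _ w1)) a) _; ring.
  by apply: ccontM => //; apply: ccontV => //; exact: cderive_ccont a.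
have [B hB] := bX _ r1.
exists (`|ln c| + `|ln B| + pi / 2 + B * c^-1) => z zr; have [b b'] := hB _ zr.
have z1 : normc z < 1 by exact: le_lt_trans r1.
have cB : c <= B by rewrite (le_trans _ b) // nX.
have B0 : 0 < B by exact: lt_le_trans cB.
have Xn0 : 0 < normc (X z) by rewrite (lt_le_trans c0) // nX.
have p0 : 0 <= pi / 2 :> R by rewrite divr_ge0 // pi_ge0.
have Bc : 0 <= B * c^-1 by rewrite mulr_ge0 ?ltW // invr_gt0.
split; last first.
  rewrite normcM normcV (@le_trans _ _ (B * c^-1)) //; last first.
    by rewrite lerDr !addr_ge0.
  apply: ler_pM; rewrite ?normc_ge0 ?invr_ge0 ?normc_ge0 //.
  by rewrite lef_pV2 ?posrE // nX.
apply: le_trans (normc_le _) _; rewrite /clog /=.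
have l1 : ln (sqn (X z)) / 2 = ln (normc (X z)).
  by rewrite -normc_sqr lnXn //; field.
have lc : ln c <= ln (normc (X z)) by rewrite ler_ln ?posrE // nX.
have lB : ln (normc (X z)) <= ln B by rewrite ler_ln ?posrE.
have at1 : `|atan (Im (X z) / Re (X z))| <= pi / 2.
  by rewrite ler_norml !ltW ?atan_gtNpi2 ?atan_ltpi2.
rewrite l1 -addrA lerD //; last by rewrite (le_trans at1) // lerDl.
have c1 : - `|ln c| <= ln c by rewrite lerNl -normrN ler_norm.
have n1 := ler_norm (ln B); have n2 := normr_ge0 (ln B); have n3 := normr_ge0 (ln c).
by rewrite ler_norml; apply/andP; split; lra.
Qed.

Lemma holo_scale X (a : R) : 0 <= a <= 1 -> holo X ->
  holo (fun z => X (a%:C%C * z)).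
Proof.
move=> /andP[a0 a1] [X' [dX bX]]; exists (fun z => a%:C%C * X' (a%:C%C * z)).
have az z : normc (a%:C%C * z) <= normc z.
  by rewrite normcM normcR ger0_norm // ler_piMl ?normc_ge0.
split=> [u v r M w w' r1 cw t tuv|r r1].
  have cw' : curve_in u v r M (fun t => a%:C%C * w t) (fun t => a%:C%C * w' t).
    move=> x xuv; have [p q dw] := cw _ xuv.
    split; [exact: le_trans (az _) _|exact: le_trans (az _) _|].
    by apply: eq_cderive (cderiveM (cderive_cst _ _) dw) _; rewrite mul0r add0r.
  have [d e] := dX _ _ _ _ _ _ r1 cw' _ tuv.
  split; first by apply: eq_cderive d _; ring.
  by apply: ccontM => //; exact: ccont_cst.
have [B hB] := bX _ r1; exists B => z zr.
have [b b'] := hB _ (le_trans (az _) zr); split => //.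
exact: le_trans b'.
Qed.

End Holomorphic.

(** * Cauchy and Poisson formulas on circles *)

Section MeanValue.
Variable R : realType.
Notation mu := (@lebesgue_measure R).
Implicit Types (X Y : R[i] -> R[i]) (w v : R -> R[i]).

Definition cint1 (h : R -> R[i]) := cint (fun=> 1 : R) h.

Lemma Re_cint1 h : Re (cint1 h) = \int[mu]_(t in circle R) Re (h t).
Proof. by rewrite /cint1 /=; apply: eq_Rintegral => t _; rewrite mul1r. Qed.

Lemma integrable1 : mu.-integrable (circle R) (EFin \o (fun=> 1 : R)).
Proof. by apply: circ_integrable_cont => t; exact: cvg_cst. Qed.

Lemma derive0_const (F : R -> R) : (forall t : R, 0 < t < 1 -> is_derive t 1 F 0) ->
  {for 0, continuous F} -> {for 1, continuous F} -> F 1 = F 0.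
Proof.
move=> dF c0 c1.
have dF' (x : R) : x \in `]0, 1[%R -> is_derive x 1 F 0.
  by rewrite in_itv /=; exact: dF.
have cF : {within `[0, 1], continuous F}.
  apply/(continuous_within_itvP _ ltr01); split.
  - by move=> x; rewrite in_itv /= => /dF; exact: derivable_continuous.
  - exact: cvg_at_right_filter.
  - exact: cvg_at_left_filter.
have [c _] := @MVT R F (fun=> 0) 0 1 ltr01 dF' cF.
by rewrite mul0r => /eqP; rewrite subr_eq0 => /eqP.
Qed.

(* The circle of radius [r] is contracted onto [p] along the homothetic
   circles [p + k (r e^{it} - p)]; the integrand is arranged so that the
   derivative in [k] is [1/k] times a derivative in [t]. *)
Lemma cauchy_contraction X (p : R[i]) (r : R) : holo X -> normc p < r -> r < 1 ->
  let c t := r%:C%C * cis t / (r%:C%C * cis t - p) in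
  \int[mu]_(t in circle R) Re (X (r%:C%C * cis t) * c t) =
  \int[mu]_(t in circle R) Re (X p * c t).
Proof.
move=> [X' [dX bX]] pr r1 c.
have r0 : 0 < r by apply: le_lt_trans pr; exact: normc_ge0.
have nrc t : normc (r%:C%C * cis t) = r.
  by rewrite normcM normc_cis mulr1 normcR gtr0_norm.
have rcp t : r - normc p <= normc (r%:C%C * cis t - p).
  by rewrite -{1}(nrc t) le_normcB.
have rp0 : 0 < r - normc p by rewrite subr_gt0.
have den t : r%:C%C * cis t - p != 0.
  by rewrite -normc_gt0 (lt_le_trans rp0).
(* Differentiation in [k] needs an open interval around [[0, 1]]; with the margin [d] the homothetic
   circles still lie in the disc of radius [r' < 1]. *)
pose d := (1 - r) / 4; pose r' := (1 + r) / 2.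
have d0 : 0 < d by rewrite /d; lra.
have r'1 : r' < 1 by rewrite /r'; lra.
have np0 := normc_ge0 p.
pose g (k t : R) := p + k%:C%C * (r%:C%C * cis t - p).
have gr k t : - d < k < 1 + d -> normc (g k t) <= r'.
  move=> /andP[k0 k1].
  have -> : g k t = (1 - k)%:C%C * p + k%:C%C * (r%:C%C * cis t).
    by rewrite /g rmorphB /= rmorph1; ring.
  apply: le_trans (le_normcD _ _) _; rewrite !normcM !normcR normc_cis mulr1.
  rewrite (gtr0_norm r0) /r'.
  have dE : d = (1 - r) / 4 by [].
  have [k2|k2] := lerP 0 k; have [k3|k3] := lerP 0 (1 - k).
  - by rewrite (ger0_norm k2) (ger0_norm k3); nra.
  - by rewrite (ger0_norm k2) (ltr0_norm k3); nra.
  - by rewrite (ltr0_norm k2) (ger0_norm k3); nra.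
  - by exfalso; lra.
have [B hB] := bX _ r'1.
have B0 : 0 <= B.
  have [] := hB p; last by move=> + _; apply: le_trans; exact: normc_ge0.
  by rewrite /r'; lra.
pose K := 1 + r / (r - normc p).
have K0 : 0 <= r / (r - normc p) by rewrite divr_ge0 // ltW.
have cK t : normc (c t) <= K.
  rewrite normcM normcV nrc (@le_trans _ _ (r / (r - normc p))) ?lerDr //.
  by rewrite ler_pM2l // lef_pV2 ?posrE // (lt_le_trans rp0).
pose h (k t : R) := X (g k t) * c t.
pose h' (k t : R) := X' (g k t) * (r%:C%C * cis t).
have dgk k t : cderive (g^~ t) k (r%:C%C * cis t - p).
  apply: eq_cderive (cderiveD (cderive_cst p k) (cderiveM
    (cderiveR (is_derive_id k 1)) (cderive_cst (r%:C%C * cis t - p) k))) _.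
  by rewrite rmorph1; ring.
have dgt k t : cderive (g k) t (k%:C * (r%:C * ('i * cis t)))%C.
  apply: eq_cderive (cderiveD (cderive_cst p t) (cderiveM (cderive_cst k%:C%C t)
    (cderiveB (cderiveM (cderive_cst r%:C%C t) (cderive_cis (is_derive_id t 1)))
    (cderive_cst p t)))) _.
  by rewrite rmorph1; ring.
have ck t : curve_in (- d) (1 + d) r' (r + normc p) (g^~ t) (fun=> r%:C%C * cis t - p).
  move=> k kd; split; [exact: gr| |exact: dgk].
  by apply: le_trans (le_normcD _ _) _; rewrite normcN nrc.
have ct k t : - d < k < 1 + d ->
    curve_in (t - 1) (t + 1) r' (2 * r) (g k) (fun x => k%:C * (r%:C * ('i * cis x)))%C.
  move=> kd x _; split; [exact: gr| |exact: dgt].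
  rewrite !normcM !normcR normc_cis (_ : normc ('i%C : R[i]) = 1) ?mulr1; last first.
    by rewrite /normc /= expr0n expr1n add0r sqrtr1.
  rewrite (gtr0_norm r0) ler_pM2r // ler_norml.
  by move: kd => /andP[]; rewrite /d; lra.
have tt (t : R) : t - 1 < t < t + 1 by lra.
have cc t : ccont c t.
  apply: (@cderive_ccont _ _ _ _ (cderiveM
    (cderiveM (cderive_cst r%:C%C t) (cderive_cis (is_derive_id t 1))) (cderiveV (den t)
    (cderiveB (cderiveM (cderive_cst r%:C%C t) (cderive_cis (is_derive_id t 1)))
    (cderive_cst p t))))).
have dh : forall k, - d < k < 1 + d ->
    cderive (fun k => cint1 (h k)) k (cint1 (h' k)).
  apply: (@cint_derive R (fun=> 1) _ _ (B * K)).
  - exact: integrable1.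
  - move=> k kd; apply: ccont_cmeas => t; apply: ccontM; last exact: cc.
    by have [/cderive_ccont] := dX _ _ _ _ _ _ r'1 (ct k t kd) t (tt t).
  - move=> k t kd _.
    have [dd _] := dX _ _ _ _ _ _ r'1 (ck t) k kd.
    apply: eq_cderive (cderiveM dd (cderive_cst (c t) k)) _.
    by rewrite mulr0 addr0 /h' /c; field; exact: den.
  - move=> k t kd _; rewrite normcM; have [b _] := hB _ (gr k t kd).
    by apply: ler_pM => //; exact: normc_ge0.
  - move=> k t kd _; rewrite normcM nrc; have [_ b] := hB _ (gr k t kd).
    by apply: ler_pM; rewrite ?normc_ge0 ?(ltW r0) // /K; lra.
pose M k := Re (cint1 (h k)).
have dM k : - d < k < 1 + d -> is_derive k 1 M (Re (cint1 (h' k))).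
  by move=> kd; case: (dh k kd).
(* The division by [k] confines this to [k > 0]; the endpoint [k = 0] is reached by continuity of
   [M]. *)
have z0 k : 0 < k < 1 -> Re (cint1 (h' k)) = 0.
  move=> /andP[k0 k1]; have kd : - d < k < 1 + d by lra.
  rewrite Re_cint1.
  apply: (@circ_FTC _ (fun t => k^-1 * Im (X (g k t)))).
  - move=> t; have [[_ dI] _] := dX _ _ _ _ _ _ r'1 (ct k t kd) t (tt t).
    refine (is_derive_eq (fderiveM (is_derive_cst k^-1 _ _) dI) _).
    rewrite mulr0 addr0 /h' /cst !Cexpr /=; field.
    by rewrite gt_eqF.
  - move=> t.
    have [_ cX'] := dX _ _ _ _ _ _ r'1 (ct k t kd) t (tt t).
    have [] // : ccont (h' k) t.
    apply: ccontM => //; apply: ccontM; first exact: ccont_cst.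
    exact: cderive_ccont (cderive_cis (is_derive_id t 1)).
  - by rewrite /g /cis cos0 sin0 mulr_natl cos2pi sin2pi.
have M10 : M 1 = M 0.
  apply: derive0_const.
  - move=> k k01; rewrite -(z0 k k01); apply: dM; lra.
  - by apply: derivable_continuous (dM 0 _); lra.
  - by apply: derivable_continuous (dM 1 _); lra.
rewrite -!Re_cint1 (_ : cint1 _ = cint1 (h 1)); last first.
  by congr cint1; apply/funext => t; rewrite /h /g rmorph1 mul1r addrC subrK.
rewrite [RHS](_ : _ = M 0) //; congr (Re (cint1 _)).
by apply/funext => t; rewrite /h /g rmorph0 mul0r addr0.
Qed.

End MeanValue.

Section Poisson.
Variable R : realType.
Notation mu := (@lebesgue_measure R).
Implicit Types (X Y : R[i] -> R[i]) (p : R[i]) (r : R).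

Lemma holo_circle X r t : holo X -> 0 <= r < 1 ->
  ccont (fun t => X (r%:C%C * cis t)) t.
Proof.
move=> [X' [dX _]] /andP[r0 r1].
have cw : curve_in (t - 1) (t + 1) r r (fun t => r%:C%C * cis t)
    (fun t => r%:C * ('i * cis t))%C.
  move=> x _; split.
  - by rewrite normcM normcR normc_cis mulr1 ger0_norm.
  - rewrite !normcM normcR normc_cis mulr1 ger0_norm // ler_piMr //.
    by rewrite /normc /= expr0n expr1n add0r sqrtr1.
  - apply: eq_cderive (cderiveM (cderive_cst r%:C%C x)
      (cderive_cis (is_derive_id x 1))) _.
    by rewrite rmorph1; ring.
have [|d _] := dX _ _ _ _ _ _ r1 cw t; first by lra.
exact: cderive_ccont d.
Qed.

Lemma circ_const (c : R) : \int[mu]_(t in circle R) c = 2 * pi * c.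
Proof.
rewrite Rintegral_cst // mulrC; congr (_ * _).
exact: (congr1 fine (mu_circle R)).
Qed.

Lemma mean_value X r : holo X -> 0 < r < 1 ->
  \int[mu]_(t in circle R) Re (X (r%:C%C * cis t)) = 2 * pi * Re (X 0).
Proof.
move=> hX /andP[r0 r1].
have := @cauchy_contraction _ _ 0 _ hX; rewrite normc0 => /(_ _ r0 r1) /=.
have e (t : R) : r%:C%C * cis t / (r%:C%C * cis t - 0) = 1.
  rewrite subr0 divff // mulf_neq0 ?cis_neq0 // eq_complex /= negb_and.
  by rewrite gt_eqF.
under eq_Rintegral do rewrite e mulr1.
by under [in X in _ = X]eq_Rintegral do rewrite e mulr1; rewrite circ_const.
Qed.

Definition poisson p r (t : R) := (r ^+ 2 - sqn p) / sqn (r%:C%C * cis t - p).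

Lemma Re_conj (z : R[i]) : Re z^*%C = Re z. Proof. by case: z. Qed.

Lemma conj_cis t : (cis t)^*%C = (cis t)^-1 :> R[i].
Proof.
apply: (mulIf (cis_neq0 t)); rewrite mulVf ?cis_neq0 //.
apply: complexP; rewrite !Cexpr /=; last by ring.
by rewrite mulNr opprK -!expr2 cos2Dsin2.
Qed.

Lemma conjM (z w : R[i]) : (z * w)^*%C = z^*%C * w^*%C.
Proof. by case: z w => a b [c d]; apply: complexP; rewrite /=; ring. Qed.

Lemma conjB (z w : R[i]) : (z - w)^*%C = z^*%C - w^*%C.
Proof. by case: z w => a b [c d]; apply: complexP; rewrite /=; ring. Qed.

Lemma conjV (z : R[i]) : (z^-1)^*%C = (z^*%C)^-1.
Proof. by case: z => a b; apply: complexP; rewrite /= sqrrN ?mulNr. Qed.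

Lemma conjc_RC (x : R) : (x%:C)^*%C = x%:C%C :> R[i].
Proof. by rewrite /= oppr0. Qed.

Lemma normc_conj (z : R[i]) : normc z^*%C = normc z.
Proof. by case: z => a b; rewrite /normc /= sqrrN. Qed.

Section Formula.
Variables (X : R[i] -> R[i]) (p : R[i]) (r : R).
Hypotheses (hX : holo X) (pr : normc p < r) (r1 : r < 1).

Let r0 : 0 < r. Proof. by apply: le_lt_trans pr; exact: normc_ge0. Qed.

(** An auxiliary radius [r < s < 1] with [normc p < r * s]: the first makes [X ((r / s) z)]
    available on the whole disc, the second keeps the zero of [k] below outside it. *)
Let s := (Num.max r (normc p / r) + 1) / 2.

Let m1 : Num.max r (normc p / r) < 1.
Proof. by rewrite gt_max r1 ltr_pdivrMr // mul1r. Qed.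

Let s1 : s < 1. Proof. rewrite /s; move: m1; lra. Qed.

Let rs : r < s.
Proof.
have := m1; rewrite gt_max /s => /andP[a b].
have : r <= Num.max r (normc p / r) by rewrite le_max lexx.
move: m1; lra.
Qed.

Let prs : normc p < r * s.
Proof.
rewrite mulrC -ltr_pdivrMr //.
have : normc p / r <= Num.max r (normc p / r) by rewrite le_max lexx orbT.
by move: m1; rewrite /s; lra.
Qed.

Let s0 : 0 < s. Proof. exact: lt_trans rs. Qed.
Let rs0 : 0 < r * s. Proof. by rewrite mulr_gt0. Qed.

Let rsC0 : (r * s)%:C%C != 0 :> R[i].
Proof. by rewrite eq_complex /= negb_and (gt_eqF rs0). Qed.

Let k z := 1 - p^*%C * z / (r * s)%:C%C.

Let k0 : k 0 = 1. Proof. by rewrite /k mulr0 mul0r subr0. Qed.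

Let k_lb z : normc z < 1 -> 1 - normc p / (r * s) <= normc (k z).
Proof.
move=> z1; apply: le_trans (le_normcB _ _); rewrite normc1 lerD2l lerN2.
rewrite !normcM normcV normcR.
rewrite (gtr0_norm rs0) normc_conj ler_pM2r ?invr_gt0 //.
by rewrite ler_piMr ?normc_ge0 // ltW.
Qed.

Let k_lb0 : 0 < 1 - normc p / (r * s).
Proof. by rewrite subr_gt0 (ltr_pdivrMr _ _ rs0) mul1r. Qed.

Let holo_k : holo k.
Proof.
apply: holoB; first exact: holo_cst.
by apply: holoM; [apply: holoM; [exact: holo_cst|exact: holo_id]|exact: holo_cst].
Qed.

Let k_neq0 z : normc z < 1 -> k z != 0.
Proof. by move=> z1; rewrite -normc_gt0 (lt_le_trans k_lb0) // k_lb. Qed.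

Let holo_kV : holo (fun z => (k z)^-1).
Proof. exact: holoV k_lb0 k_lb holo_k. Qed.

Let ncis (x : R) t : 0 < x -> normc (x%:C%C * cis t) = x.
Proof. by move=> x0; rewrite normcM normc_cis mulr1 normcR gtr0_norm. Qed.

Let c t := r%:C%C * cis t / (r%:C%C * cis t - p).

Let den t : r%:C%C * cis t - p != 0.
Proof.
rewrite -normc_gt0 (lt_le_trans _ (le_normcB _ _)) // ncis // subr_gt0 //.
Qed.

(** Since [cis t] has inverse [(cis t)^*], the conjugate of the Cauchy kernel on the circle of
    radius [r] is the restriction of the holomorphic function [1 / k] to the circle of radius
    [s]. *)
Let conj_c t : (c t)^*%C = (k (s%:C%C * cis t))^-1.
Proof.
have kk := k_neq0 (z := s%:C%C * cis t); rewrite ncis // in kk.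
have sC : s%:C%C != 0 :> R[i] by rewrite eq_complex /= negb_and gt_eqF.
have rC : r%:C%C != 0 :> R[i] by rewrite eq_complex /= negb_and gt_eqF.
have c0 := cis_neq0 t.
have e : r%:C%C / cis t - p^*%C =
    r%:C%C / cis t * (1 - p^*%C * (s%:C%C * cis t) / (r%:C%C * s%:C%C)).
  by field; rewrite sC rC c0.
have rsE : (r * s)%:C%C = r%:C%C * s%:C%C :> R[i] by rewrite rmorphM.
have := kk s1; rewrite /k rsE => kk1.
rewrite /c conjM conjV conjB conjM conjc_RC conj_cis e.
set b := 1 - _ in kk1 *.
by field; rewrite c0 rC kk1.
Qed.

(** Contraction replaces [X] by the constant [X p]. The real part is unchanged by conjugation, which
    turns the integrand into the holomorphic [(X p)^* / k], whose mean is its value at [0]. *)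
Lemma cauchy_formula :
  \int[mu]_(t in circle R) Re (X (r%:C%C * cis t) * c t) = 2 * pi * Re (X p).
Proof.
rewrite cauchy_contraction //.
have hZ : holo (fun z => (X p)^*%C * (k z)^-1).
  by apply: holoM; [exact: holo_cst|exact: holo_kV].
have := mean_value hZ (r := s); rewrite s0 s1 => /(_ isT).
rewrite k0 invr1 mulr1 Re_conj => <-.
apply: eq_Rintegral => t _.
by rewrite -conj_c -conjM Re_conj.
Qed.

(** The Poisson kernel is [Re c + Re (c^* - 1)], and the imaginary parts of [c] and [c^*] cancel.
    The extra integrand [X * (c^* - 1)] comes from a holomorphic function vanishing at [0], so it
    adds nothing to the Cauchy formula. *)
Lemma poisson_formula :
  \int[mu]_(t in circle R) (Re (X (r%:C%C * cis t)) * poisson p r t) =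
  2 * pi * Re (X p).
Proof.
have r01 : 0 <= r < 1 by rewrite ltW.
have hs : holo (fun z => X ((r / s)%:C%C * z) * ((k z)^-1 - 1)).
  apply: holoM.
    apply: holo_scale hX.
    by rewrite divr_ge0 ?ltW //= ltr_pdivrMr // mul1r.
  by apply: holoB; [exact: holo_kV|exact: holo_cst].
have := mean_value hs (r := s); rewrite s0 s1 => /(_ isT).
rewrite k0 invr1 subrr [X in Re X]mulr0 mulr0 => h0.
rewrite -cauchy_formula -[RHS]addr0 -h0.
have e t : X ((r / s)%:C%C * (s%:C%C * cis t)) = X (r%:C%C * cis t).
  by rewrite mulrA -rmorphM /= divfK // gt_eqF.
have cX t := holo_circle t hX r01.
have cR : continuous (fun t => Re (X (r%:C%C * cis t) * c t)).
  move=> t.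
  have [] // : ccont (fun t => X (r%:C%C * cis t) * c t) t.
  apply: ccontM; first exact: cX.
  apply: ccontM; first exact: (holo_circle t (@holo_id R) r01).
  apply: ccontV; first exact: den.
  apply: ccontD; last exact: ccont_cst.
  exact: (holo_circle t (@holo_id R) r01).
have cK : continuous (fun t => Re (X (r%:C%C * cis t) * ((k (s%:C%C * cis t))^-1 - 1))).
  move=> t.
  have [] // : ccont (fun t => X (r%:C%C * cis t) * ((k (s%:C%C * cis t))^-1 - 1)) t.
  apply: ccontM; first exact: cX.
  apply: ccontD; last exact: ccont_cst.
  by apply: (holo_circle t holo_kV); rewrite s1 ltW.
under [X in _ = _ + X]eq_Rintegral do rewrite e.
rewrite -RintegralD //; last 2 first.
- exact: circ_integrable_cont.
- exact: circ_integrable_cont.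
apply: eq_Rintegral => t _.
rewrite -conj_c.
have n0 : sqn (r%:C%C * cis t - p) != 0 by rewrite sqn_eq0.
have r2 : r ^+ 2 = sqn (r%:C%C * cis t) by rewrite -normc_sqr ncis.
have -> : poisson p r t = Re (c t) + Re ((c t)^*%C - 1).
  rewrite [in RHS]CReD Re_conj /c CReM CReV CImV /poisson r2.
  have nE : sqn (r%:C%C * cis t - p) =
    (Re (r%:C%C * cis t) - Re p) ^+ 2 + (Im (r%:C%C * cis t) - Im p) ^+ 2.
    by rewrite {1}/sqn !CReD !CImD !CReN !CImN.
  rewrite !(CReD _ (- p)) !(CImD _ (- p)) !CReN !CImN.
  have -> : Re (1 : R[i]) = sqn (r%:C%C * cis t - p) / sqn (r%:C%C * cis t - p).
    by rewrite divff.
  rewrite [X in _ - X / _]nE; move: n0; set n := sqn (_ - p) => n0.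
  by rewrite /sqn; field.
rewrite !CReM !CImD !CImN CReD CReN /= (_ : Im (c t)^*%C = - Im (c t)).
  by ring.
by case: (c t).
Qed.

End Formula.
End Poisson.

(** * The Herglotz integral *)

Section Herglotz.
Variable R : realType.
Notation mu := (@lebesgue_measure R).
Implicit Types (f g : R -> R) (z : R[i]).
Notation L1 f := (mu.-integrable (circle R) (EFin \o f)).

Lemma normc_cint_le f h (B : R) : L1 f -> cmeas h ->
  (forall s, circle R s -> normc (h s) <= B) ->
  normc (cint f h) <= 2 * (B * \int[mu]_(s in circle R) `|f s|).
Proof.
move=> fi mh hB; have [iR iI] := cint_integrable fi mh hB.
have fn := integrable_norm fi.
have bnd (p : R[i] -> R) : L1 (fun s => f s * p (h s)) ->
    (forall z, `|p z| <= normc z) ->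
    `|\int[mu]_(s in circle R) (f s * p (h s))| <=
      B * \int[mu]_(s in circle R) `|f s|.
  move=> ip pB; rewrite -RintegralZl //.
  apply: le_trans (le_normr_Rintegral _ ip) _ => //.
  apply: le_Rintegral => //.
  - exact: integrable_norm.
  - by under [_ \o _]eq_fun do rewrite /= EFinM; exact: integrableZl.
  - move=> s cs; rewrite normrM mulrC ler_wpM2r //.
    exact: le_trans (pB _) (hB _ cs).
apply: le_trans (normc_le _) _; rewrite mulr_natl mulr2n /= lerD //.
  exact: bnd (@normRe_le R).
exact: bnd (@normIm_le R).
Qed.

Lemma cintD f g h (B : R) : L1 f -> L1 g -> cmeas h ->
  (forall s, circle R s -> normc (h s) <= B) ->
  cint (fun s => f s + g s) h = cint f h + cint g h.
Proof.
move=> fi gi mh hB; have [a b] := cint_integrable fi mh hB.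
have [c d] := cint_integrable gi mh hB.
apply: complexP; rewrite !Cexpr /=.
  rewrite -(RintegralD _ a c) //.
  by apply: eq_Rintegral => s _; rewrite mulrDl.
rewrite -(RintegralD _ b d) //.
by apply: eq_Rintegral => s _; rewrite mulrDl.
Qed.

Lemma cintZl f h (k B : R) : L1 f -> cmeas h ->
  (forall s, circle R s -> normc (h s) <= B) ->
  cint (fun s => k * f s) h = k%:C%C * cint f h.
Proof.
move=> fi mh hB; have [a b] := cint_integrable fi mh hB.
apply: complexP; rewrite ?CReRM ?CImRM /=.
  rewrite -(RintegralZl _ _ a) //.
  by apply: eq_Rintegral => s _; rewrite mulrA.
rewrite -(RintegralZl _ _ b) //.
by apply: eq_Rintegral => s _; rewrite mulrA.
Qed.

Definition herg_kernel z (s : R) : R[i] := (cis s + z) / (cis s - z).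

Definition herg f z : R[i] := ((2 * pi)^-1)%:C%C * cint f (herg_kernel z).

(** A family closed under differentiation in [z], the derivative of [K n] being [n * K n.+1]; the
    Herglotz kernel is [2 * K 1 - 1]. *)
Let K (n : nat) z (s : R) : R[i] := cis s / (cis s - z) ^+ n.

Let cis_far z (r : R) s : normc z <= r -> 1 - r <= normc (cis s - z).
Proof.
by move=> zr; apply: le_trans (le_normcB _ _); rewrite normc_cis lerD2l lerN2.
Qed.

Let cis_sub_neq0 z s : normc z < 1 -> cis s - z != 0.
Proof.
move=> z1; rewrite -normc_gt0 (lt_le_trans _ (cis_far s (lexx _))) //.
by rewrite subr_gt0.
Qed.

Let KE z s : normc z < 1 -> herg_kernel z s = 2 * K 1 z s - 1.
Proof.
move=> z1; rewrite /herg_kernel /K expr1; have := cis_sub_neq0 s z1 => z0.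
by field.
Qed.

Let K_bound n z (r : R) s : normc z <= r -> r < 1 -> normc (K n z s) <= (1 - r) ^- n.
Proof.
move=> zr r1; rewrite /K normcM normcV normc_cis mul1r.
have X (w : R[i]) : normc (w ^+ n) = normc w ^+ n.
  by elim: n => [|n IH]; rewrite ?normc1 // !exprS normcM IH.
rewrite X lef_pV2 ?posrE ?exprn_gt0 ?subr_gt0 //; last first.
  by rewrite (lt_le_trans _ (cis_far s zr)) // subr_gt0.
by rewrite lerXn2r ?nnegrE ?normc_ge0 ?cis_far // subr_ge0 ltW.
Qed.

Let K_ccont n z s : normc z < 1 -> ccont (K n z) s.
Proof.
move=> z1.
have cc : ccont (fun s => cis s - z) s.
  exact: cderive_ccont (cderiveB (cderive_cis (is_derive_id s 1)) (cderive_cst z s)).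
have ce : ccont (fun s => (cis s - z) ^+ n) s.
  elim: n => [|n IH]; first exact: ccont_cst.
  by under [X in ccont X]eq_fun do rewrite exprS; exact: ccontM.
apply: ccontM; first exact: cderive_ccont (cderive_cis (is_derive_id s 1)).
by apply: ccontV => //; rewrite expf_neq0 // cis_sub_neq0.
Qed.

Let K_derive n (w : R -> R[i]) t d s : normc (w t) < 1 -> cderive w t d ->
  cderive (fun t => K n (w t) s) t (n%:R * K n.+1 (w t) s * d).
Proof.
move=> w1 dw.
have dX (m : nat) : cderive (fun t => (cis s - w t) ^+ m) t
    (- (m%:R * (cis s - w t) ^+ m.-1 * d)).
  elim: m => [|m IH].
    by apply: eq_cderive (cderive_cst 1 t) _; rewrite !mul0r oppr0.
  under [X in cderive X]eq_fun do rewrite exprS.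
  apply: eq_cderive (cderiveM (cderiveB (cderive_cst (cis s) t) dw) IH) _.
  case: m {IH} => [|m]; first by rewrite !expr0; ring.
  by rewrite /= exprS -!(natr1 m) -(natr1 m.+1) -(natr1 m); ring.
have z0 := cis_sub_neq0 s w1.
apply: eq_cderive (cderiveM (cderive_cst (cis s) t)
  (cderiveV (expf_neq0 n z0) (dX n))) _.
rewrite /K; case: n {dX} => [|n]; first by rewrite !mulr0n !mul0r !oppr0 mul0r mulr0 addr0.
rewrite /= !exprS; field.
by rewrite z0 expf_neq0.
Qed.

Let curve_K f n u v (r M : R) w w' : L1 f -> r < 1 ->
  curve_in u v r M w w' -> forall t, u < t < v ->
  cderive (fun t => cint f (K n (w t))) t (n%:R * cint f (K n.+1 (w t)) * w' t).
Proof.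
move=> fi r1 cw t tuv.
have w1 x : u < x < v -> normc (w x) < 1.
  by move=> xuv; have [wr _ _] := cw x xuv; exact: le_lt_trans r1.
have d0 m : 0 <= (1 - r) ^- m by rewrite invr_ge0 exprn_ge0 // subr_ge0 ltW.
have M0 : 0 <= M by have [_ + _] := cw t tuv; apply: le_trans; exact: normc_ge0.
have nn (m : nat) : normc (m%:R : R[i]) = m%:R.
  by rewrite -(rmorph_nat (real_complex R)) normcR ger0_norm.
pose B : R := (1 - r) ^- n + n%:R * (1 - r) ^- n.+1 * M.
have := @cint_derive R f u v B (fun t s => K n (w t) s)
  (fun t s => n%:R * K n.+1 (w t) s * w' t) fi.
move=> H.
apply: eq_cderive; first apply: H => //.
- by move=> x xuv; apply: ccont_cmeas => s; apply: K_ccont; exact: w1.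
- by move=> x s xuv _; apply: K_derive; [exact: w1|case: (cw x xuv)].
- move=> x s xuv _; have [wr _ _] := cw x xuv.
  by rewrite (le_trans (K_bound n s wr r1)) // lerDl !mulr_ge0.
- move=> x s xuv _; have [wr wM _] := cw x xuv.
  rewrite (normcM (_ * _)) (normcM _%:R) nn (@le_trans _ _ (n%:R * (1 - r) ^- n.+1 * M)) ?lerDr //.
  apply: ler_pM => //; first by rewrite mulr_ge0 ?normc_ge0.
    exact: normc_ge0.
  by rewrite ler_wpM2l // K_bound.
have [wr wM _] := cw t tuv.
rewrite (_ : (fun s => _) = fun s => (n%:R * w' t) * K n.+1 (w t) s); last first.
  by apply/funext => s; ring.
rewrite (@cintZ _ _ _ _ ((1 - r) ^- n.+1) fi) //; first by ring.
- by apply: ccont_cmeas => s; apply: K_ccont; exact: w1.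
- by move=> s _; exact: K_bound.
Qed.

Lemma herg_kernel_cmeas z : normc z < 1 -> cmeas (herg_kernel z).
Proof.
move=> z1; apply: ccont_cmeas => s; apply: ccontM.
  apply: ccontD; last exact: ccont_cst.
  exact: cderive_ccont (cderive_cis (is_derive_id s 1)).
apply: ccontV; first exact: cis_sub_neq0.
exact: cderive_ccont (cderiveB (cderive_cis (is_derive_id s 1)) (cderive_cst z s)).
Qed.

Lemma herg_kernel_bound z s : normc z < 1 ->
  normc (herg_kernel z s) <= 2 / (1 - normc z).
Proof.
move=> z1; have d0 : 0 < 1 - normc z by rewrite subr_gt0.
rewrite normcM normcV ler_pM ?normc_ge0 ?invr_ge0 ?normc_ge0 //.
  by rewrite (le_trans (le_normcD _ _)) // normc_cis; lra.
by rewrite lef_pV2 ?posrE ?(lt_le_trans d0) // cis_far.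
Qed.

Let hergE f z : L1 f -> normc z < 1 ->
  herg f z = ((2 * pi)^-1)%:C%C * (2 * cint f (K 1 z) - cint f (fun=> 1)).
Proof.
move=> fi z1; congr (_ * _).
have mK : cmeas (K 1 z) by apply: ccont_cmeas => s; exact: K_ccont.
have bK s : circle R s -> normc (K 1 z s) <= (1 - normc z) ^- 1.
  by move=> _; exact: K_bound.
have [iR iI] := cint_integrable fi mK bK.
have m1 : cmeas (fun=> 1 : R[i]) by apply: ccont_cmeas => s; exact: ccont_cst.
have [jR jI] := cint_integrable fi m1 (fun s _ => lexx (normc (1 : R[i]))).
have Zi g : L1 g -> L1 (fun s => 2 * g s).
  by move=> gi; under [_ \o _]eq_fun do rewrite /= EFinM; exact: integrableZl.
apply: complexP; rewrite !Cexpr.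
  transitivity (\int[mu]_(s in circle R) (2 * (f s * Re (K 1 z s)) - f s * Re (1 : R[i]))).
    by apply: eq_Rintegral => s _; rewrite KE // !Cexpr /=; ring.
  by rewrite (RintegralB (@measurable_circleR R) (Zi _ iR) jR) // (RintegralZl _ (@measurable_circleR R) iR) //=; ring.
transitivity (\int[mu]_(s in circle R) (2 * (f s * Im (K 1 z s)) - f s * Im (1 : R[i]))).
  by apply: eq_Rintegral => s _; rewrite KE // !Cexpr /=; ring.
by rewrite (RintegralB (@measurable_circleR R) (Zi _ iI) jI) // (RintegralZl _ (@measurable_circleR R) iI) //=; ring.
Qed.

Lemma eq_on_cderive (w v : R -> R[i]) (t a b : R) d : a < t < b ->
  (forall x, a < x < b -> w x = v x) -> cderive w t d -> cderive v t d.
Proof.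
move=> tab wv [dR dI].
have tin : t \in `]a, b[ by rewrite in_itv.
have n := near_in_itvoo tin.
split; [apply: near_eq_is_derive dR|apply: near_eq_is_derive dI].
  by apply: filterS n => x; rewrite in_itv /= => /wv ->.
by apply: filterS n => x; rewrite in_itv /= => /wv ->.
Qed.

Lemma holo_herg f : L1 f -> holo (herg f).
Proof.
move=> fi; exists (fun z => ((2 * pi)^-1)%:C%C * (2 * cint f (K 2 z))).
split=> [u v r M w w' r1 cw t tuv|r r1].
  have w1 x : u < x < v -> normc (w x) < 1.
    by move=> xuv; have [wr _ _] := cw x xuv; exact: le_lt_trans r1.
  have d1 := curve_K 1 fi r1 cw tuv.
  have d2 := curve_K 2 fi r1 cw tuv.
  have dE : cderive (fun x => ((2 * pi)^-1)%:C%C * (2 * cint f (K 1 (w x)) - cint f (fun=> 1)))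
     t (((2 * pi)^-1)%:C%C * (2 * cint f (K 2 (w t))) * w' t).
    apply: eq_cderive (cderiveM (cderive_cst _ t) (cderiveB (cderiveM (cderive_cst 2 t) d1)
      (cderive_cst (cint f (fun=> 1)) t))) _.
    by rewrite mulr1n; ring.
  split.
    by apply: eq_on_cderive tuv _ dE => x xuv; rewrite hergE // w1.
  apply: ccontM; first exact: ccont_cst.
  apply: ccontM; first exact: ccont_cst.
  exact: cderive_ccont d2.
pose I := \int[mu]_(s in circle R) `|f s|.
have I0 : 0 <= I by apply: Rintegral_ge0.
pose B : R := 2 / (1 - r) + (1 - r) ^- 2.
have d0 : 0 < 1 - r by rewrite subr_gt0.
exists (`|(2 * pi)^-1| * (2 * (2 * (B * I)))) => z zr.
have z1 : normc z < 1 by exact: le_lt_trans r1.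
have B1 : 0 <= 2 / (1 - r) by rewrite divr_ge0 // ltW.
have B2 : 0 <= (1 - r) ^- 2 by rewrite invr_ge0 exprn_ge0 // ltW.
have B0 : 0 <= B by rewrite /B addr_ge0.
split; rewrite (normcM (_)%:C%C) normcR ler_wpM2l //.
  apply: (@le_trans _ _ (2 * (B * I))); last by rewrite ler_peMl ?mulr_ge0 // ler1n.
  apply: normc_cint_le => //; first exact: herg_kernel_cmeas.
  move=> s _; apply: le_trans (herg_kernel_bound s z1) _.
  rewrite /B (@le_trans _ _ (2 / (1 - r))) ?lerDl // ler_pM2l //.
  by rewrite lef_pV2 ?posrE ?subr_gt0 // lerD2l lerN2.
rewrite normcM (_ : normc 2 = 2); last first.
  by rewrite -(rmorph_nat (real_complex R)) normcR ger0_norm.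
rewrite ler_pM2l //; apply: normc_cint_le => //.
  by apply: ccont_cmeas => s; exact: K_ccont.
move=> s _; apply: le_trans (K_bound 2 s zr r1) _.
by rewrite /B lerDr.
Qed.

End Herglotz.

Section HerglotzFacts.
Variable R : realType.
Notation mu := (@lebesgue_measure R).
Implicit Types (f g : R -> R) (z p : R[i]) (r s t e : R).
Notation L1 f := (mu.-integrable (circle R) (EFin \o f)).

Lemma two_pi_gt0 : 0 < 2 * pi :> R.
Proof. by rewrite mulr_gt0 // pi_gt0. Qed.

Lemma hergD f g z : L1 f -> L1 g -> normc z < 1 ->
  herg (fun s => f s + g s) z = herg f z + herg g z.
Proof.
move=> fi gi z1; rewrite /herg.
rewrite (cintD fi gi (herg_kernel_cmeas z1) (fun s _ => herg_kernel_bound s z1)).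
by rewrite mulrDr.
Qed.

Lemma hergZ f (k : R) z : L1 f -> normc z < 1 ->
  herg (fun s => k * f s) z = k%:C%C * herg f z.
Proof.
move=> fi z1; rewrite /herg.
rewrite (cintZl k fi (herg_kernel_cmeas z1) (fun s _ => herg_kernel_bound s z1)).
by rewrite mulrCA.
Qed.

Lemma L1Z f (k : R) : L1 f -> L1 (fun s => k * f s).
Proof.
by move=> fi; under [_ \o _]eq_fun do rewrite /= EFinM; exact: integrableZl.
Qed.

Lemma L1D f g : L1 f -> L1 g -> L1 (fun s => f s + g s).
Proof. by move=> fi gi; under [_ \o _]eq_fun do rewrite /= EFinD; exact: integrableD. Qed.

Lemma L1B f g : L1 f -> L1 g -> L1 (fun s => f s - g s).
Proof. by move=> fi gi; under [_ \o _]eq_fun do rewrite /= EFinB; exact: integrableB. Qed.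

Lemma L1cst (c : R) : L1 (fun=> c).
Proof. by apply: circ_integrable_cont => t; exact: cvg_cst. Qed.

Lemma hergB f g z : L1 f -> L1 g -> normc z < 1 ->
  herg (fun s => f s - g s) z = herg f z - herg g z.
Proof.
move=> fi gi z1; transitivity (herg (fun s => f s + -1 * g s) z).
  by congr (herg _ z); apply/funext => s; rewrite mulN1r.
rewrite (hergD fi (L1Z (-1) gi) z1) (hergZ (-1) gi z1).
by rewrite rmorphN rmorph1 mulN1r.
Qed.

Lemma Re_herg f z : Re (herg f z) =
  (2 * pi)^-1 * \int[mu]_(s in circle R) (f s * Re (herg_kernel z s)).
Proof. by rewrite CReRM. Qed.

Lemma Im_herg f z : Im (herg f z) =
  (2 * pi)^-1 * \int[mu]_(s in circle R) (f s * Im (herg_kernel z s)).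
Proof. by rewrite CImRM. Qed.

Lemma Re_herg_kernel z s :
  Re (herg_kernel z s) = (1 - sqn z) / sqn (cis s - z).
Proof.
have e : sqn (cis s) = 1 by rewrite -normc_sqr normc_cis expr1n.
rewrite CReM CReV CImV !CReD !CImD !CReN !CImN -{1}e /sqn; set n := _^-1.
rewrite !CReD !CImD !CReN !CImN in n *.
by rewrite -/n; ring.
Qed.

Lemma Im_herg_kernel z s : Im (herg_kernel z s) =
  2 * (Im z * Re (cis s) - Re z * Im (cis s)) / sqn (cis s - z).
Proof.
rewrite CImM CReV CImV !CReD !CImD !CReN !CImN; set n := _^-1.
by ring.
Qed.

Lemma Re_herg_kernel_ge0 z s : normc z < 1 -> 0 <= Re (herg_kernel z s).
Proof.
move=> z1; rewrite Re_herg_kernel divr_ge0 ?sqn_ge0 // -normc_sqr subr_ge0.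
by rewrite expr_le1 ?normc_ge0 // ltW.
Qed.

Lemma herg_ge0 f z : normc z < 1 -> (forall s, circle R s -> 0 <= f s) ->
  0 <= Re (herg f z).
Proof.
move=> z1 f0; rewrite Re_herg; apply: mulr_ge0.
  by rewrite invr_ge0 ltW // two_pi_gt0.
by apply: Rintegral_ge0 => s cs; rewrite mulr_ge0 ?f0 // Re_herg_kernel_ge0.
Qed.

Lemma herg_at0 f : herg f 0 = ((2 * pi)^-1 * \int[mu]_(s in circle R) f s)%:C%C.
Proof.
have e s : herg_kernel (0 : R[i]) s = 1.
  by rewrite /herg_kernel addr0 subr0 divff // cis_neq0.
apply: complexP; rewrite ?Re_herg ?Im_herg [RHS]/=.
  by congr (_ * _); apply: eq_Rintegral => s _; rewrite e /= mulr1.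
under eq_Rintegral do rewrite e /= mulr0.
by rewrite circ_const !mulr0.
Qed.

(** On the circle the conjugate of the Herglotz kernel is [(1 + a w) / (1 - a w)] at
    [w = r * cis t], with [a = z^* / r]. Choosing [normc z < r < 1] gives [normc a < 1], so this
    function of [w] is holomorphic on the disc and has mean [1]; multiplying it by [- i] gives the
    imaginary part. *)
Lemma herg_cst (c : R) z : normc z < 1 -> herg (fun=> c) z = c%:C%C.
Proof.
move=> z1.
pose r := (1 + normc z) / 2.
have zr : normc z < r by rewrite /r; lra.
have r1 : r < 1 by rewrite /r; lra.
have r0 : 0 < r by apply: le_lt_trans zr; exact: normc_ge0.
have rC : r%:C%C != 0 :> R[i] by rewrite eq_complex /= negb_and gt_eqF.
pose a := z^*%C / r%:C%C.
have na : normc a < 1.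
  rewrite /a normcM normcV normcR gtr0_norm // normc_conj.
  by rewrite ltr_pdivrMr // mul1r.
have a0 : 0 < 1 - normc a by rewrite subr_gt0.
have den w : normc w < 1 -> 1 - normc a <= normc (1 - a * w).
  move=> w1; apply: le_trans (le_normcB _ _); rewrite normc1 lerD2l lerN2.
  by rewrite normcM ler_piMr ?normc_ge0 // ltW.
have hK : holo (fun w => (1 + a * w) * (1 - a * w)^-1).
  have haw : holo (fun w => a * w) by apply: holoM; [exact: holo_cst|exact: holo_id].
  apply: holoM; first by apply: holoD => //; exact: holo_cst.
  by apply: holoV a0 den _; apply: holoB => //; exact: holo_cst.
have e t : (herg_kernel z t)^*%C =
    (1 + a * (r%:C%C * cis t)) * (1 - a * (r%:C%C * cis t))^-1.
  have c0 := cis_neq0 t.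
  have z0 : cis t - z != 0.
    rewrite -normc_gt0 (lt_le_trans _ (le_normcB _ _)) // normc_cis.
    by rewrite subr_gt0.
  have : (cis t - z)^*%C != 0 by rewrite conjc_eq0.
  rewrite /herg_kernel conjM conjV conjB conj_cis /a => d0.
  have -> : (cis t + z)^*%C = (cis t)^-1 + z^*%C.
    by rewrite -conj_cis; case: z {z0 d0 a na a0 den hK z1 zr} @r r1 r0 rC => x y *; apply: complexP; rewrite /= ?opprD.
  have e1 : (cis t)^-1 - z^*%C = (1 - z^*%C * cis t) / cis t by field.
  have d1 : 1 - z^*%C * cis t != 0.
    by apply: contraNneq d0 => d1; rewrite e1 d1 mul0r.
  have -> : z^*%C / r%:C%C * (r%:C%C * cis t) = z^*%C * cis t.
    by rewrite mulrA divfK.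
  by rewrite e1; field; rewrite c0 d1.
have mv := mean_value hK (r := r); rewrite r0 r1 in mv.
have {}mv := mv isT.
have mvI := mean_value (holoM (holo_cst (- 'i)%C) hK) (r := r).
rewrite r0 r1 in mvI; have {}mvI := mvI isT.
rewrite !mulr0 addr0 subr0 invr1 mulr1 in mv mvI.
have eR : \int[mu]_(t in circle R) Re (herg_kernel z t) = 2 * pi.
  rewrite -[RHS]mulr1 -[in RHS]mv; apply: eq_Rintegral => t _.
  have := congr1 (@complex.Re R) (e t); case: (herg_kernel z t) => x y /= <-.
  by [].
have eI : \int[mu]_(t in circle R) Im (herg_kernel z t) = 0.
  transitivity (\int[mu]_(t in circle R) (- Re (- 'i%C * ((1 + a * (r%:C%C * cis t)) / (1 - a * (r%:C%C * cis t)))))).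
    apply: eq_Rintegral => t _; rewrite -(e t).
    by case: (herg_kernel z t) => x y; rewrite !Cexpr /=; ring.
  have cI : L1 (fun t => Re (- 'i%C * ((1 + a * (r%:C%C * cis t)) / (1 - a * (r%:C%C * cis t))))).
    apply: circ_integrable_cont => t.
    have [] // := holo_circle t (holoM (holo_cst (- 'i)%C) hK) (r := r).
    by rewrite r1 ltW.
  have -> : (fun t => (- Re (- 'i%C * ((1 + a * (r%:C%C * cis t)) / (1 - a * (r%:C%C * cis t)))))) =
    (fun t => -1 * (Re (- 'i%C * ((1 + a * (r%:C%C * cis t)) / (1 - a * (r%:C%C * cis t)))))).
    by apply/funext => t; rewrite mulN1r.
  by rewrite RintegralZl // mvI /=; ring.
have kb := fun s (_ : circle R s) => herg_kernel_bound s z1.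
have [iR iI] := cint_integrable (L1cst 1) (herg_kernel_cmeas z1) kb.
apply: complexP; rewrite ?Re_herg ?Im_herg [RHS]/=.
  have -> : \int[mu]_(s in circle R) (c * Re (herg_kernel z s)) = c * (2 * pi).
    rewrite -eR -RintegralZl //.
    by under [_ \o _]eq_fun do rewrite -[Re _]mul1r.
  by rewrite mulrCA mulVf ?mulr1 // gt_eqF // two_pi_gt0.
have -> : \int[mu]_(s in circle R) (c * Im (herg_kernel z s)) = c * 0.
  rewrite -eI -RintegralZl //.
  by under [_ \o _]eq_fun do rewrite -[Im _]mul1r.
by rewrite !mulr0.
Qed.

End HerglotzFacts.

(** * Kernel estimates and Lebesgue points *)

Section Kernels.
Variable R : realType.
Notation mu := (@lebesgue_measure R).
Implicit Types (f g : R -> R) (z p : R[i]) (r s t e h x y : R).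
Notation L1 f := (mu.-integrable (circle R) (EFin \o f)).

Lemma ge1_pi : 1 <= pi :> R.
Proof. by rewrite (le_trans _ (pi_ge2 R)) // ler1n. Qed.

(** Up to [1] the mean value theorem applies with [cos >= cos 1]; from [1] to [pi - h] the sine
    stays above the smaller of [sin 1] and [sin h]. *)
Lemma sin_lower h : 0 < h < pi ->
  exists2 k : R, 0 < k & forall x, `|x| <= pi - h -> k * `|x| <= `|sin x|.
Proof.
move=> /andP[h0 hpi].
have p0 : 0 < pi :> R := pi_gt0 R.
have c1 : 0 < cos 1 :> R := cos1_gt0 R.
have s1 : 0 < sin 1 :> R by apply: sin_gt0_pi; rewrite ltr01 (lt_le_trans _ (pi_ge2 R)) // ltr1n.
have sh : 0 < sin h by apply: sin_gt0_pi; rewrite h0.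
pose m := Num.min (sin 1) (sin h).
have m0 : 0 < m by rewrite lt_min s1.
exists (Num.min (cos 1) (m / pi)); first by rewrite lt_min c1 divr_gt0.
have main x : 0 <= x -> x <= pi - h -> Num.min (cos 1) (m / pi) * x <= sin x.
  move=> x0 xh; have [x1|x1] := lerP x 1.
    apply: (@le_trans _ _ (cos 1 * x)); first by rewrite ler_wpM2r // ge_min lexx.
    move: x0; rewrite le_eqVlt => /predU1P[<-|x0]; first by rewrite mulr0 sin0.
    have dsin (y : R) : y \in `]0, x[%R -> is_derive y 1 (@sin R) (cos y).
      by move=> _; exact: is_derive_sin.
    have csin : {within `[0, x], continuous (@sin R)}.
      by apply: continuous_subspaceT; exact: continuous_sin.
    have [c] := @MVT R (@sin R) (@cos R) 0 x x0 dsin csin.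
    rewrite in_itv /= => /andP[c0 cx]; rewrite sin0 !subr0 => ->.
    rewrite ler_pM2r //.
    have [] := ltrP (cos c) (cos 1) => //.
    rewrite ltr_cos ?in_itv /= ?ler01 ?ge1_pi ?(ltW c0) //=.
      by move=> c1'; have := lt_trans c1' cx; rewrite ltNge x1.
    by rewrite (le_trans (ltW cx)) // (le_trans x1) // ge1_pi.
  have xpi : x <= pi by rewrite (le_trans xh) // gerBl ltW.
  apply: (@le_trans _ _ m).
    rewrite (@le_trans _ _ (m / pi * x)) //; first by rewrite ler_wpM2r // ge_min lexx orbT.
    by rewrite mulrAC ler_pdivrMr // ler_pM2l.
  have mono (a b : R) : - (pi / 2) <= a -> a <= b -> b <= pi / 2 -> sin a <= sin b.
    move=> pa ab bp; rewrite leNgt ltr_sin ?in_itv /= ?pa ?bp ?(le_trans pa ab) ?(le_trans ab bp) //.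
    by rewrite -leNgt.
  have [x2|x2] := lerP x (pi / 2).
    rewrite (@le_trans _ _ (sin 1)) ?ge_min ?lexx //; apply: mono => //; last exact: ltW.
    by rewrite (@le_trans _ _ 0) // oppr_le0 divr_ge0 // ltW.
  have -> : sin x = sin (pi - x) by rewrite sinB sinpi cospi mul0r sub0r mulN1r opprK.
  rewrite (@le_trans _ _ (sin h)) ?ge_min ?lexx ?orbT //; apply: mono; lra.
move=> x xh; have [x0|x0] := lerP 0 x.
  rewrite ger0_norm // in xh *; apply: le_trans (main _ x0 xh) _; exact: ler_norm.
rewrite ltr0_norm // in xh *; have nx : 0 <= - x by rewrite oppr_ge0 ltW.
by apply: le_trans (main _ nx xh) _; rewrite sinN -normrN ler_norm.
Qed.

Lemma normr_sin_le x : `|sin x| <= `|x|.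
Proof.
have main (y : R) : 0 <= y -> `|sin y| <= `|y|.
  rewrite le_eqVlt => /predU1P[<-|y0]; first by rewrite sin0 normr0.
  have dsin (u : R) : u \in `]0, y[%R -> is_derive u 1 (@sin R) (cos u).
    by move=> _; exact: is_derive_sin.
  have csin : {within `[0, y], continuous (@sin R)}.
    by apply: continuous_subspaceT; exact: continuous_sin.
  have [c _] := @MVT R (@sin R) (@cos R) 0 y y0 dsin csin.
  by rewrite sin0 !subr0 => ->; rewrite normrM ler_piMl // cos_max.
have [x0|x0] := lerP 0 x; first exact: main.
by rewrite -normrN -sinN -[`|x|]normrN; apply: main; rewrite oppr_ge0 ltW.
Qed.

Lemma kernel_den e s t : sqn (cis t - (1 - e)%:C%C * cis s) =
  e ^+ 2 + 4 * (1 - e) * sin ((s - t) / 2) ^+ 2.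
Proof.
have h : cos (s - t) = 1 - 2 * sin ((s - t) / 2) ^+ 2.
  rewrite {1}(splitr (s - t)) cosD; have := cos2Dsin2 ((s - t) / 2).
  by move=> /(canRL (addrK _)); rewrite !expr2 => ->; ring.
have ct := cos2Dsin2 t; have cs := cos2Dsin2 s.
have -> : 4 * (1 - e) * sin ((s - t) / 2) ^+ 2 = 2 * (1 - e) * (1 - cos (s - t)).
  by rewrite h; ring.
rewrite /sqn !Cexpr /= cosB.
transitivity ((cos t ^+ 2 + sin t ^+ 2) + (1 - e) ^+ 2 * (cos s ^+ 2 + sin s ^+ 2)
  - 2 * (1 - e) * (cos s * cos t + sin s * sin t)); first by ring.
by rewrite ct cs; ring.
Qed.

(** Extension by zero puts the truncated kernels for all [e] on the same domain, where they can be
    subtracted from one another and from the Herglotz kernel. *)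
Definition cot_trunc s e t : R :=
  if e < `|s - t| < 2 * pi - e then cot ((s - t) / 2) else 0.

Lemma conj_truncE f s e : conj_trunc f s e =
  (2 * pi)^-1 * \int[mu]_(t in circle R) (f t * cot_trunc s e t).
Proof.
rewrite /conj_trunc; congr (_ * _).
have -> : circle_away s e = circle R `&` [set t | e < `|s - t| < 2 * pi - e].
  by [].
rewrite Rintegral_mkcondr; apply: eq_Rintegral => t _.
rewrite /patch /cot_trunc; case: ifPn.
  by rewrite inE /= => ->.
by rewrite notin_setE /= => /negP/negbTE ->; rewrite mulr0.
Qed.

(** At distance [e] from the circle the Poisson kernel, and the difference between its conjugate and
    the cotangent truncated at the same scale [e], are both dominated by one approximate identity.
    Keeping [s] at distance [h] from the cut [0 = 2 pi] makes [|sin ((s - t) / 2)|] comparable with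
    [|s - t|]. *)
Lemma kernel_bounds (h : R) : 0 < h < pi ->
  exists2 C : R, 0 < C & forall s t e, h <= s <= 2 * pi - h -> circle R t ->
    0 < e <= 2^-1 -> e < h ->
    Re (herg_kernel ((1 - e)%:C%C * cis s) t) <= C * (e / (e ^+ 2 + (t - s) ^+ 2)) /\
    `|Im (herg_kernel ((1 - e)%:C%C * cis s) t) - cot_trunc s e t| <=
      C * (e / (e ^+ 2 + (t - s) ^+ 2)).
Proof.
move=> /andP[h0 hpi]; have p0 : 0 < pi :> R := pi_gt0 R.
have [|k k0 kP] := @sin_lower (h / 2).
  by apply/andP; split; lra.
pose c := Num.min 1 (k ^+ 2 / 2).
have c0 : 0 < c by rewrite lt_min ltr01 divr_gt0 // exprn_gt0.
exists ((2 + 2 / k) / c).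
  by rewrite divr_gt0 // addr_gt0 // divr_gt0.
move=> s t e /andP[hs sh] ct.
have /andP[t0 t2] : 0 <= t < 2 * pi by move: ct; rewrite /circle /= in_itv.
move=> /andP[e0 e12] eh.
set x := (s - t) / 2; set D := sqn (cis t - (1 - e)%:C%C * cis s).
have xb : `|x| <= pi - h / 2 by rewrite /x ler_norml; apply/andP; split; lra.
have kx := kP _ xb.
have ts : (t - s) ^+ 2 = 4 * x ^+ 2 by rewrite /x; field.
have DE : D = e ^+ 2 + 4 * (1 - e) * sin x ^+ 2 by exact: kernel_den.
have e20 : 0 < e ^+ 2 by rewrite exprn_gt0.
have den0 : 0 < e ^+ 2 + (t - s) ^+ 2 by rewrite ltr_pwDl // sqr_ge0.
have s2 : k ^+ 2 * x ^+ 2 <= sin x ^+ 2.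
  rewrite -exprMn -[X in X <= _]real_normK ?num_real // -[X in _ <= X]real_normK ?num_real //.
  by rewrite normrM (gtr0_norm k0) lerXn2r ?nnegrE ?mulr_ge0 // ltW.
have Dc : c * (e ^+ 2 + (t - s) ^+ 2) <= D.
  rewrite DE mulrDr lerD //.
    by apply: ler_piMl; [exact: ltW|rewrite /c ge_min lexx].
  rewrite ts; apply: (@le_trans _ _ (k ^+ 2 / 2 * (4 * x ^+ 2))).
    apply: ler_wpM2r; first by rewrite mulr_ge0 // sqr_ge0.
    by rewrite /c ge_min lexx orbT.
  have : 0 <= sin x ^+ 2 by rewrite sqr_ge0.
  by nra.
have D0 : 0 < D by apply: lt_le_trans Dc; rewrite mulr_gt0.
have DV : D^-1 <= c^-1 / (e ^+ 2 + (t - s) ^+ 2).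
  by rewrite -invfM lef_pV2 ?posrE // mulr_gt0.
have bnd (a : R) : a <= (2 + 2 / k) * e ->
    a / D <= (2 + 2 / k) / c * (e / (e ^+ 2 + (t - s) ^+ 2)).
  move=> ae; apply: (@le_trans _ _ ((2 + 2 / k) * e / D)).
    by rewrite ler_pM2r // invr_gt0.
  rewrite -!mulrA ler_pM2l ?addr_gt0 ?divr_gt0 // mulrCA ler_pM2l //.
have k20 : 0 < 2 / k by rewrite divr_gt0.
split.
  rewrite Re_herg_kernel -/D; apply: bnd.
  rewrite -normc_sqr normcM normc_cis mulr1 normcR.
  rewrite real_normK ?num_real //.
  have : 0 <= 2 / k * e by rewrite mulr_ge0 // ltW.
  by nra.
have ImE : Im (herg_kernel ((1 - e)%:C%C * cis s) t) = 2 * (1 - e) * sin (s - t) / D.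
  rewrite Im_herg_kernel -/D; congr (_ / _).
  by rewrite CReM CImM /= sinB; ring.
rewrite ImE /cot_trunc.
case: ifPn => [/andP[ex _]|nex].
  have ex' : e < 2 * `|x| by rewrite /x normrM [`|2^-1|]gtr0_norm //; lra.
  have x0 : 0 < `|x| by lra.
  have sx0 : 0 < `|sin x| by apply: lt_le_trans kx; rewrite mulr_gt0.
  have sx : sin x != 0 by rewrite -normr_gt0.
  (* The leading singularities cancel and a factor [e ^+ 2] remains; one power of [e] is then spent
     on [1 / |sin x| <= 2 / (k * e)]. *)
  have -> : 2 * (1 - e) * sin (s - t) / D - cot x = - (e ^+ 2 * cos x / sin x) / D.
    have -> : sin (s - t) = 2 * sin x * cos x.
      by rewrite {1}(splitr (s - t)) sinD -/x; ring.
    have D0' : D != 0 by rewrite gt_eqF.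
    have E : e ^+ 2 = D - 4 * (1 - e) * sin x ^+ 2 by rewrite DE; ring.
    by rewrite E /cot; field; rewrite sx D0'.
  rewrite normrM normrN (gtr0_norm (_ : 0 < D^-1)) ?invr_gt0 //.
  apply: bnd; rewrite (normrM (e ^+ 2 * cos x)) normfV (normrM (e ^+ 2)) (gtr0_norm e20).
  have cx : `|cos x| <= 1 := cos_max x.
  have sV : `|sin x|^-1 <= 2 / (k * e).
    rewrite -[2 / _]invrK lef_pV2 ?posrE ?invr_gt0 ?divr_gt0 ?mulr_gt0 //.
    by rewrite invf_div ler_pdivrMr //; nra.
  apply: (@le_trans _ _ (e ^+ 2 * 1 * (2 / (k * e)))).
    by apply: ler_pM; rewrite ?mulr_ge0 ?invr_ge0 // ?ler_pM2l // ltW.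
  have -> : e ^+ 2 * 1 * (2 / (k * e)) = 2 / k * e by field; rewrite !gt_eqF.
  by rewrite ler_pM2r // lerDr.
(* The truncated kernel is zero here because [t] is within [e] of [s], and the conjugate kernel
   alone is at most a multiple of [e / D]. *)
have ex : `|s - t| <= e.
  move: nex; rewrite negb_and -!leNgt => /orP[//|].
  have : `|s - t| <= 2 * pi - h by rewrite ler_norml; apply/andP; split; lra.
  by lra.
rewrite subr0 normrM (gtr0_norm (_ : 0 < D^-1)) ?invr_gt0 //; apply: bnd.
rewrite !normrM (gtr0_norm (_ : 0 < 2)) // (@ger0_norm _ (1 - e)); last by lra.
have sb : `|sin (s - t)| <= `|s - t| by exact: normr_sin_le.
have : 0 <= 2 / k * e by rewrite mulr_ge0 // ltW.
have : 0 <= `|sin (s - t)| by [].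
by nra.
Qed.

End Kernels.

(** * The truncated cotangent kernel *)

Section Truncation.
Variable R : realType.
Notation mu := (@lebesgue_measure R).
Implicit Types (f g : R -> R) (z p : R[i]) (r s t e h x y : R).
Notation L1 f := (mu.-integrable (circle R) (EFin \o f)).

Lemma circleP t : circle R t <-> 0 <= t < 2 * pi.
Proof. by rewrite /circle /= in_itv. Qed.

(** Writing the cotangent as [cos * sin / sin^2] and bounding the denominator below by [m ^+ 2]
    gives a continuous [g] that agrees with it wherever the truncation keeps it. *)
Lemma cot_trunc_measurable s e : 0 < e < pi ->
  measurable_fun setT (cot_trunc s e).
Proof.
move=> /andP[e0 epi].
have [|k k0 kP] := @sin_lower R (e / 2); first by apply/andP; split; lra.
pose m := k * (e / 2); have m0 : 0 < m by rewrite mulr_gt0 // divr_gt0.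
pose g t := cos ((s - t) / 2) * sin ((s - t) / 2) *
  (Num.max (m ^+ 2) (sin ((s - t) / 2) ^+ 2))^-1.
have -> : cot_trunc s e = (fun t => if e < `|s - t| < 2 * pi - e then g t else 0).
  apply/funext => t; rewrite /cot_trunc; case: ifPn => // /andP[te te2].
  set x := (s - t) / 2.
  have xE : `|x| = `|s - t| / 2 by rewrite normrM normfV [`|2|]ger0_norm.
  have kx : k * `|x| <= `|sin x| by apply: kP; rewrite xE; lra.
  have mx : m <= `|sin x|.
    by apply: le_trans kx; rewrite ler_pM2l // xE; lra.
  have sx : sin x != 0 by rewrite -normr_gt0 (lt_le_trans m0).
  rewrite /g -/x max_r; first by rewrite /cot; field.
  by rewrite -[X in _ <= X]real_normK ?num_real // lerXn2r ?nnegrE // ltW.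
have ms : measurable_fun setT (fun t : R => `|s - t|).
  by apply: continuous_measurable_fun => t;
    apply: cvg_norm; apply: cvgB; [exact: cvg_cst|exact: cvg_id].
apply: measurable_fun_ifT => //.
  by apply: measurable_and; apply: measurable_fun_ltr.
apply: continuous_measurable_fun => t.
have cx : (fun t => (s - t) / 2) @ t --> (s - t) / 2.
  by apply: cvgM; [apply: cvgB; [exact: cvg_cst|exact: cvg_id]|exact: cvg_cst].
have csin : (fun t => sin ((s - t) / 2)) @ t --> sin ((s - t) / 2).
  by apply: continuous_cvg cx; exact: continuous_sin.
have ccos : (fun t => cos ((s - t) / 2)) @ t --> cos ((s - t) / 2).
  by apply: continuous_cvg cx; exact: continuous_cos.
apply: cvgM; first exact: cvgM.
apply: cvgV; first by rewrite gt_eqF // lt_max exprn_gt0.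
have c2 : (fun t => sin ((s - t) / 2) ^+ 2) @ t --> sin ((s - t) / 2) ^+ 2.
  by rewrite expr2; under eq_fun do rewrite expr2; exact: cvgM.
rewrite maxr_absE; under eq_fun do rewrite maxr_absE.
apply: cvgM; last exact: cvg_cst.
apply: cvgD; first by apply: cvgD => //; exact: cvg_cst.
by apply: cvg_norm; apply: cvgB => //; exact: cvg_cst.
Qed.

Lemma FTC_closed f (F : R -> R) (a b : R) : a < b ->
  (forall x, a <= x <= b -> is_derive x 1 F (f x)) ->
  (forall x, a <= x <= b -> {for x, continuous f}) ->
  mu.-integrable `[a, b] (EFin \o f) /\
  \int[mu]_(x in `[a, b]) f x = F b - F a.
Proof.
move=> ab dF cf.
have cfw : {within `[a, b], continuous f}.
  apply/(continuous_within_itvP _ ab); split.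
  - by move=> x; rewrite in_itv /= => /andP[? ?]; apply: cf; rewrite !ltW.
  - by apply: cvg_at_right_filter; apply: cf; rewrite lexx ltW.
  - by apply: cvg_at_left_filter; apply: cf; rewrite lexx ltW.
split; first by apply: continuous_compact_integrable => //; exact: segment_compact.
rewrite /Rintegral (@continuous_FTC2 _ f F) //.
- split.
  + by move=> x; rewrite in_itv /= => /andP[? ?]; case: (dF x) => //; rewrite !ltW.
  + apply: cvg_at_right_filter.
    by apply: derivable_continuous (dF a _); rewrite lexx ltW.
  + apply: cvg_at_left_filter.
    by apply: derivable_continuous (dF b _); rewrite lexx ltW.
- move=> x; rewrite in_itv /= => /andP[? ?].
  by rewrite derive1E; apply: derive_val; apply: dF; rewrite !ltW.
Qed.

Lemma fderive_affine (k c t : R) : is_derive t 1 (fun t => k * t + c) k.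
Proof.
refine (is_derive_eq (fderiveD (fderiveM (is_derive_cst k t 1) (is_derive_id t 1))
  (is_derive_cst c t 1)) _).
by rewrite /= mulr0 addr0 addr0 mulr1.
Qed.

(** The antiderivative is [- 2 ln |sin ((s - t) / 2)|]. Its values at both edges of the removed arc
    are equal, and so are those at [0] and [2 pi]. *)
Lemma int_cot_trunc s e : 0 < e -> e < s -> s + e < 2 * pi ->
  \int[mu]_(t in circle R) cot_trunc s e t = 0.
Proof.
move=> e0 es se; have p0 : 0 < pi :> R := pi_gt0 R.
have ccot x : sin x != 0 -> {for x, continuous (@cot R)}.
  move=> sx; apply: cvgM; first exact: continuous_cos.
  by apply: cvgV => //; exact: continuous_sin.
pose A := `[0%R, s - e[%classic : set R; pose B := `]s + e, (2 * pi)%R[%classic : set R.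
have dis : [disjoint A & B].
  rewrite disj_set2E; apply/eqP/seteqP; split => // t [] /=.
  rewrite /A /B /= !in_itv /= => /andP[_ a] /andP[b _]; lra.
have mA : measurable A by exact: measurable_itv.
have mB : measurable B by exact: measurable_itv.
pose f t := cot ((s - t) / 2).
pose F1 t := - 2 * ln (sin (- 2^-1 * t + s / 2)).
pose F2 t := - 2 * ln (sin (2^-1 * t + - (s / 2))).
have cf t : sin ((s - t) / 2) != 0 -> {for t, continuous f}.
  move=> st; apply: (@continuous_comp _ _ _ (fun t => (s - t) / 2) (@cot R)); last exact: ccot.
  by apply: cvgM; [apply: cvgB; [exact: cvg_cst|exact: cvg_id]|exact: cvg_cst].
have [i1 I1] : mu.-integrable `[0%R, s - e] (EFin \o f) /\
    \int[mu]_(x in `[0%R, s - e]) f x = F1 (s - e) - F1 0.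
  apply: FTC_closed; first by lra.
    move=> t /andP[t0 t1].
    have a0 : 0 < sin (- 2^-1 * t + s / 2).
      by apply: sin_gt0_pi; apply/andP; split; lra.
    refine (is_derive_eq (fderiveM (is_derive_cst (- 2 : R) t 1)
      (@fderive_comp R (@ln R) (fun t => sin (- 2^-1 * t + s / 2)) t _ _ (is_derive1_ln a0)
      (@fderive_comp R (@sin R) (fun t => - 2^-1 * t + s / 2) t _ _ (is_derive_sin _)
        (fderive_affine _ _ t)))) _).
    rewrite mulr0 addr0 /cst /f /cot (_ : (s - t) / 2 = - 2^-1 * t + s / 2); last by field.
    by field; rewrite gt_eqF.
  move=> t /andP[t0 t1]; apply: cf.
  by rewrite gt_eqF //; apply: sin_gt0_pi; apply/andP; split; lra.
have [i2 I2] : mu.-integrable `[s + e, (2 * pi)%R] (EFin \o f) /\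
    \int[mu]_(x in `[s + e, (2 * pi)%R]) f x = F2 (2 * pi) - F2 (s + e).
  apply: FTC_closed; first by lra.
    move=> t /andP[t0 t1].
    have a0 : 0 < sin (2^-1 * t + - (s / 2)).
      by apply: sin_gt0_pi; apply/andP; split; lra.
    refine (is_derive_eq (fderiveM (is_derive_cst (- 2 : R) t 1)
      (@fderive_comp R (@ln R) (fun t => sin (2^-1 * t + - (s / 2))) t _ _ (is_derive1_ln a0)
      (@fderive_comp R (@sin R) (fun t => 2^-1 * t + - (s / 2)) t _ _ (is_derive_sin _)
        (fderive_affine _ _ t)))) _).
    rewrite mulr0 addr0 /cst /f /cot (_ : (s - t) / 2 = - (2^-1 * t + - (s / 2))); last by field.
    by rewrite sinN cosN; field; rewrite gt_eqF.
  move=> t /andP[t0 t1]; apply: cf.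
  rewrite (_ : (s - t) / 2 = - ((t - s) / 2)) ?sinN ?oppr_eq0; last by field.
  by rewrite gt_eqF //; apply: sin_gt0_pi; apply/andP; split; lra.
have iA : mu.-integrable A (EFin \o f).
  by apply: integrableS i1 => //; exact: subset_itv_co_cc.
have iB : mu.-integrable B (EFin \o f).
  by apply: integrableS i2 => //; exact: subset_itv_oo_cc.
have -> : \int[mu]_(t in circle R) cot_trunc s e t = \int[mu]_(t in A `|` B) f t.
  rewrite Rintegral_mkcond [RHS]Rintegral_mkcond; apply: eq_Rintegral => t _.
  rewrite /patch /cot_trunc -/(f t).
  have cE : (t \in circle R) = (0 <= t < 2 * pi) by apply/idP/idP; rewrite inE circleP.
  have AE : (t \in A `|` B) = (0 <= t < s - e) || (s + e < t < 2 * pi).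
    by apply/idP/orP; rewrite inE /A /B /= !in_itv /=.
  rewrite cE AE (_ : point = 0 :> R) //.
  case: (ltrP t s) => ts.
    have [t0|t0] := lerP 0 t; last first.
      by rewrite /= ifF //; apply/negP => /andP[]; lra.
    have -> : t < 2 * pi by lra.
    have -> : (s + e < t) = false by apply/negbTE; rewrite -leNgt; lra.
    have -> : s - t < 2 * pi - e by lra.
    by rewrite /= orbF andbT ltrBrDl -ltrBrDr.
  have -> : 0 <= t by lra.
  have -> : (t < s - e) = false by apply/negbTE; rewrite -leNgt; lra.
  rewrite /=; have [t2|t2] := ltrP t (2 * pi); last by rewrite andbF.
  have -> : t - s < 2 * pi - e by lra.
  by rewrite !andbT ltrBrDl.
rewrite Rintegral_setU //; last first.
  have /integrableP[mfA fA] := iA; have /integrableP[mfB fB] := iB.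
  apply/integrableP; split; first exact/measurable_funU.
  rewrite ge0_integral_setU //; first exact: lte_add_pinfty.
  by apply: measurableT_comp => //; exact/measurable_funU.
rewrite /A /B Rintegral_itv_bndo_bndc // I1.
rewrite Rintegral_itv_obnd_cbnd // Rintegral_itv_bndo_bndc; last first.
  by apply: integrableS i2 => //; exact: subset_itv_co_cc.
rewrite I2 /F1 /F2.
have -> : - 2^-1 * (s - e) + s / 2 = e / 2 by field.
have -> : 2^-1 * (s + e) + - (s / 2) = e / 2 by field.
have -> : - 2^-1 * 0 + s / 2 = s / 2 by field.
have -> : 2^-1 * (2 * pi) + - (s / 2) = pi - s / 2 by field.
rewrite sinB sinpi cospi mul0r sub0r mulN1r opprK.
by ring.
Qed.

End Truncation.

(** * Approximate identities, Lebesgue points and radial limits *)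

Section RadialConvergence.
Variable R : realType.
Notation mu := (@lebesgue_measure R).
Implicit Types (f g : R -> R) (z p : R[i]) (r s t e h x y A : R).
Notation L1 f := (mu.-integrable (circle R) (EFin \o f)).

(** The Poisson kernel of a half-plane, up to the factor [pi]. *)
Definition kpeak e s t : R := e / (e ^+ 2 + (t - s) ^+ 2).

Definition indb s r : R -> R := \1_(ball s r).

Lemma indbE s r t : indb s r t = (`|t - s| < r)%R%:R.
Proof.
rewrite /indb indicE; congr (_%:R); rewrite /ball /= distrC.
by congr nat_of_bool; apply/idP/idP; rewrite inE.
Qed.

Lemma indb_ge0 s r t : 0 <= indb s r t.
Proof. by rewrite indbE. Qed.

Lemma indb_le1 s r t : `|indb s r t| <= 1.
Proof. by rewrite indbE ger0_norm // lern1; case: (_ < _). Qed.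

Lemma indb_measurable s r : measurable_fun setT (indb s r).
Proof. by apply: measurable_indic; exact: measurable_ball. Qed.

Lemma L1_indb g s r : L1 g -> L1 (fun t => g t * indb s r t).
Proof.
move=> gi; apply: (circ_integrableM (B := 1)) => //.
  by apply: measurable_funTS; exact: indb_measurable.
by move=> t _; exact: indb_le1.
Qed.

Lemma kpeak_ge0 e s t : 0 < e -> 0 <= kpeak e s t.
Proof. by move=> e0; rewrite divr_ge0 ?(ltW e0) // addr_ge0 ?sqr_ge0. Qed.

Lemma kpeak_den e s t : 0 < e -> 0 < e ^+ 2 + (t - s) ^+ 2.
Proof. by move=> e0; rewrite ltr_pwDl ?sqr_ge0 // exprn_gt0. Qed.

Lemma kpeak_le e s t : 0 < e -> kpeak e s t <= e^-1.
Proof.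
move=> e0; rewrite ler_pdivrMr ?kpeak_den // mulrDr expr2 mulKf ?gt_eqF //.
by rewrite lerDl mulr_ge0 ?sqr_ge0 // invr_ge0 ltW.
Qed.

Lemma kpeak_measurable e s : 0 < e -> measurable_fun setT (kpeak e s).
Proof.
move=> e0; apply: continuous_measurable_fun => t.
apply: cvgM; first exact: cvg_cst.
apply: cvgV; first by rewrite gt_eqF // kpeak_den.
apply: cvgD; first exact: cvg_cst.
rewrite expr2; under eq_fun do rewrite expr2.
by apply: cvgM; (apply: cvgB; [exact: cvg_id|exact: cvg_cst]).
Qed.

Lemma L1_kpeak g e s : 0 < e -> L1 g -> L1 (fun t => g t * kpeak e s t).
Proof.
move=> e0 gi; apply: (circ_integrableM (B := e^-1)) => //.
  by apply: measurable_funTS; exact: kpeak_measurable.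
by move=> t _; rewrite ger0_norm ?kpeak_ge0 // kpeak_le.
Qed.

(** A step majorant of the peak: where [2 ^ (k - 1) * e <= |t - s| < 2 ^ k * e], the peak is at most
    [4 / (4 ^ k * e)]. *)
Definition kdyad N e s t : R :=
  \sum_(k < N.+1) 4 / (4 ^+ k * e) * indb s (2 ^+ k * e) t.

Lemma kdyad_ge0 N e s t : 0 < e -> 0 <= kdyad N e s t.
Proof.
move=> e0; apply: sumr_ge0 => k _; rewrite mulr_ge0 ?indb_ge0 //.
by rewrite divr_ge0 // mulr_ge0 ?exprn_ge0 // ltW.
Qed.

Lemma kpeak_dyad N e s t : 0 < e -> `|t - s| < 2 ^+ N * e ->
  kpeak e s t <= kdyad N e s t.
Proof.
move=> e0; elim: N => [|N IH] ts.
  rewrite /kdyad big_ord1 !expr0 !mul1r indbE; rewrite expr0 mul1r in ts.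
  rewrite ts mulr1 (le_trans (kpeak_le s t e0)) // ler_pMl ?invr_gt0 //.
  by rewrite ler1n.
have := ltrP `|t - s| (2 ^+ N * e); case=> tN.
  rewrite (le_trans (IH tN)) // /kdyad [leRHS]big_ord_recr /= lerDl.
  by rewrite mulr_ge0 ?indb_ge0 // divr_ge0 // mulr_ge0 ?exprn_ge0 // ltW.
rewrite /kdyad big_ord_recr /= -[leLHS]add0r lerD ?kdyad_ge0 //.
rewrite indbE ts mulr1 exprS -mulrA invfM mulrA divff ?mul1r //.
have -> : (4 ^+ N * e)^-1 = e / (4 ^+ N * e ^+ 2).
  by field; rewrite expf_neq0 //= gt_eqF.
have q0 : 0 < 4 ^+ N * e ^+ 2 by rewrite mulr_gt0 // exprn_gt0.
rewrite /kpeak ler_pM2l // lef_pV2 ?posrE ?kpeak_den //.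
have : (2 ^+ N * e) ^+ 2 <= `|t - s| ^+ 2.
  by rewrite lerXn2r ?nnegrE ?mulr_ge0 ?exprn_ge0 ?(ltW e0).
rewrite real_normK ?num_real // exprMn exprAC (_ : 2 ^+ 2 = 4 :> R); last by ring.
by move=> h; rewrite (le_trans h) // lerDr sqr_ge0.
Qed.

(** The ball of radius [2 ^ k * e] contributes at most [8 * A / 2 ^ k], a geometric series of sum
    [16 * A]. *)
Lemma int_kdyad g A N e s : 0 < e -> L1 g ->
  (forall r, 0 < r -> \int[mu]_(t in circle R) (g t * indb s r t) <= 2 * r * A) ->
  L1 (fun t => g t * kdyad N e s t) /\
  \int[mu]_(t in circle R) (g t * kdyad N e s t) <= 16 * A * (1 - 2 ^- N.+1).
Proof.
move=> e0 gi gA.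
have term k : L1 (fun t => g t * (4 / (4 ^+ k * e) * indb s (2 ^+ k * e) t)) /\
    \int[mu]_(t in circle R) (g t * (4 / (4 ^+ k * e) * indb s (2 ^+ k * e) t)) <=
    8 * A / 2 ^+ k.
  have E : (fun t => g t * (4 / (4 ^+ k * e) * indb s (2 ^+ k * e) t)) =
      (fun t => 4 / (4 ^+ k * e) * (g t * indb s (2 ^+ k * e) t)).
    by apply/funext => t; rewrite mulrCA.
  rewrite E; have gb := L1_indb s (2 ^+ k * e) gi.
  split; first exact: L1Z.
  have p2 : 0 < 2 ^+ k :> R by rewrite exprn_gt0.
  have p4 : 0 < 4 ^+ k :> R by rewrite exprn_gt0.
  rewrite RintegralZl //.
  have -> : 8 * A / 2 ^+ k = 4 / (4 ^+ k * e) * (2 * (2 ^+ k * e) * A).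
    have -> : 4 ^+ k = 2 ^+ k * 2 ^+ k :> R by rewrite -exprMn; congr (_ ^+ _); ring.
    by field; rewrite !gt_eqF.
  by rewrite ler_wpM2l ?gA ?mulr_gt0 // divr_ge0 // mulr_ge0 // ltW.
elim: N => [|N [IHi IHb]].
  have [ti tb] := term 0%N.
  have -> : (fun t => g t * kdyad 0 e s t) =
      (fun t => g t * (4 / (4 ^+ 0 * e) * indb s (2 ^+ 0 * e) t)).
    by apply/funext => t; rewrite /kdyad big_ord1.
  split => //; apply: le_trans tb _.
  by rewrite expr0 expr1; lra.
have [ti tb] := term N.+1.
have -> : (fun t => g t * kdyad N.+1 e s t) =
    (fun t => g t * kdyad N e s t + g t * (4 / (4 ^+ N.+1 * e) * indb s (2 ^+ N.+1 * e) t)).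
  by apply/funext => t; rewrite /kdyad big_ord_recr /= mulrDr.
split; first exact: L1D.
rewrite RintegralD //; apply: le_trans (lerD IHb tb) _.
rewrite [2 ^+ N.+2]exprS invfM.
by rewrite le_eqVlt; apply/orP; left; apply/eqP; field; rewrite expf_neq0.
Qed.

Lemma int_kpeak_le g A e s : 0 < e -> L1 g -> (forall t, circle R t -> 0 <= g t) ->
  circle R s ->
  (forall r, 0 < r -> \int[mu]_(t in circle R) (g t * indb s r t) <= 2 * r * A) ->
  \int[mu]_(t in circle R) (g t * kpeak e s t) <= 16 * A.
Proof.
move=> e0 gi g0 cs gA.
(* The ball of radius [2 ^ N * e] about [s] then covers the whole circle. *)
have [N HN] : exists N, 2 * pi < 2 ^+ N * e.
  pose N := Num.trunc (2 * pi / e); exists N.+1.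
  rewrite -ltr_pdivrMr //.
  have h : 2 * pi / e < N.+1%:R by exact: truncnS_gt.
  apply: lt_le_trans h _.
  by rewrite -natrX ler_nat ltnW // ltn_expl.
have A0 : 0 <= A.
  have := gA 2^-1; rewrite invr_gt0 => /(_ (ltr0Sn _ _)).
  rewrite divff // mul1r; apply: le_trans; apply: Rintegral_ge0 => t ct.
  by rewrite mulr_ge0 ?g0 ?indb_ge0.
have [di db] := int_kdyad N e0 gi gA.
apply: (@le_trans _ _ (16 * A * (1 - 2 ^- N.+1))).
  apply: le_trans db; apply: le_Rintegral => //; first exact: L1_kpeak.
  move=> t ct; rewrite ler_wpM2l ?g0 //; apply: kpeak_dyad => //.
  apply: le_lt_trans HN; move/circleP: ct => /andP[t0 t2].
  move/circleP: cs => /andP[s0 s2].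
  by rewrite ler_norml; apply/andP; split; lra.
rewrite ler_piMr ?mulr_ge0 // gerBl invr_ge0 exprn_ge0 //.
Qed.

Lemma L1_restrict f : L1 f -> mu.-integrable setT (EFin \o (f \_ (circle R))).
Proof.
move=> fi; rewrite -restrict_EFin.
by apply/integrable_restrict => //; rewrite setTI.
Qed.

Lemma ae_lebesgue_pt f : L1 f -> {ae mu, forall s, lebesgue_pt (f \_ (circle R)) s}.
Proof.
move=> fi; apply: lebesgue_differentiation.
by apply: open_integrable_locally; [exact: openT|exact: L1_restrict].
Qed.

Lemma int_indb g s r : ball s r `<=` circle R -> L1 g ->
  \int[mu]_(t in circle R) (g t * indb s r t) = \int[mu]_(t in ball s r) g t.
Proof.
move=> br gi; rewrite -[X in _ = \int[mu]_(t in X) _](setIidr br) Rintegral_mkcondr.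
apply: eq_Rintegral => t _; rewrite /patch /indb indicE.
by case: (t \in _); rewrite ?mulr1 ?mulr0.
Qed.

Lemma lebesgue_pt_avg f s : L1 f -> 0 < s < 2 * pi ->
  lebesgue_pt (f \_ (circle R)) s -> forall A, 0 < A -> exists2 d : R, 0 < d &
  forall r, 0 < r <= d ->
    \int[mu]_(t in circle R) (`|f t - f s| * indb s r t) <= 2 * r * A.
Proof.
move=> fi /andP[s0 s2] /fine_cvgP[fin cv] A A0.
have gi : L1 (fun t => `|f t - f s|).
  by apply: integrable_norm; apply: L1B => //; exact: L1cst.
have cs : circle R s by apply/circleP; rewrite ltW.
have [d1 /= d10 d1P] : \forall r \near (0 : R)^'+,
    (davg (f \_ (circle R)) s r < A%:E)%E.
  move/cvgrPdist_lt : cv => /(_ _ A0) cv.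
  near=> r; have fr : davg (f \_ (circle R)) s r \is a fin_num by near: r.
  rewrite -(fineK fr) lte_fin; apply: le_lt_trans (ler_norm _) _.
  have : `|0 - fine (davg (f \_ (circle R)) s r)| < A by near: r.
  by rewrite sub0r normrN.
(* Besides the smallness of the averages, the ball has to stay inside [circle R], where [f] and its
   extension by zero agree. *)
pose d := Num.min (d1 / 2) (Num.min s (2 * pi - s)).
have d0 : 0 < d by rewrite !lt_min divr_gt0 // s0 subr_gt0.
exists d => // r /andP[r0 rd].
have : (davg (f \_ (circle R)) s r < A%:E)%E.
  apply: d1P => //=; rewrite sub0r normrN gtr0_norm //.
  apply: (le_lt_trans rd); rewrite (@le_lt_trans _ _ (d1 / 2)) //.
    by rewrite /d ge_min lexx.
  by rewrite ltr_pdivrMr // ltr_pMr // ltr1n.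
have br : ball s r `<=` circle R.
  move=> t; rewrite /ball /= => sr; apply/circleP.
  have : r <= s by rewrite (le_trans rd) // /d !ge_min lexx orbT.
  have : r <= 2 * pi - s by rewrite (le_trans rd) // /d !ge_min lexx !orbT.
  by move: sr; rewrite ltr_norml => /andP[a b] c1 c2; lra.
rewrite /davg /iavg (lebesgue_measure_ball _ (ltW r0)) => avgA.
rewrite int_indb // -lee_fin /Rintegral.
have E : (\int[mu]_(x in ball s r) (`|f x - f s|%R)%:E)%E =
  (\int[mu]_(y in ball s r) `|((center ((f \_ (circle R)) s) \o f \_ (circle R)) y)%:E|)%E.
  apply: eq_integral => y /set_mem sy.
  rewrite /= !patchE !mem_set //; exact: br.
have gb : mu.-integrable (ball s r) (EFin \o (fun t => `|f t - f s|)).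
  apply: (@integrableS _ _ _ mu (circle R : set (measurableTypeR R)) (ball s r : set (measurableTypeR R)) _ _ _ br gi) => //; exact: measurable_ball.
rewrite fineK; last by apply: integrable_fin_num => //; exact: measurable_ball.
rewrite E; move: avgA.
set I := (\int[mu]_(y in ball s r) _)%E.
have I0 : (0 <= I)%E by apply: integral_ge0.
have If : I \is a fin_num by rewrite /I -E; apply: integrable_fin_num => //; exact: measurable_ball.
rewrite inver -(fineK If) ifF; last by rewrite mulrn_eq0 /= gt_eqF.
rewrite -EFinM lte_fin lee_fin ltr_pdivrMl ?mulrn_wgt0 // => h.
by rewrite mulr_natl ltW.
Unshelve. all: by end_near. Qed.

(** Within distance [d] of [s] the averages are at most [A / 32], so the near part is at most
    [16 * (A / 32)]. Farther away the peak is at most [e / d ^+ 2], and the threshold on [e] makes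
    that part at most [A / 2] as well. *)
Lemma int_kpeak_cvg f s : L1 f -> 0 < s < 2 * pi ->
  lebesgue_pt (f \_ (circle R)) s -> forall A, 0 < A -> exists2 d : R, 0 < d &
  forall e, 0 < e < d ->
    \int[mu]_(t in circle R) (`|f t - f s| * kpeak e s t) <= A.
Proof.
move=> fi s02 ls A A0.
have cs : circle R s by apply/circleP; lra.
pose g t := `|f t - f s|.
have gi : L1 g.
  by apply: integrable_norm; apply: L1B => //; exact: L1cst.
have A32 : 0 < A / 32 by rewrite divr_gt0.
have [d d0 dP] := lebesgue_pt_avg fi s02 ls A32.
pose G := \int[mu]_(t in circle R) g t.
have g0 t : 0 <= g t by rewrite /g.
have G0 : 0 <= G by apply: Rintegral_ge0 => t _; exact: g0.
exists (d ^+ 2 * (A / 2) / (G + 1)).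
  by rewrite divr_gt0 ?mulr_gt0 ?exprn_gt0 ?divr_gt0 // ltr_wpDl.
move=> e /andP[e0 ed].
pose g1 t := g t * indb s d t.
have g1i : L1 g1 by exact: L1_indb.
have g1A : \int[mu]_(t in circle R) (g1 t * kpeak e s t) <= 16 * (A / 32).
  apply: int_kpeak_le => //.
    by move=> t _; rewrite mulr_ge0 ?indb_ge0.
  move=> r r0; have [rd|rd] := lerP r d.
    apply: (@le_trans _ _ (\int[mu]_(t in circle R) (g t * indb s r t))).
      apply: le_Rintegral => //; [exact: L1_indb|exact: L1_indb|].
      move=> t _; rewrite ler_wpM2r ?indb_ge0 // ler_piMr ?g0 //.
      by rewrite (le_trans (ler_norm _)) // indb_le1.
    by apply: dP; rewrite r0.
  apply: (@le_trans _ _ (\int[mu]_(t in circle R) (g t * indb s d t))).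
    apply: le_Rintegral => //; [exact: L1_indb| ].
    move=> t _; rewrite ler_piMr ?mulr_ge0 ?g0 ?indb_ge0 //.
    by rewrite (le_trans (ler_norm _)) // indb_le1.
  apply: le_trans (dP d _) _; first by rewrite d0 /=.
  by rewrite ler_wpM2r ?(ltW A32) // ler_pM2l // ltW.
have far : \int[mu]_(t in circle R) ((g t - g1 t) * kpeak e s t) <= e / d ^+ 2 * G.
  have gg : L1 (fun t => (g t - g1 t)) by exact: L1B.
  rewrite /G -RintegralZl //; apply: le_Rintegral => //.
  - exact: L1_kpeak.
  - exact: L1Z.
  - move=> t _; rewrite /g1 indbE; have [td|td] := ltrP `|t - s| d.
      by rewrite mulr1 subrr mul0r mulr_ge0 ?g0 // divr_ge0 ?exprn_ge0 // ltW.
    rewrite mulr0 subr0 mulrC ler_wpM2r ?g0 // /kpeak ler_pM2l //.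
    rewrite lef_pV2 ?posrE ?kpeak_den ?exprn_gt0 //.
    have : d ^+ 2 <= `|t - s| ^+ 2 by rewrite lerXn2r ?nnegrE ?(ltW d0).
    by rewrite real_normK ?num_real // => h; rewrite (le_trans h) // lerDr sqr_ge0.
have -> : (fun t => `|f t - f s| * kpeak e s t) =
    (fun t => g1 t * kpeak e s t + (g t - g1 t) * kpeak e s t).
  by apply/funext => t; rewrite -/(g t); ring.
rewrite RintegralD //; first last.
- by apply: L1_kpeak => //; exact: L1B.
- exact: L1_kpeak.
have : e / d ^+ 2 * G <= A / 2.
  move: ed; rewrite ltr_pdivlMr ?ltr_wpDl // => ed.
  rewrite mulrAC ler_pdivrMr ?exprn_gt0 // [leRHS]mulrC (le_trans _ (ltW ed)) //.
  by rewrite ler_pM2l // lerDl.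
move=> h; apply: le_trans (lerD g1A (le_trans far h)) _.
by have -> : 16 * (A / 32) + A / 2 = A by field.
Qed.

Section RadialLimits.
Variables (f : R -> R) (s : R).
Hypotheses (fi : L1 f) (s02 : 0 < s < 2 * pi).
Hypothesis ls : lebesgue_pt (f \_ (circle R)) s.

(** Constants have Herglotz integral equal to themselves, hence real, and the truncated cotangent
    has integral zero. So [f] may be replaced by [f - f s] in both differences, whose kernels are
    dominated by [kpeak]. *)
Lemma radial_estimate : forall A, 0 < A -> exists2 d : R, 0 < d & forall e, 0 < e < d ->
  `|Re (herg f ((1 - e)%:C%C * cis s)) - f s| <= A /\
  `|Im (herg f ((1 - e)%:C%C * cis s)) - conj_trunc f s e| <= A.
Proof.
move=> A A0; have p0 := pi_gt0 R; have /andP[s0 s2] := s02.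
have [h [h0 hpi hs hs2]] : exists h, [/\ 0 < h, 0 < h < pi, h <= s & h <= 2 * pi - s].
  exists (Num.min (pi / 2) (Num.min s (2 * pi - s))).
  have m0 : 0 < Num.min (pi / 2) (Num.min s (2 * pi - s)).
    by rewrite !lt_min divr_gt0 // s0 subr_gt0.
  rewrite m0 /=; split => //; rewrite ?ge_min ?lexx ?orbT //.
  by rewrite gt_min; apply/orP; left; lra.
have [C C0 CP] := kernel_bounds hpi.
have AC : 0 < A / C by rewrite divr_gt0.
have [d1 d10 d1P] := int_kpeak_cvg fi s02 ls AC.
exists (Num.min d1 (Num.min 2^-1 h)).
  by rewrite !lt_min d10 h0 invr_gt0 ltr0n.
move=> e; rewrite !lt_min => /andP[e0 /andP[ed1 /andP[e1 eh]]].
have eh1 : 0 < e <= 2^-1 by rewrite e0 ltW.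
have hsh : h <= s <= 2 * pi - h by rewrite hs; lra.
set z := (1 - e)%:C%C * cis s.
have z1 : normc z < 1.
  by rewrite normcM normc_cis mulr1 normcR ger0_norm; lra.
pose g t := f t - f s.
have gi : L1 g by apply: L1B => //; exact: L1cst.
have ki : L1 (fun t => `|g t| * kpeak e s t).
  by apply: L1_kpeak => //; exact: integrable_norm.
have I1 : \int[mu]_(t in circle R) (`|g t| * kpeak e s t) <= A / C.
  by apply: d1P; rewrite e0.
have tp := two_pi_gt0 R.
have bound (k : R -> R) B : measurable_fun (circle R) k ->
    (forall t, circle R t -> `|k t| <= B) ->
    (forall t, circle R t -> `|k t| <= C * kpeak e s t) ->
    `|(2 * pi)^-1 * \int[mu]_(t in circle R) (g t * k t)| <= A.
  move=> mk kB kC.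
  have gk : L1 (fun t => g t * k t) by exact: (circ_integrableM gi mk kB).
  rewrite normrM ger0_norm ?invr_ge0 ?(ltW tp) //.
  apply: (@le_trans _ _ (1 * `|\int[mu]_(t in circle R) (g t * k t)|)).
    rewrite ler_wpM2r // invf_le1 //; have := pi_ge2 R; lra.
  rewrite mul1r; apply: le_trans (le_normr_Rintegral _ gk) _ => //.
  apply: (@le_trans _ _ (C * (A / C))); last by rewrite mulrC divfK // gt_eqF.
  apply: (@le_trans _ _ (C * \int[mu]_(t in circle R) (`|g t| * kpeak e s t))); last first.
    by rewrite ler_pM2l.
  rewrite -RintegralZl //; apply: le_Rintegral => //.
  - exact: integrable_norm.
  - exact: L1Z.
  - move=> t ct; rewrite normrM mulrCA ler_wpM2l // kC //.
have [mR mI] := herg_kernel_cmeas z1.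
have kb t : circle R t -> normc (herg_kernel z t) <= 2 / (1 - normc z).
  by move=> _; exact: herg_kernel_bound.
split.
  have -> : Re (herg f z) - f s = Re (herg g z).
    by rewrite /g (hergB fi (L1cst _) z1) (herg_cst _ z1) CReD CReN.
  rewrite Re_herg; apply: (bound _ (2 / (1 - normc z))) => //.
    by move=> t ct; apply: le_trans (normRe_le _) (kb _ ct).
  move=> t ct; rewrite ger0_norm ?Re_herg_kernel_ge0 //.
  by have [] := CP s t e hsh ct eh1 eh.
have epi : 0 < e < pi by rewrite e0; have := pi_ge2 R; lra.
have mc : measurable_fun (circle R) (cot_trunc s e).
  by apply: measurable_funTS; exact: cot_trunc_measurable.
have cB t : circle R t -> `|cot_trunc s e t| <= 2 / (1 - normc z) + C * e^-1.
  move=> ct; have [_ b] := CP s t e hsh ct eh1 eh.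
  rewrite -(subrK (Im (herg_kernel z t)) (cot_trunc s e t)).
  apply: le_trans (ler_normD _ _) _; rewrite addrC lerD //.
    exact: le_trans (normIm_le _) (kb _ ct).
  by rewrite distrC (le_trans b) // ler_pM2l // kpeak_le.
have fc : L1 (fun t => f t * cot_trunc s e t) by exact: (circ_integrableM fi mc cB).
have gc : L1 (fun t => g t * cot_trunc s e t) by exact: (circ_integrableM gi mc cB).
have [_ gI] := cint_integrable gi (herg_kernel_cmeas z1) kb.
have -> : Im (herg f z) - conj_trunc f s e =
    (2 * pi)^-1 * \int[mu]_(t in circle R) (g t * (Im (herg_kernel z t) - cot_trunc s e t)).
  have -> : Im (herg f z) = Im (herg g z).
    by rewrite /g (hergB fi (L1cst _) z1) (herg_cst _ z1) CImD CImN /= subr0.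
  have -> : conj_trunc f s e = (2 * pi)^-1 * \int[mu]_(t in circle R) (g t * cot_trunc s e t).
    rewrite conj_truncE; congr (_ * _).
    have ci : L1 (cot_trunc s e) by exact: (circ_integrable_bounded mc cB).
    have -> : (fun t => g t * cot_trunc s e t) =
        (fun t => f t * cot_trunc s e t - f s * cot_trunc s e t).
      by apply/funext => t; rewrite /g mulrBl.
    rewrite RintegralB //; last exact: L1Z.
    by rewrite RintegralZl // int_cot_trunc ?mulr0 ?subr0 //; lra.
  rewrite Im_herg -mulrBr; congr (_ * _).
  rewrite -RintegralB //; apply: eq_Rintegral => t _; rewrite mulrBr //.
apply: (bound _ (2 / (1 - normc z) + (2 / (1 - normc z) + C * e^-1))).
- exact: measurable_funB.
- move=> t ct; apply: le_trans (ler_normB _ _) _; rewrite lerD ?cB //.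
  exact: le_trans (normIm_le _) (kb _ ct).
- by move=> t ct; have [] := CP s t e hsh ct eh1 eh.
Qed.

End RadialLimits.

Lemma aeS (P Q : R -> Prop) : (forall x, P x -> Q x) ->
  {ae mu, forall x, P x} -> {ae mu, forall x, Q x}.
Proof.
move=> PQ [N [mN N0 NP]]; exists N; split => //.
by apply: subset_trans NP => x /=; apply: contra_not; exact: PQ.
Qed.

Lemma aeI (P Q : R -> Prop) : {ae mu, forall x, P x} -> {ae mu, forall x, Q x} ->
  {ae mu, forall x, P x /\ Q x}.
Proof.
move=> aP aQ; have := negligibleU aP aQ; apply: negligibleS => x /= /not_andP[]; by [left|right].
Qed.

Lemma L1_measurable f : L1 f -> measurable_fun (circle R) f.
Proof. by case/integrableP => /measurable_EFinP. Qed.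

Lemma L1norm f : L1 f -> L1 (fun t => `|f t|).
Proof. by move=> fi; apply: integrable_norm => //; exact: measurable_circleR. Qed.

Lemma circ_DCT (F : nat -> R -> R) f g :
  (forall n, measurable_fun (circle R) (F n)) -> measurable_fun (circle R) f ->
  {ae mu, forall t, circle R t -> F ^~ t @ \oo --> f t} -> L1 g ->
  (forall n t, circle R t -> `|F n t| <= g t) ->
  L1 f /\ \int[mu]_(t in circle R) F n t @[n --> \oo] --> \int[mu]_(t in circle R) f t.
Proof.
move=> mF mf Ff gi Fg.
have [] := @dominated_convergence _ _ _ mu (circle R : set (measurableTypeR R))
  (@measurable_circleR R) (fun n => EFin \o F n) (EFin \o f) (EFin \o g).
- by move=> n; apply/measurable_EFinP; exact: mF.
- by apply/measurable_EFinP; exact: mf.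
- by apply: aeS Ff => t h ct; apply: cvg_EFin; [exact: nearW|exact: h].
- exact: gi.
- by apply: aeW => t n ct; rewrite lee_fin Fg.
move=> fi _ cv; split; first exact: fi.
apply: fine_cvg; rewrite fineK; first exact: cv.
exact: integrable_fin_num.
Qed.

Definition locally_cst f s := exists2 d : R, 0 < d & forall t, `|t - s| < d -> f t = f s.

(** A continuous approximation is composed with rounding down to multiples of [1 / (n + 1)]. The
    jumps of the resulting step function sit at rational points, which form a null set. *)
Lemma step_density f A : L1 f -> 0 < A -> exists g, [/\ L1 g,
  \int[mu]_(t in circle R) `|f t - g t| <= A &
  forall s, ~ (range ratr : set R) s -> locally_cst g s].
Proof.
move=> fi A0.
have mc : (mu (circle R) < +oo)%E := mu_circle_lty R.
have [G [cG iG]] := @approximation_continuous_integrable R (circle R) f (@measurable_circleR R) mc fi.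
move=> /fine_cvgP[finG cvG].
have [N [NG NGf]] : exists N, (\int[mu]_(z in circle R) `|(f z - G N z)%:E|)%E \is a fin_num /\
    fine (\int[mu]_(z in circle R) `|(f z - G N z)%:E|)%E < A / 2.
  have A2 : 0 < A / 2 by rewrite divr_gt0.
  move/cvgrPdist_lt : cvG => /(_ _ A2) cvG.
  have : \forall n \near \oo, (\int[mu]_(z in circle R) `|(f z - G n z)%:E|)%E \is a fin_num /\
    fine (\int[mu]_(z in circle R) `|(f z - G n z)%:E|)%E < A / 2.
    near=> n; split; first by near: n.
    apply: le_lt_trans (ler_norm _) _.
    by rewrite -normrN -[X in `|X|]add0r; near: n.
  by move=> [n _ /(_ n (leqnn n))]; exists n.
pose g0 := G N.
have cg0 : continuous g0 by exact: cG.
have NG1 : \int[mu]_(t in circle R) `|f t - g0 t| < A / 2 by [].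
pose fl n t : R := (Num.floor (t * n.+1%:R))%:~R / n.+1%:R.
pose h n t : R := g0 (fl n t).
have n0 n : 0 < n.+1%:R :> R by rewrite ltr0n.
have flP n t : t - n.+1%:R^-1 < fl n t <= t.
  rewrite /fl ltr_pdivlMr // ler_pdivrMr // floor_le andbT mulrBl mulVf ?gt_eqF //.
  by rewrite ltrBlDr; have := floorD1_gt (t * n.+1%:R); rewrite intrD.
have fl0 n t : 0 <= t -> 0 <= fl n t.
  by move=> t0; rewrite divr_ge0 ?(ltW (n0 n)) // ler0z floor_ge0 mulr_ge0 // ltW.
have mh n : measurable_fun setT (h n).
  apply: (@measurableT_comp _ _ _ _ _ _ g0); first exact: continuous_measurable_fun.
  apply: nondecreasing_measurable => // a b ab.
  rewrite ler_pM2r ?invr_gt0 // ler_int; apply: le_floor.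
  by rewrite ler_pM2r.
have [M MP] : exists M : R, forall t, 0 <= t <= 2 * pi -> `|g0 t| <= M.
  have : compact (g0 @` `[0, 2 * pi]).
    apply: continuous_compact; last exact: segment_compact.
    exact: continuous_subspaceT.
  move=> /compact_bounded[M [_ MP]]; exists (M + 1) => t t02.
  apply: (MP (M + 1)); first by rewrite ltrDl.
  by exists t => //=; rewrite in_itv.
have hM n t : circle R t -> `|h n t| <= M.
  move/circleP => /andP[t0 t2]; apply: MP; rewrite fl0 //=.
  by have /andP[_ a] := flP n t; rewrite (le_trans a) // ltW.
have hcv t : h ^~ t @ \oo --> g0 t.
  apply: (@cvg_comp _ _ _ (fl ^~ t) g0); last exact: cg0.
  apply/cvgrPdist_lt => e e0; near=> n.
  have /andP[a b] := flP n t; rewrite ger0_norm ?subr_ge0 //.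
  rewrite ltrBlDr -ltrBlDl; apply: le_lt_trans a; rewrite lerD2l lerN2.
  near: n; have := near_infty_natSinv_lt (PosNum e0); apply: filterS => n /= ne.
  exact: ltW.
have M0 : 0 <= M.
  by apply: le_trans (MP 0 _) => //; rewrite lexx ltW // two_pi_gt0.
have hi n : L1 (h n).
  by apply: (@circ_integrable_bounded _ (h n) M (measurable_funTS (mh n))); exact: hM.
have g0i : L1 g0 by exact: iG.
have mg0 : measurable_fun setT g0 by exact: continuous_measurable_fun.
have [_ cvI] : L1 (fun _ => 0) /\
    \int[mu]_(t in circle R) `|g0 t - h n t| @[n --> \oo] --> \int[mu]_(t in circle R) 0.
  apply: (circ_DCT (g := fun _ => M + M)).
  - by move=> n; apply: measurableT_comp => //; apply: measurable_funTS; exact: measurable_funB.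
  - exact: measurable_cst.
  - apply: aeW => t ct; apply/cvgrPdist_lt => e e0.
    have /cvgrPdist_lt/(_ e e0) := hcv t; apply: filterS => n.
    by rewrite sub0r normrN normr_id.
  - exact: L1cst.
  - move=> n t ct; rewrite normr_id; apply: le_trans (ler_normB _ _) _.
    by rewrite lerD ?hM // MP //; move/circleP: ct => /andP[-> /ltW].
have A2 : 0 < A / 2 by rewrite divr_gt0.
rewrite Rintegral_cst // mul0r in cvI.
move/cvgrPdist_lt : cvI => /(_ _ A2) [n _ /(_ n (leqnn n)) /=].
rewrite sub0r normrN => /(le_lt_trans (ler_norm _)) hnA.
exists (h n); split; first exact: hi.
  apply: (@le_trans _ _ (\int[mu]_(t in circle R) (`|f t - g0 t| + `|g0 t - h n t|))).
    have fg : L1 (fun t => `|f t - g0 t|).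
      by apply: L1norm; exact: L1B.
    have gh : L1 (fun t => `|g0 t - h n t|).
      by apply: L1norm; exact: L1B.
    apply: (le_Rintegral (@measurable_circleR R)).
    - by apply: L1norm; exact: L1B.
    - exact: L1D.
    - by move=> t _; apply: ler_distD.
  have fg : L1 (fun t => `|f t - g0 t|).
    by apply: L1norm; exact: L1B.
  have gh : L1 (fun t => `|g0 t - h n t|).
    by apply: L1norm; exact: L1B.
  rewrite RintegralD //.
  by apply: le_trans (lerD (ltW NG1) (ltW hnA)) _; rewrite -splitr.
move=> s irr.
set m := Num.floor (s * n.+1%:R).
have n1 := n0 n.
have ms : m%:~R < s * n.+1%:R < (m + 1)%:~R.
  rewrite /m floorD1_gt andbT lt_neqAle floor_le andbT; apply/eqP => E.
  apply: irr; exists ((Num.floor (s * n.+1%:R))%:~R / n.+1%:R)%R => //.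
  by rewrite fmorph_div /= ratr_int ratr_nat E mulfK // gt_eqF.
exists (Num.min (s - m%:~R / n.+1%:R) ((m + 1)%:~R / n.+1%:R - s)).
  by rewrite lt_min !subr_gt0 ltr_pdivrMr // ltr_pdivlMr.
move=> t; rewrite lt_min => /andP[].
rewrite !ltr_norml => /andP[a _] /andP[_ b].
rewrite /h /fl; congr (g0 (_ %:~R / _)); rewrite -/m; apply: floor_def.
move: a b; rewrite opprB !ltrD2r => + +.
by rewrite ltr_pdivrMr // ltr_pdivlMr // => /ltW -> ->.
Unshelve. all: by end_near. Qed.

(** * Weak type estimate and radial limits *)

Lemma circ_HL g A : L1 g -> (forall t, circle R t -> 0 <= g t) -> 0 < A ->
  exists S : set R, [/\ measurable S,
    (mu S <= (3 / A * \int[mu]_(t in circle R) g t)%:E)%E &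
    forall s, ~ S s -> forall r, 0 < r ->
      \int[mu]_(t in circle R) (g t * indb s r t) <= 2 * r * A].
Proof.
move=> gi g0 A0; pose G := g \_ (circle R).
have Gi : mu.-integrable setT (EFin \o G) by exact: L1_restrict.
have lG : locally_integrable setT G.
  by apply: open_integrable_locally; [exact: openT|].
have G0 t : 0 <= G t by rewrite /G patchE; case: ifPn => // /set_mem /g0.
exists [set s | (A%:E < HL_maximal G s)%E]; split.
- rewrite -[X in measurable X]setTI; apply: emeasurable_fun_o_infty => //.
  exact: measurable_HL_maximal.
- apply: le_trans (maximal_inequality lG A0) _.
  rewrite (EFinM (3 / A)) lee_pmul2l ?lte_fin ?divr_gt0 // /Rintegral fineK; last exact: integrable_fin_num.
  rewrite le_eqVlt; apply/orP; left; apply/eqP.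
  transitivity (\int[mu]_t ((EFin \o g) \_ (circle R)) t)%E.
    apply: eq_integral => t _; rewrite restrict_EFin /= ger0_norm //.
  by rewrite -integral_mkcond.
move=> s /negP; rewrite -leNgt => sA r r0.
have : (iavg G (ball s r) <= A%:E)%E.
  by apply: le_trans sA; apply: ereal_sup_ubound; exists r => //=; rewrite in_itv /= r0.
rewrite /iavg (lebesgue_measure_ball _ (ltW r0)).
have E : (\int[mu]_(y in ball s r) `|(G y)%:E| =
  (\int[mu]_(t in circle R) (g t * indb s r t))%:E)%E.
  rewrite /Rintegral fineK; last by apply: integrable_fin_num => //; exact: L1_indb.
  rewrite [LHS]integral_mkcond [RHS]integral_mkcond; apply: eq_integral => t _.
  rewrite !patchE /= /G /indb indicE ger0_norm; last exact: G0.
  by rewrite [(g \_ _) _]patchE; case: (t \in circle R); case: (_ \in _) => /=; rewrite ?mulr1 ?mulr0.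
rewrite E inver ifF; last by rewrite mulrn_eq0 /= gt_eqF.
rewrite -EFinM lee_fin ler_pdivrMl ?mulrn_wgt0 // => H.
by rewrite mulr_natl.
Qed.

(** The set [T] is the lower limit of the [S n], an increasing union of sets of measure at most [B].
    A point outside it escapes [S m] for arbitrarily large [m], which is what a passage to the limit
    along circles needs. *)
Lemma liminf_mu (S : nat -> set R) B : (forall n, measurable (S n)) ->
  (forall n, (mu (S n) <= B)%E) -> exists T : set R, [/\ measurable T, (mu T <= B)%E &
  forall s, ~ T s -> forall n, exists2 m, (n <= m)%N & ~ S m s].
Proof.
move=> mS SB; pose F n := \bigcap_(m in [set m | (n <= m)%N]) S m.
have mF n : measurable (F n) by apply: bigcap_measurableType.
have mU : measurable (\bigcup_n F n) by exact: bigcup_measurable.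
exists (\bigcup_n F n); split => //.
- have cv := @nondecreasing_cvg_mu _ _ _ mu F mF mU.
  have /cvg_lim <- // : (mu \o F) x @[x --> \oo] --> mu (\bigcup_n F n).
    apply: cv => n m nm; apply/subsetPset => s Fs k /= mk; apply: Fs => /=; exact: leq_trans nm mk.
  apply: lime_le; first by apply/cvg_ex; eexists; apply: cv => n m nm;
    apply/subsetPset => s Fs k /= mk; apply: Fs => /=; exact: leq_trans nm mk.
  apply: nearW => n /=; apply: le_trans (SB n); apply: le_measure; rewrite ?inE.
  - exact: mF.
  - exact: mS.
  - by move=> s /(_ n (leqnn n)).
move=> s nT n; apply: contrapT => h; apply: nT; exists n => // m nm.
by apply: contrapT => nS; apply: h; exists m.
Qed.

Lemma poisson_scale z r t : 0 < r -> poisson (r%:C%C * z) r t = Re (herg_kernel z t).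
Proof.
move=> r0; rewrite Re_herg_kernel /poisson -mulrBr !sqnM.
have -> : sqn (r%:C%C : R[i]) = r ^+ 2 by rewrite /sqn /= expr0n addr0.
by rewrite -{1}[r ^+ 2]mulr1 -mulrBr -mulf_div divff ?mul1r // sqrf_eq0 gt_eqF.
Qed.

Lemma Re_clog z : Re (clog z) = ln (sqn z) / 2.
Proof. by []. Qed.

(** Boundary values of [ln |1 + F|] are not known at this stage, so the maximal inequality is
    applied to its values on the circles of radius [rr n], which tend to the unit circle, with a
    bound uniform in [n]. *)
Lemma weak_log h : 0 < h < pi -> exists2 K : R, 0 < K & forall f A, L1 f ->
  (forall t, circle R t -> 0 <= f t) -> 0 < A -> exists T : set R, [/\ measurable T,
    (mu T <= (3 / A * \int[mu]_(t in circle R) f t)%:E)%E &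
    forall s e, h <= s <= 2 * pi - h -> ~ T s -> 0 < e <= 2^-1 -> e < h ->
      ln (sqn (1 + herg f ((1 - e)%:C%C * cis s))) <= K * A].
Proof.
move=> hpi; have [C C0 CP] := kernel_bounds hpi; have p0 := pi_gt0 R.
(* The Poisson formula carries [2 * pi] and [Re (clog z)] is half of [ln (sqn z)], which leaves
   [pi]. *)
exists (16 * C / pi); first by rewrite divr_gt0 // mulr_gt0.
move=> f A fi f0 A0; pose X z := clog (1 + herg f z).
have re1 z : normc z < 1 -> 1 <= Re (1 + herg f z).
  by move=> z1; rewrite CReD /= lerDl herg_ge0.
have hX : holo X.
  by apply: (@holo_clog R _ 1) => //; apply: holoD; [exact: holo_cst|exact: holo_herg].
have sq1 z : normc z < 1 -> 1 <= sqn (1 + herg f z).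
  move=> /re1 z1; apply: (@le_trans _ _ (Re (1 + herg f z) ^+ 2)).
    by rewrite -[leLHS](expr1n _ 2) lerXn2r ?nnegrE // (le_trans _ z1).
  by rewrite /sqn lerDl sqr_ge0.
have X0 z : normc z < 1 -> 0 <= Re (X z).
  by move=> /sq1 z1; rewrite Re_clog divr_ge0 // ln_ge0.
pose rr (n : nat) : R := 1 - n.+2%:R^-1.
have rr01 n : 0 < rr n < 1.
  rewrite /rr subr_gt0 invf_lt1 ?ltr0n // ltr1n /= ltrBlDr ltrDl invr_gt0 ltr0n //.
pose G n t := Re (X ((rr n)%:C%C * cis t)).
have rc n t : normc ((rr n)%:C%C * cis t) < 1.
  have /andP[a b] := rr01 n.
  by rewrite (normcM (rr n)%:C%C (cis t)) normc_cis mulr1 normcR ger0_norm // ltW.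
have Gi n : L1 (G n).
  apply: circ_integrable_cont => t; have /andP[a b] := rr01 n.
  by have [] := @holo_circle R X (rr n) t hX; rewrite // (ltW a).
have G0 n t : circle R t -> 0 <= G n t by move=> _; exact/X0/rc.
have IG n : \int[mu]_(t in circle R) G n t <= \int[mu]_(t in circle R) f t.
  rewrite /G (mean_value hX (rr01 n)) Re_clog herg_at0.
  set a := \int[mu]_(t in circle R) f t.
  have a0 : 0 <= (2 * pi)^-1 * a.
    rewrite mulr_ge0 ?invr_ge0 ?(ltW (two_pi_gt0 R)) //; exact: Rintegral_ge0.
  have -> : sqn (1 + ((2 * pi)^-1 * a)%:C%C) = (1 + (2 * pi)^-1 * a) ^+ 2.
    by rewrite /sqn /= addr0 expr0n addr0.
  rewrite lnXn ?ltr_wpDr // mulr2n -[X in _ * ((X + X) / 2)]mulr1 -mulrDr.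
  rewrite -mulrA divff ?mulr1 // -ler_pdivlMl ?two_pi_gt0 //.
  by apply: le_ln1Dx; rewrite (lt_le_trans _ a0) // ltrN10.
have /choice[S SP] n : exists S : set R, [/\ measurable S,
    (mu S <= (3 / A * \int[mu]_(t in circle R) f t)%:E)%E &
    forall s, ~ S s -> forall r, 0 < r ->
      \int[mu]_(t in circle R) (G n t * indb s r t) <= 2 * r * A].
  have [S [mS SB SP]] := circ_HL (Gi n) (@G0 n) A0.
  exists S; split => //; apply: le_trans SB _.
  by rewrite lee_fin ler_pM2l ?divr_gt0.
have [||T [mT TB TP]] := @liminf_mu S ((3 / A * \int[mu]_(t in circle R) f t)%:E).
- by move=> n; have [] := SP n.
- by move=> n; have [] := SP n.
exists T; split => // s e hs nT /andP[e0 e12] eh.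
have [N NP] : exists N, forall m, (N <= m)%N -> 1 - e < rr m.
  have := near_infty_natSinv_lt (PosNum e0) => -[N _ NP]; exists N => m Nm.
  rewrite /rr ltrD2l ltrN2; apply: (NP m.+1); exact: leqW.
have [m /NP em nS] := TP s nT N.
have [_ _ /(_ s nS) Sm] := SP m.
have /andP[r0 r1] := rr01 m.
(* Measured in units of the radius [rr m], the point is at distance [e'] from that circle, and
   [0 < e' <= e]. *)
pose e' := 1 - (1 - e) / rr m.
have e'0 : 0 < e' by rewrite /e' subr_gt0 ltr_pdivrMr // mul1r.
have e'e : e' <= e.
  rewrite /e' lerBlDr -lerBlDl ler_pdivlMr // ler_piMr ?(ltW r1) //; lra.
have pE : (1 - e)%:C%C * cis s = (rr m)%:C%C * ((1 - e')%:C%C * cis s).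
  rewrite mulrA; congr (_ * _); rewrite -rmorphM /=; congr (_%:C%C).
  by rewrite /e' subKr mulrC divfK // gt_eqF.
have cs : circle R s by apply/circleP; lra.
have z1 : normc ((1 - e')%:C%C * cis s) < 1.
  by rewrite (normcM (1 - e')%:C%C (cis s)) normc_cis mulr1 normcR ger0_norm; lra.
have pr : normc ((1 - e)%:C%C * cis s) < rr m.
  by rewrite (normcM (1 - e)%:C%C (cis s)) normc_cis mulr1 normcR ger0_norm //; lra.
have := poisson_formula hX pr r1.
have I16 : \int[mu]_(t in circle R) (G m t * kpeak e' s t) <= 16 * A.
  by apply: int_kpeak_le => //; exact: G0.
rewrite {2}/X Re_clog => PF.
have : \int[mu]_(t in circle R) (G m t * poisson ((1 - e)%:C%C * cis s) (rr m) t) <=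
    C * (16 * A).
  apply: (@le_trans _ _ (C * \int[mu]_(t in circle R) (G m t * kpeak e' s t))); last first.
    by rewrite ler_pM2l.
  rewrite -RintegralZl //; last exact: L1_kpeak.
  apply: (le_Rintegral (@measurable_circleR R)).
  - under eq_fun do rewrite pE poisson_scale //.
    have [mR _] := herg_kernel_cmeas z1.
    apply: (circ_integrableM (Gi m) mR) => t _.
    by apply: le_trans (normRe_le _) (herg_kernel_bound t z1).
  - by apply: L1Z; exact: L1_kpeak.
  - move=> t ct; rewrite pE poisson_scale // mulrCA ler_wpM2l ?G0 //.
    have e2 : 0 < e' <= 2^-1 by rewrite e'0 (le_trans e'e).
    by have [+ _] := CP s t e' hs ct e2 (le_lt_trans e'e eh).
rewrite PF => H.
have -> : 16 * C / pi * A = (C * (16 * A)) / pi by rewrite !mulrA [C * 16]mulrC mulrAC.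
rewrite ler_pdivlMr // (le_trans _ H) // le_eqVlt; apply/orP; left; apply/eqP; by field.
Qed.

Definition rpt e s : R[i] := (1 - e)%:C%C * cis s.

Lemma normc_rpt e s : 0 < e <= 1 -> normc (rpt e s) < 1.
Proof.
move=> /andP[e0 e1].
by rewrite /rpt (normcM (1 - e)%:C%C (cis s)) normc_cis mulr1 normcR ger0_norm; lra.
Qed.

Lemma mu_setU_le (A B : set R) : measurable A -> measurable B ->
  (mu (A `|` B) <= mu A + mu B)%E.
Proof. by move=> mA mB; have := @measureU2 _ _ _ mu A B mA mB. Qed.

(** The positive and negative parts are divided by [d], after which their integrals are at most [d].
    With [A = ln 4 / K] the logarithmic bound reads [sqn (1 + F / d) <= 4], so [|Im F| <= 2 * d] off
    a set of measure [O(d)]. The two parts together double both constants. *)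
Lemma weak_small h : 0 < h < pi -> exists2 K : R, 0 < K & forall f d, L1 f -> 0 < d ->
  \int[mu]_(t in circle R) `|f t| <= d ^+ 2 -> exists T : set R, [/\ measurable T,
    (mu T <= (K * d)%:E)%E &
    forall s e, h <= s <= 2 * pi - h -> ~ T s -> 0 < e <= 2^-1 -> e < h ->
      `|Im (herg f (rpt e s))| <= 4 * d].
Proof.
move=> /weak_log[K K0 KP]; have l4 : 0 < ln 4 :> R by rewrite ln_gt0 // ltr1n.
exists (6 * K / ln 4); first by rewrite divr_gt0 // mulr_gt0.
move=> f d fi d0 fd.
have mf := L1_measurable fi.
pose fp t := Num.max (f t) 0; pose fn t := Num.max (- f t) 0.
have fpn t : f t = fp t - fn t by rewrite /fp /fn; case: (lerP (f t) 0); case: (lerP (- f t) 0) => ? ?; lra.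
have part (k : R -> R) : measurable_fun (circle R) k -> (forall t, 0 <= k t <= `|f t|) ->
    L1 k /\ exists T : set R, [/\ measurable T, (mu T <= (3 * K / ln 4 * d)%:E)%E &
    forall s e, h <= s <= 2 * pi - h -> ~ T s -> 0 < e <= 2^-1 -> e < h ->
      `|Im (herg k (rpt e s))| <= 2 * d].
  move=> mk kf.
  have ki : L1 k.
    apply: le_integrable (L1norm fi); first exact: measurable_circleR.
      by apply/measurable_EFinP.
    move=> t _ /=; rewrite lee_fin normr_id; have /andP[a b] := kf t.
    by rewrite ger0_norm.
  split=> //.
  have k0 t : circle R t -> 0 <= d^-1 * k t.
    by move=> _; rewrite mulr_ge0 ?invr_ge0 ?(ltW d0) //; have /andP[] := kf t.
  have kI : \int[mu]_(t in circle R) (d^-1 * k t) <= d.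
    rewrite RintegralZl // ler_pdivrMl // -expr2; apply: le_trans fd.
    apply: (le_Rintegral (@measurable_circleR R)) => //; first exact: L1norm.
    by move=> t _; have /andP[] := kf t.
  have A0 : 0 < ln 4 / K by rewrite divr_gt0.
  have [T [mT TB TP]] := KP _ _ (L1Z d^-1 ki) k0 A0.
  exists T; split => //.
    apply: le_trans TB _; rewrite lee_fin invf_div mulrA ler_pM2l //.
    by rewrite divr_gt0 // mulr_gt0.
  move=> s e hs nT e0 eh.
  have z1 : normc (rpt e s) < 1 by apply: normc_rpt; lra.
  have := TP s e hs nT e0 eh; rewrite -/(rpt e s) hergZ // [K * _]mulrC divfK ?gt_eqF //.
  set w := herg k (rpt e s).
  have w0 : 0 <= Re w by apply: herg_ge0 => // t _; have /andP[] := kf t.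
  have sE : sqn (1 + d^-1%:C%C * w) = (1 + d^-1 * Re w) ^+ 2 + (d^-1 * Im w) ^+ 2.
    by clearbody w; case: (w) => a b; rewrite /sqn /=; ring.
  rewrite sE ler_ln ?posrE //; last first.
    by rewrite ltr_pwDl ?sqr_ge0 // exprn_gt0 // ltr_wpDr // mulr_ge0 // invr_ge0 ltW.
  move=> H; have : (d^-1 * Im w) ^+ 2 <= 2 ^+ 2.
    by apply: le_trans (_ : 4 <= _); [apply: le_trans H; rewrite lerDr sqr_ge0|rewrite -natrX ler_nat].
  rewrite -[X in X <= _]real_normK ?num_real // ler_sqr ?nnegrE // => {}H.
  by move: H; rewrite normrM ger0_norm ?invr_ge0 ?(ltW d0) // ler_pdivrMl // mulrC.
have mfp : measurable_fun (circle R) fp by apply: measurable_maxr.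
have mfn : measurable_fun (circle R) fn by apply: measurable_maxr => //; exact: measurableT_comp.
have [|fpi [T [mT TB TP]]] := part fp mfp.
  by move=> t; rewrite /fp le_max lexx orbT ge_max ler_norm normr_ge0.
have [|fni [U [mU UB UP]]] := part fn mfn.
  by move=> t; rewrite /fn -normrN le_max lexx orbT ge_max ler_norm normr_ge0.
exists (T `|` U); split.
- exact: measurableU.
- apply: le_trans (mu_setU_le mT mU) _.
  have -> : 6 * K / ln 4 * d = 3 * K / ln 4 * d + 3 * K / ln 4 * d by field; exact: lt0r_neq0.
  by rewrite EFinD; exact: leeD.
move=> s e hs /not_orP[nT nU] e0 eh.
have -> : herg f = herg (fun t => fp t - fn t) by congr herg; apply/funext.
rewrite hergB //; last by apply: normc_rpt; lra.
rewrite CImD CImN; apply: le_trans (ler_normB _ _) _.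
have := TP s e hs nT e0 eh; have := UP s e hs nU e0 eh; lra.
Qed.

Lemma cot_trunc_bounded s e : 0 < e < pi -> exists B : R, forall t, `|cot_trunc s e t| <= B.
Proof.
move=> /andP[e0 epi].
have [|k k0 kP] := @sin_lower R (e / 2); first by apply/andP; split; lra.
have m0 : 0 < k * (e / 2) by rewrite mulr_gt0 // divr_gt0.
exists (k * (e / 2))^-1 => t; rewrite /cot_trunc.
case: ifPn => [/andP[te te2]|_]; last by rewrite normr0 invr_ge0 ltW.
set x := (s - t) / 2.
have xE : `|x| = `|s - t| / 2 by rewrite normrM normfV [`|2|]ger0_norm.
have kx : k * `|x| <= `|sin x| by apply: kP; rewrite xE; lra.
have mx : k * (e / 2) <= `|sin x|.
  by apply: le_trans kx; rewrite ler_pM2l // xE; lra.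
rewrite /cot normrM normfV -[leRHS]mul1r ler_pM ?invr_ge0 //.
  by rewrite ler_norml cos_geN1 cos_le1.
by rewrite lef_pV2 ?posrE // (lt_le_trans m0).
Qed.

Lemma L1_cot_trunc g s e : L1 g -> 0 < e < pi -> L1 (fun t => g t * cot_trunc s e t).
Proof.
move=> gi ep; have [B BP] := cot_trunc_bounded s ep.
apply: (circ_integrableM gi (B := B)) => // .
by apply: measurable_funTS; exact: cot_trunc_measurable.
Qed.

(* At a point of local constancy the removed arcs contribute the integral of an odd kernel. *)
Lemma conj_trunc_locally_cst g s : L1 g -> 0 < s < 2 * pi -> locally_cst g s ->
  exists2 d : R, 0 < d & forall e e', 0 < e < d -> 0 < e' < d ->
    conj_trunc g s e = conj_trunc g s e'.
Proof.
move=> gi /andP[s0 s2] [d1 d10 gP]; have p0 := pi_gt0 R.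
pose d := Num.min d1 (Num.min s (2 * pi - s)).
have d0 : 0 < d by rewrite !lt_min d10 s0 subr_gt0.
have dd1 : d <= d1 by rewrite /d !ge_min lexx.
have ds : d <= s by rewrite /d !ge_min lexx !orbT.
have ds2 : d <= 2 * pi - s by rewrite /d !ge_min lexx !orbT.
exists d => // e e' /andP[e0 ed] /andP[e'0 e'd].
have ci x : 0 < x < d -> [/\ L1 (fun t => g t * cot_trunc s x t), L1 (cot_trunc s x)
    & \int[mu]_(t in circle R) cot_trunc s x t = 0].
  move=> /andP[x0 xd]; have xp : 0 < x < pi by rewrite x0; lra.
  split; first exact: L1_cot_trunc.
    have := L1_cot_trunc s (L1cst 1) xp; congr (mu.-integrable _ (EFin \o _)).
    by apply/funext => t; rewrite mul1r.
  by apply: int_cot_trunc; lra.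
have [|i1 j1 z1] := ci e; first by rewrite e0.
have [|i2 j2 z2] := ci e'; first by rewrite e'0.
rewrite !conj_truncE; congr (_ * _); apply/eqP; rewrite -subr_eq0; apply/eqP.
rewrite -RintegralB //.
transitivity (\int[mu]_(t in circle R) (g s * (cot_trunc s e t - cot_trunc s e' t))); last first.
  rewrite RintegralZl //; last exact: L1B.
  by rewrite RintegralB // z1 z2 subrr mulr0.
apply: eq_Rintegral => t /set_mem/circleP/andP[t0 t2]; rewrite -mulrBr.
have [td|td] := ltrP `|t - s| d; first by rewrite gP // (lt_le_trans td).
rewrite /cot_trunc distrC.
have std : `|t - s| <= 2 * pi - d by rewrite ler_norml; lra.
by rewrite !ifT ?subrr ?mulr0 //; apply/andP; split; lra.
Qed.

Definition rad_cauchy f s A := exists2 d : R, 0 < d & forall e e', 0 < e < d -> 0 < e' < d ->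
  `|Im (herg f (rpt e s)) - Im (herg f (rpt e' s))| <= A.

(** The truncations are eventually constant and the radial values stay within [A / 2] of them. *)
Lemma rad_cauchy_locally_cst g s A : L1 g -> 0 < s < 2 * pi -> locally_cst g s ->
  lebesgue_pt (g \_ (circle R)) s -> 0 < A -> rad_cauchy g s A.
Proof.
move=> gi s02 lg ls A0.
have [d d0 dP] := conj_trunc_locally_cst gi s02 lg.
have A2 : 0 < A / 2 by rewrite divr_gt0.
have [d1 d10 d1P] := radial_estimate gi s02 ls A2.
exists (Num.min d d1); first by rewrite lt_min d0.
move=> e e'; rewrite !lt_min => /andP[e0 /andP[ed ed1]] /andP[e'0 /andP[e'd e'd1]].
have [|_ h1] := d1P e; first by rewrite e0.
have [|_ h2] := d1P e'; first by rewrite e'0.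
have h3 : conj_trunc g s e = conj_trunc g s e' by apply: dP; rewrite ?e0 ?e'0.
rewrite -h3 distrC in h2.
by apply: le_trans (ler_distD (conj_trunc g s e) _ _) _; rewrite [leRHS]splitr lerD.
Qed.

(** A step function within [d n ^+ 2] of [f] in mean has oscillation at most [A / 9] almost
    everywhere, and the remainder costs [4 * (A / 9)] at each of the two radii. The points where
    this fails for a given [n] have measure at most [K * d n]; the exceptional set lies in all of
    these, hence is null. *)
Lemma ae_rad_cauchy f h A : L1 f -> 0 < h < pi -> 0 < A ->
  {ae mu, forall s, h <= s <= 2 * pi - h -> rad_cauchy f s A}.
Proof.
move=> fi hpi A0; have /andP[h0 hp] := hpi.
have [K K0 KP] := weak_small hpi.
pose d n : R := A / 9 * n.+1%:R^-1.
have d0 n : 0 < d n by rewrite /d mulr_gt0 ?invr_gt0 ?divr_gt0.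
have /choice[T TP] n : exists T : set R, [/\ measurable T, (mu T <= (K * d n)%:E)%E &
    forall s, h <= s <= 2 * pi - h -> ~ T s -> rad_cauchy f s A].
  have dn2 : 0 < d n ^+ 2 by rewrite exprn_gt0.
  have [g [gi fg gP]] := step_density fi dn2.
  have [T [mT TB TP]] := KP _ _ (L1B fi gi) (d0 n) fg.
  have [N [mN N0 NP]] := ae_lebesgue_pt gi.
  pose Q : set R := range ratr.
  have mQ : measurable Q.
    apply: countable_measurable; first exact: measurable_set1.
    apply: sub_countable (card_image_le _ _) _; exact: countableP.
  exists (T `|` (N `|` Q)); split.
  - by apply: measurableU => //; exact: measurableU.
  - apply: le_trans (mu_setU_le mT (measurableU _ _ mN mQ)) _.
    rewrite -[leRHS]adde0 leeD //; apply: le_trans (mu_setU_le mN mQ) _.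
    by rewrite N0 lebesgue_measure_rat adde0.
  move=> s hs /not_orP[nT /not_orP[nN nQ]].
  have ls : lebesgue_pt (g \_ (circle R)) s by apply: contrapT => /NP.
  have s02 : 0 < s < 2 * pi by apply/andP; split; lra.
  have A9 : 0 < A / 9 by rewrite divr_gt0.
  have [e1 e10 e1P] := rad_cauchy_locally_cst gi s02 (gP _ nQ) ls A9.
  exists (Num.min e1 (Num.min 2^-1 h)); first by rewrite !lt_min e10 h0 invr_gt0 ltr0n.
  have dn9 : d n <= A / 9 by rewrite /d ler_piMr ?(ltW A9) // invf_le1 ?ltr0n // ler1n.
  move=> e e'; rewrite !lt_min => /andP[x0 /andP[x1 /andP[x2 x3]]] /andP[y0 /andP[y1 /andP[y2 y3]]].
  have c1 := e1P e e'; rewrite x0 y0 x1 y1 in c1; have {}c1 := c1 isT isT.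
  have Tk x : 0 < x -> x < 2^-1 -> x < h ->
      `|Im (herg f (rpt x s)) - Im (herg g (rpt x s))| <= 4 * (A / 9).
    move=> a b c; have ab : 0 < x <= 2^-1 by rewrite a ltW.
    have := TP s x hs nT ab c; rewrite (hergB fi gi) ?CImD ?CImN; last by apply: normc_rpt; lra.
    by move=> H; apply: le_trans H _; rewrite ler_pM2l.
  have c2 := Tk e x0 x2 x3; have c3 := Tk e' y0 y2 y3.
  apply: le_trans (ler_distD (Im (herg g (rpt e s))) _ _) _.
  have c4 := ler_distD (Im (herg g (rpt e' s))) (Im (herg g (rpt e s))) (Im (herg f (rpt e' s))).
  rewrite [X in _ <= _ + X]distrC in c4.
  suff <- : 4 * (A / 9) + (A / 9 + 4 * (A / 9)) = A.
    exact: lerD c2 (le_trans c4 (lerD c1 c3)).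
  by field.
have mB : measurable (\bigcap_n T n) by apply: bigcapT_measurable => n; have [] := TP n.
exists (\bigcap_n T n); split => //.
  apply/eqP; rewrite eq_le measure_ge0 andbT; apply/lee_addgt0Pr => x x0.
  rewrite add0e.
  have x1 : 0 < x / (K * (A / 9)) by rewrite divr_gt0 // mulr_gt0 // divr_gt0.
  have [n _ /(_ n (leqnn n)) nP] := near_infty_natSinv_lt (PosNum x1).
  have [mT TB _] := TP n.
  apply: (@le_trans _ _ (mu (T n))); first by apply: le_measure; rewrite ?inE //; exact: bigcap_inf.
  apply: le_trans TB _; rewrite lee_fin /d mulrA -ler_pdivlMl ?mulr_gt0 ?divr_gt0 //.
  by rewrite mulrC ltW.
move=> s /= /not_implyP[hs nC] n _; have [_ _ Tn] := TP n.
by apply: contrapT => nT; apply: nC; exact: Tn.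
Qed.

Lemma rad_cauchy_cvg f s : L1 f -> 0 < s < 2 * pi -> lebesgue_pt (f \_ (circle R)) s ->
  (forall A, 0 < A -> rad_cauchy f s A) ->
  Re (herg f (rpt e s)) @[e --> 0^'+] --> f s /\
  Im (herg f (rpt e s)) @[e --> 0^'+] --> conj_fun f s.
Proof.
move=> fi s02 ls fC.
have re := radial_estimate fi s02 ls.
have near0 (d : R) (P : R -> Prop) : 0 < d -> (forall e, 0 < e < d -> P e) ->
    \forall e \near 0^'+, P e.
  move=> dd0 dP; near=> e; apply: dP; apply/andP; split; first by near: e; exact: nbhs_right_gt.
  by near: e; exact: nbhs_right_lt.
split.
  apply/cvgrPdist_le => A A0; have [d d0 dP] := re A A0.
  by apply: (near0 d) => // e /dP[+ _]; rewrite distrC.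
have cv : cvg (Im (herg f (rpt e s)) @[e --> 0^'+]).
  apply/cauchy_cvgP/cauchy_exP => A A0.
  have A2 : 0 < A / 2 by rewrite divr_gt0.
  have [d d0 dP] := fC _ A2.
  exists (Im (herg f (rpt (d / 2) s))); apply: (near0 d) => // e ed.
  rewrite /ball /=; apply: le_lt_trans (dP _ _ _ ed) _; first by lra.
  by rewrite ltr_pdivrMr // ltr_pMr // ltr1n.
have cd : (Im (herg f (rpt e s)) - conj_trunc f s e) @[e --> 0^'+] --> 0.
  apply/cvgrPdist_le => A A0; have [d d0 dP] := re A A0.
  by apply: (near0 d) => // e /dP[_ +]; rewrite sub0r normrN.
(* As [conj_fun] is a [lim], its value is meaningful only once the truncations are known to
   converge; they inherit this from the radial values. *)
have ct : conj_trunc f s e @[e --> 0^'+] --> lim (Im (herg f (rpt e s)) @[e --> 0^'+]).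
  have -> : conj_trunc f s = (fun e => Im (herg f (rpt e s)) - (Im (herg f (rpt e s)) - conj_trunc f s e)).
    by apply/funext => e; ring.
  by rewrite -[X in _ --> X]subr0; apply: cvgB.
by rewrite /conj_fun (cvg_lim _ ct).
Unshelve. all: by end_near. Qed.

Lemma radial_limits_ae f : L1 f -> {ae mu, forall s, 0 < s < 2 * pi ->
  Re (herg f (rpt e s)) @[e --> 0^'+] --> f s /\
  Im (herg f (rpt e s)) @[e --> 0^'+] --> conj_fun f s}.
Proof.
move=> fi.
have h1 n : 0 < (n.+1%:R^-1 : R) < pi.
  rewrite invr_gt0 ltr0n /=; apply: le_lt_trans (_ : 1 < _); first by rewrite invf_le1 // ler1n.
  by have := pi_ge2 R; lra.
have H n m := ae_rad_cauchy fi (h1 n) (_ : 0 < m.+1%:R^-1).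
have {}H : {ae mu, forall s, forall n m : nat, n.+1%:R^-1 <= s <= 2 * pi - n.+1%:R^-1 -> rad_cauchy f s m.+1%:R^-1}.
  by apply: ae_foralln => n; apply: ae_foralln => m; apply: H.
apply: aeS (aeI H (ae_lebesgue_pt fi)) => s [sC ls] s02.
apply: rad_cauchy_cvg => // A A0.
have [m _ /(_ m (leqnn m)) mP] := near_infty_natSinv_lt (PosNum A0).
have m0 : 0 < Num.min s (2 * pi - s) by rewrite lt_min; lra.
have [n _ /(_ n (leqnn n)) nP] := near_infty_natSinv_lt (PosNum m0).
have [|d d0 dP] := sC n m.
  move: nP; rewrite /= lt_min; move: (n.+1%:R^-1) => x /andP[a b].
  by apply/andP; split; lra.
exists d => // e e' a b; apply: le_trans (dP e e' a b) _; exact: ltW.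
Qed.

End RadialConvergence.

(** * Boundary values *)

Section BoundaryValues.
Variable R : realType.
Notation mu := (@lebesgue_measure R).
Implicit Types (f g : R -> R) (z p c : R[i]) (r s t e h A : R).
Implicit Types (u v : nat -> R[i]) (X Y : R[i] -> R[i]) (x y : R -> R[i]).
Notation L1 f := (mu.-integrable (circle R) (EFin \o f)).

Definition ccvg u (l : R[i]) := Re (u n) @[n --> \oo] --> Re l /\
  Im (u n) @[n --> \oo] --> Im l.

Lemma ccvg_cst c : ccvg (fun=> c) c.
Proof. by split; exact: cvg_cst. Qed.

Lemma ccvgD u v (l k : R[i]) : ccvg u l -> ccvg v k -> ccvg (fun n => u n + v n) (l + k).
Proof.
move=> [a b] [c d]; split; [under eq_fun do rewrite CReD|under eq_fun do rewrite CImD];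
  by rewrite Cexpr; apply: cvgD.
Qed.

Lemma ccvgN u (l : R[i]) : ccvg u l -> ccvg (fun n => - u n) (- l).
Proof.
move=> [a b]; split; [under eq_fun do rewrite CReN|under eq_fun do rewrite CImN];
  by rewrite Cexpr; apply: cvgN.
Qed.

Lemma ccvgM u v (l k : R[i]) : ccvg u l -> ccvg v k -> ccvg (fun n => u n * v n) (l * k).
Proof.
move=> [a b] [c d]; split; [under eq_fun do rewrite CReM|under eq_fun do rewrite CImM].
  by rewrite CReM; apply: cvgB; apply: cvgM.
by rewrite CImM; apply: cvgD; apply: cvgM.
Qed.

Lemma ccvg_sqn u (l : R[i]) : ccvg u l -> sqn (u n) @[n --> \oo] --> sqn l.
Proof. by move=> [a b]; rewrite /sqn; apply: cvgD; under eq_fun do rewrite expr2; rewrite expr2; apply: cvgM. Qed.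

Lemma ccvgV u (l : R[i]) : l != 0 -> ccvg u l -> ccvg (fun n => (u n)^-1) l^-1.
Proof.
move=> l0 ul; have s0 : sqn l != 0 by rewrite sqn_eq0.
have sl : (sqn (u n))^-1 @[n --> \oo] --> (sqn l)^-1 by apply: cvgV => //; exact: ccvg_sqn.
have [a b] := ul.
split; [under eq_fun do rewrite CReV|under eq_fun do rewrite CImV].
  by rewrite CReV; exact: cvgM.
by rewrite CImV; apply: cvgM => //; exact: cvgN.
Qed.

Lemma ccvg_cexp u (l : R[i]) : ccvg u l -> ccvg (fun n => cexp (u n)) (cexp l).
Proof.
move=> [a b].
have ea : expR (Re (u n)) @[n --> \oo] --> expR (Re l).
  by apply: continuous_cvg a; exact: continuous_expR.
split; [under eq_fun do rewrite Re_cexp|under eq_fun do rewrite Im_cexp].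
  by rewrite Re_cexp; apply: cvgM => //; apply: continuous_cvg b; exact: continuous_cos.
by rewrite Im_cexp; apply: cvgM => //; apply: continuous_cvg b; exact: continuous_sin.
Qed.

Lemma cmeasD x y : cmeas x -> cmeas y -> cmeas (fun s => x s + y s).
Proof.
move=> [a b] [c d]; split; [under eq_fun do rewrite CReD|under eq_fun do rewrite CImD];
  exact: measurable_funD.
Qed.

Lemma cmeasN x : cmeas x -> cmeas (fun s => - x s).
Proof.
move=> [a b]; split; [under eq_fun do rewrite CReN|under eq_fun do rewrite CImN];
  exact: measurableT_comp.
Qed.

Lemma cmeasM x y : cmeas x -> cmeas y -> cmeas (fun s => x s * y s).
Proof.
move=> [a b] [c d]; split; [under eq_fun do rewrite CReM|under eq_fun do rewrite CImM].
  by apply: measurable_funB; apply: measurable_funM.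
by apply: measurable_funD; apply: measurable_funM.
Qed.

Lemma measurable_sqn x : cmeas x -> measurable_fun (circle R) (fun s => sqn (x s)).
Proof.
move=> [a b]; rewrite /sqn.
by apply: measurable_funD; under eq_fun do rewrite expr2; apply: measurable_funM.
Qed.

Lemma measurable_invr_ge0 f : (forall t, 0 <= f t) -> measurable_fun (circle R) f ->
  measurable_fun (circle R) (fun s => (f s)^-1).
Proof.
move=> f0 mf; under eq_fun do rewrite -(powR_inv1 (f0 _)).
by apply: (measurableT_comp (measurable_powR (-1)) mf).
Qed.

Lemma cmeasV x : cmeas x -> cmeas (fun s => (x s)^-1).
Proof.
move=> mx; have [a b] := mx.
have ms := measurable_invr_ge0 (fun s => sqn_ge0 (x s)) (measurable_sqn mx).
split; [under eq_fun do rewrite CReV|under eq_fun do rewrite CImV].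
  exact: measurable_funM.
by apply: measurable_funM => //; exact: measurableT_comp.
Qed.

Lemma cmeas_cexp x : cmeas x -> cmeas (fun s => cexp (x s)).
Proof.
move=> [a b]; have ea := measurableT_comp (@measurable_expR R) a.
have mc : measurable_fun setT (@cos R).
  by apply: continuous_measurable_fun; exact: continuous_cos.
have ms : measurable_fun setT (@sin R).
  by apply: continuous_measurable_fun; exact: continuous_sin.
split; [under eq_fun do rewrite Re_cexp|under eq_fun do rewrite Im_cexp];
  apply: measurable_funM => //; exact: measurableT_comp.
Qed.

(** The radii are restricted to [1 - 1 / (n + 2)]: a sequence suits dominated convergence, and the
    shift by two keeps every radius strictly between [0] and [1]. *)
Definition bval X x := [/\ holo X, cmeas x &
  {ae mu, forall s, circle R s -> ccvg (fun n => X (rpt n.+2%:R^-1 s)) (x s)}].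

Lemma rpt_disc n s : normc (rpt n.+2%:R^-1 s : R[i]) < 1.
Proof. by apply: normc_rpt; rewrite invr_gt0 ltr0n invf_le1 ?ltr0n // ler1n. Qed.

Lemma bval_cst c : bval (fun=> c) (fun=> c).
Proof.
split; [exact: holo_cst|by split; exact: measurable_cst|].
by apply: aeW => s _; exact: ccvg_cst.
Qed.

Lemma bvalD X Y x y : bval X x -> bval Y y -> bval (fun z => X z + Y z) (fun s => x s + y s).
Proof.
move=> [a b c] [a' b' c']; split; [exact: holoD|exact: cmeasD|].
by apply: aeS (aeI c c') => s [h k] cs; apply: ccvgD; [exact: h|exact: k].
Qed.

Lemma bvalN X x : bval X x -> bval (fun z => - X z) (fun s => - x s).
Proof.
move=> [a b c]; split; [exact: holoN|exact: cmeasN|].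
by apply: aeS c => s h cs; apply: ccvgN; exact: h.
Qed.

Lemma bvalM X Y x y : bval X x -> bval Y y -> bval (fun z => X z * Y z) (fun s => x s * y s).
Proof.
move=> [a b c] [a' b' c']; split; [exact: holoM|exact: cmeasM|].
by apply: aeS (aeI c c') => s [h k] cs; apply: ccvgM; [exact: h|exact: k].
Qed.

Lemma bval_cexp X x : bval X x -> bval (fun z => cexp (X z)) (fun s => cexp (x s)).
Proof.
move=> [a b c]; split; [exact: holo_cexp|exact: cmeas_cexp|].
by apply: aeS c => s h cs; apply: ccvg_cexp; exact: h.
Qed.

Lemma bvalV X x (d : R) : 0 < d -> (forall z, normc z < 1 -> d <= normc (X z)) ->
  bval X x -> bval (fun z => (X z)^-1) (fun s => (x s)^-1).
Proof.
move=> d0 dX [a b c]; split; [exact: holoV dX a|exact: cmeasV|].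
apply: aeS c => s h cs; apply: ccvgV (h cs); rewrite -sqn_gt0.
apply: (@lt_le_trans _ _ (d ^+ 2)); first by rewrite exprn_gt0.
apply: (cvgr_to_ge (ccvg_sqn (h cs))); apply: nearW => n.
by rewrite -normc_sqr ler_sqr ?nnegrE ?(ltW d0) ?normc_ge0 // dX // rpt_disc.
Qed.

Lemma cvg_right_seq (g : R -> R) (l : R) : g e @[e --> 0^'+] --> l ->
  g n.+2%:R^-1 @[n --> \oo] --> l.
Proof.
move=> /cvgrPdist_lt gl; apply/cvgrPdist_lt => A A0.
have [d /= d0 dP] := gl A A0.
have [N _ NP] := near_infty_natSinv_lt (PosNum d0).
exists N => // n /= Nn; apply: dP => /=; last by rewrite invr_gt0 ltr0n.
rewrite sub0r normrN ger0_norm ?invr_ge0 //.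
by apply: (NP n.+1); exact: leqW.
Qed.

Lemma holo_rpt_cmeas X e : holo X -> 0 < e <= 1 -> cmeas (fun s => X (rpt e s)).
Proof. by move=> hX e1; apply: ccont_cmeas => s; apply: holo_circle => //; lra. Qed.

(* The principal value integral need not be measurable off the set of
   convergence, hence the measurable representative [V]. *)
Lemma bval_herg f : L1 f -> exists V : R -> R, [/\ measurable_fun (circle R) V,
  {ae mu, forall s, circle R s -> V s = conj_fun f s} &
  bval (herg f) (fun s => (f s +i* V s)%C)].
Proof.
move=> fi.
pose g n s := Im (herg f (rpt n.+2%:R^-1 s)).
pose V s := fine (limn_esup (fun n => (g n s)%:E)).
have mV : measurable_fun (circle R) V.
  apply: measurableT_comp => //; apply: measurable_fun_limn_esup => n.
  apply/measurable_EFinP.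
  have [] := @holo_rpt_cmeas (herg f) n.+2%:R^-1 (holo_herg fi) _.
    by rewrite invr_gt0 ltr0n invf_le1 ?ltr0n // ler1n.
  by [].
have aeP : {ae mu, forall s, circle R s -> V s = conj_fun f s /\
    ccvg (fun n => herg f (rpt n.+2%:R^-1 s)) (f s +i* V s)%C}.
  have n0 : {ae mu, forall s : R, s != 0}.
    exists [set 0]; split => //; first exact: lebesgue_measure_set1.
    by move=> s /= /negP; rewrite negbK => /eqP.
  apply: aeS (aeI n0 (radial_limits_ae fi)) => s [s0 H] /circleP/andP[s1 s2].
  have [|/cvg_right_seq cR /cvg_right_seq cI] := H; first by rewrite lt_neqAle eq_sym s0 s1.
  have VE : V s = conj_fun f s.
    rewrite /V (cvg_limn_einf_sup (_ : (g n s)%:E @[n --> \oo] --> (conj_fun f s)%:E)) //.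
    by apply: cvg_EFin; [exact: nearW|].
  by split => //; split => //=; rewrite VE.
exists V; split => //; first by apply: aeS aeP => s H /H[].
split; first exact: holo_herg.
  by split => //=; exact: L1_measurable.
by apply: aeS aeP => s H /H[].
Qed.

End BoundaryValues.

(** * The Poisson formula on the unit circle for bounded functions *)

Section BoundaryPoisson.
Variable R : realType.
Notation mu := (@lebesgue_measure R).
Implicit Types (f g : R -> R) (z p c : R[i]) (r s t e h A : R).
Implicit Types (u v : nat -> R[i]) (X Y : R[i] -> R[i]) (x y : R -> R[i]).
Notation L1 f := (mu.-integrable (circle R) (EFin \o f)).

Lemma holo_ray X p : holo X -> normc p < 1 -> ccont (fun r => X (r%:C%C * p)) 1.
Proof.
move=> [X' [dX _]] p1; have p0 := normc_ge0 p.
pose d := (1 - normc p) / 2; have d0 : 0 < d by rewrite divr_gt0 // subr_gt0.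
have r1 : normc p + d < 1 by rewrite /d; lra.
have cw : curve_in 0 (1 + d) (normc p + d) (normc p) (fun r => r%:C%C * p) (fun=> p).
  move=> x /andP[x0 x1]; split => //.
  - rewrite normcM normcR (gtr0_norm x0).
    apply: (@le_trans _ _ ((1 + d) * normc p)); first by rewrite ler_wpM2r // ltW.
    by rewrite mulrDl mul1r lerD2l ler_piMr ?(ltW d0) // ltW.
  - apply: eq_cderive (cderiveM (cderiveR (is_derive_id x 1)) (cderive_cst p x)) _.
    by rewrite mulr0 addr0 rmorph1 mul1r.
have [|k _] := dX _ _ _ _ _ _ r1 cw 1; first by rewrite ltr01 /= ltrDl.
exact: cderive_ccont k.
Qed.

(** At the point [r * p] of the disc of radius [r] the Poisson kernel does not depend on [r], so
    only [X] varies in the integrand. Its bound [M] gives dominated convergence as [r] tends to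
    [1]. *)
Lemma bval_poisson X x (M : R) p : bval X x ->
  (forall z, normc z < 1 -> normc (X z) <= M) -> normc p < 1 ->
  L1 (fun s => Re (x s) * Re (herg_kernel p s)) /\
  \int[mu]_(s in circle R) (Re (x s) * Re (herg_kernel p s)) = 2 * pi * Re (X p).
Proof.
move=> [hX [mR mI] Xx] XM p1.
have [mk _] := herg_kernel_cmeas p1.
pose C := 2 / (1 - normc p).
have M0 : 0 <= M by apply: le_trans (XM 0 _); rewrite ?normc_ge0 // normc0.
have kC s : `|Re (herg_kernel p s)| <= C.
  exact: le_trans (normRe_le _) (herg_kernel_bound s p1).
have e01 n : 0 < (n.+2%:R^-1 : R) < 1.
  by rewrite invr_gt0 ltr0n invf_lt1 ?ltr0n // ltr1n.
have [||||/= xi cv] := @circ_DCT R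
  (fun n s => Re (X (rpt n.+2%:R^-1 s)) * Re (herg_kernel p s))
  (fun s => Re (x s) * Re (herg_kernel p s)) (fun=> M * C) _ _ _ (L1cst _).
- move=> n; apply: measurable_funM => //.
  have [] // := @holo_rpt_cmeas _ X n.+2%:R^-1 hX _.
  by have /andP[-> /ltW] := e01 n.
- exact: measurable_funM.
- apply: aeS Xx => s h cs; apply: cvgM; last exact: cvg_cst.
  by have [] := h cs.
- move=> n s cs; rewrite normrM ler_pM //.
  by apply: le_trans (normRe_le _) (XM _ (rpt_disc _ _)).
split=> //.
suff cv2 : \int[mu]_(t in circle R)
    (Re (X (rpt n.+2%:R^-1 t)) * Re (herg_kernel p t)) @[n --> \oo] --> 2 * pi * Re (X p).
  exact: cvg_unique cv cv2.
have E n : \int[mu]_(t in circle R) (Re (X (rpt n.+2%:R^-1 t)) * Re (herg_kernel p t)) =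
    2 * pi * Re (X ((1 - n.+2%:R^-1)%:C%C * p)).
  have /andP[e0 e1] := e01 n; have r0 : 0 < 1 - n.+2%:R^-1 :> R by rewrite subr_gt0.
  rewrite -(@poisson_formula _ X _ (1 - n.+2%:R^-1) hX).
  - by apply: eq_Rintegral => t _; rewrite poisson_scale.
  - by rewrite normcM normcR (gtr0_norm r0) gtr_pMr.
  - by rewrite ltrBlDr ltrDl.
under eq_fun do rewrite E.
apply: cvgM; first exact: cvg_cst.
have [cR _] := holo_ray hX p1.
have e10 : (1 - n.+2%:R^-1 : R) @[n --> \oo] --> (1 : R).
  rewrite -[X in _ --> X]subr0; apply: cvgB; first exact: cvg_cst.
  have := @cvg_right_seq R id 0; apply.
  by apply: cvg_within_filter; exact: cvg_id.
have -> : Re (X p) = (fun r : R => Re (X (r%:C%C * p))) 1 by rewrite mul1r.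
exact: (continuous_cvg _ cR e10).
Qed.

Lemma circ_le_ae f g : L1 f -> L1 g ->
  {ae mu, forall s, circle R s -> f s <= g s} ->
  \int[mu]_(s in circle R) f s <= \int[mu]_(s in circle R) g s.
Proof.
move=> fi gi fg; have mf := L1_measurable fi; have mg := L1_measurable gi.
have mm : measurable_fun (circle R) (fun s => Num.min (f s) (g s)) by exact: measurable_minr.
have bi : L1 (fun s => `|f s| + `|g s|) by apply: L1D; exact: L1norm.
have mb s : `|Num.min (f s) (g s)| <= `|f s| + `|g s|.
  by rewrite /Order.min; case: ifP => _; rewrite ?lerDl ?lerDr normr_ge0.
have mi : L1 (fun s => Num.min (f s) (g s)).
  apply: (le_integrable (@measurable_circleR R) _ _ bi); first exact/measurable_EFinP.
  by move=> s _; rewrite /= lee_fin [leRHS]ger0_norm.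
(* Dominated convergence for a constant sequence: it identifies the integrals of two functions that
   are equal almost everywhere. *)
have [||||_ cv] := @circ_DCT R (fun _ s => Num.min (f s) (g s)) f _ _ _ _ bi.
- by [].
- by [].
- by apply: aeS fg => s h /h fgs; rewrite min_l //; exact: cvg_cst.
- by move=> _ s _; exact: mb.
have <- : \int[mu]_(s in circle R) Num.min (f s) (g s) = \int[mu]_(s in circle R) f s.
  by apply: cvg_unique cv => //; exact: cvg_cst.
apply: (le_Rintegral (@measurable_circleR R)) => // s _.
by rewrite ge_min lexx orbT.
Qed.

End BoundaryPoisson.

(** * Pointwise inequalities on the circle *)

Section PointwiseBounds.
Variable R : realType.
Implicit Types (w z A B L : R[i]) (b a c e T x v l : R).

Definition qf w := w * (1 + w)^-1.
(** On the imaginary axis [Re (q^2) = 2 (Re q)^2 - Re q], so this combination has real part exactly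
    [(Re q)^2] there. The square is essential: [Re (phi w)] gets multiplied by a term of size
    [ln |w|], and [(Re q)^2 * ln |w|], unlike [Re q * ln |w|], is controlled by [Re q] as [w] tends
    to [0]. *)
Definition phi w := (2^-1)%:C%C * (qf w + qf w * qf w).
(** Near [0] this is [w] to first order, yet on the imaginary axis its real part is
    [4 (Re q)^2 - Re q], of second order. An error of second order on the circle thus yields a gain
    of first order at an interior point. *)
Definition lf w := qf w + 2%:C%C * (qf w * qf w).
Definition wf b z := cexp (- ('i%C * z) - b%:C%C).

Lemma Re_wf b z : Re (wf b z) = expR (Im z - b) * cos (Re z).
Proof.
by case: z => x y; rewrite /wf Re_cexp !Cexpr /= !mul0r !mul1r sub0r opprK add0r subr0 cosN.
Qed.

Lemma Im_wf b z : Im (wf b z) = - (expR (Im z - b) * sin (Re z)).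
Proof.
by case: z => x y; rewrite /wf Im_cexp !Cexpr /= !mul0r !mul1r sub0r opprK add0r subr0 sinN mulrN.
Qed.

Lemma normc_wf b z : normc (wf b z) = expR (Im z - b).
Proof.
by case: z => x y; rewrite /wf normc_cexp !Cexpr /= !mul0r mul1r sub0r opprK.
Qed.

Section RightHalfPlane.
Variable w : R[i].
Hypothesis w0 : 0 <= Re w.

Lemma sqn_1D_ge : 1 + sqn w <= sqn (1 + w).
Proof. by move: w0; case: (w) => x y /=; rewrite /sqn /= => x0; nra. Qed.

Lemma normc_1D_ge1 : 1 <= normc (1 + w).
Proof.
rewrite -(ler_sqr) ?nnegrE ?normc_ge0 // expr1n normc_sqr.
by apply: le_trans sqn_1D_ge; rewrite lerDl sqn_ge0.
Qed.

Lemma normc_1D_neq0 : 1 + w != 0.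
Proof. by rewrite -normc_gt0 (lt_le_trans _ normc_1D_ge1). Qed.

Lemma normc_qf_le : normc (qf w) <= normc w.
Proof.
rewrite /qf normcM normcV ler_piMr ?normc_ge0 //.
by rewrite invf_le1 ?normc_1D_ge1 // normc_gt0 normc_1D_neq0.
Qed.

Lemma normc_qf_le1 : normc (qf w) <= 1.
Proof.
rewrite /qf normcM normcV ler_pdivrMr ?normc_gt0 ?normc_1D_neq0 // mul1r.
rewrite -ler_sqr ?nnegrE ?normc_ge0 // !normc_sqr.
by apply: le_trans sqn_1D_ge; rewrite lerDr.
Qed.

Lemma normc_phi_le1 : normc (phi w) <= 1.
Proof.
rewrite /phi normcM normcR ger0_norm // ler_pdivrMl // mulr1.
apply: le_trans (le_normcD _ _) _; have q1 := normc_qf_le1.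
by rewrite (_ : 2 = 1 + 1) // lerD // normcM mulr_ile1 ?normc_ge0.
Qed.

Lemma normc_lf_le3 : normc (lf w) <= 3.
Proof.
rewrite /lf; apply: le_trans (le_normcD _ _) _; have q1 := normc_qf_le1.
rewrite (_ : 3 = 1 + 2 * 1 :> R); last by ring.
by rewrite lerD // normcM normcR ger0_norm // ler_pM2l // normcM mulr_ile1 ?normc_ge0.
Qed.

Lemma Re_qf_ge0 : 0 <= Re (qf w).
Proof.
rewrite /qf CReM CReV CImV CReD CImD /=; set D := sqn _.
have D0 : 0 < D by rewrite sqn_gt0 normc_1D_neq0.
rewrite (_ : _ - _ = (Re w + sqn w) / D); last first.
  by rewrite /sqn; field; rewrite gt_eqF.
by rewrite divr_ge0 ?(ltW D0) // addr_ge0 // sqn_ge0.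
Qed.

(** Both [Im (phi w) / Im (qf w) = (1 + 2 Re (qf w)) / 2] and [Im (qf w) / Im w = 1 / sqn (1 + w)]
    are positive. The product with [x] covers both signs of [Im w]. *)
Lemma Im_phi_sign x : 0 <= Im w * x -> 0 <= Im (phi w) * x.
Proof.
move=> wx.
have -> : Im (phi w) * x = 2^-1 * (1 + 2 * Re (qf w)) * (Im (qf w) * x).
  by rewrite /phi CImRM !Cexpr; ring.
apply: mulr_ge0; first by rewrite mulr_ge0 // addr_ge0 // mulr_ge0 // Re_qf_ge0.
rewrite /qf CImM CReV CImV CReD CImD /=; set D := sqn _.
have D0 : 0 < D by rewrite sqn_gt0 normc_1D_neq0.
rewrite (_ : _ * x = (Im w * x) / D); last by field; rewrite gt_eqF.
by rewrite divr_ge0 // ltW.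
Qed.

(** From [q = w - w q] follows [lf w = w + 2 q^2 - w q], and [|q| <= |w|] bounds the last two
    terms. *)
Lemma Re_lf_ge : Re w - 3 * normc w ^+ 2 <= Re (lf w).
Proof.
have -> : lf w = w + (2%:C%C * (qf w * qf w) - w * qf w).
  rewrite /lf /qf; set W := (1 + w)^-1.
  have E : W + w * W = 1 by rewrite -{1}[W]mul1r -mulrDl /W mulfV // normc_1D_neq0.
  transitivity (w * 1 + (2%:C%C * (w * W * (w * W)) - w * (w * W))); last by rewrite mulr1.
  by rewrite -E; ring.
rewrite CReD lerD2l lerNl; apply: le_trans (ler_norm _) _; rewrite normrN.
apply: le_trans (normRe_le _) _;
have q1 := normc_qf_le; have n0 := normc_ge0 w; have q0 := normc_ge0 (qf w).
apply: (@le_trans _ _ (2 * (normc (qf w) * normc (qf w)) + normc w * normc (qf w))).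
  apply: le_trans (le_normcD _ _) _; rewrite normcN (normcM w) (normcM 2%:C%C)
    (normcM (qf w)) normcR ger0_norm //.
rewrite (_ : 3 * _ = 2 * (normc w * normc w) + normc w * normc w); last by ring.
by apply: lerD; [rewrite ler_pM2l //|]; apply: ler_pM.
Qed.

End RightHalfPlane.

(** With [s = expR y] and [ps = s^2 / (1 + s^2)] this says [- y * ps <= 1], the control of the
    logarithm on the circle. For [y < -1] it follows from [1 = s^2 * expR (- 2 y)] and the tangent
    line of the exponential. *)
Lemma exp_tangent (y : R) : 0 <= 1 + expR y ^+ 2 * (1 + y).
Proof.
have [y1|y1] := lerP (-1) y.
  by rewrite addr_ge0 // mulr_ge0 ?sqr_ge0 //; lra.
have E : expR y ^+ 2 * expR (- (2 * y)) = 1.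
  by rewrite -expRM_natl -expRD mulr_natl mulr2n subrr expR0.
rewrite -{1}E -mulrDr mulr_ge0 ?sqr_ge0 //.
by have := expR_ge1Dx (- (2 * y)); lra.
Qed.

(* As [x0 = +-pi/2], the value [w] is purely imaginary; the shift by [4] is
   what makes [(ln |w| + 4) * Re (phi w)] dominate [Re (lf w)]. *)
Lemma bdry_ineq (x0 v0 xA vA xB vB a c : R) :
  (x0 = pi / 2 /\ 0 <= xA /\ xB = 0) \/ (x0 = - (pi / 2) /\ xA = 0 /\ 0 <= xB) ->
  forall w, w = wf (a + 4 - c) (x0 +i* v0)%C ->
  Im (phi w * ((xA - xB) +i* (vA - vB - c))%C) <= Num.max (v0 + vA - vB - a) 0 - Re (lf w).
Proof.
move=> H w wE.
pose y := v0 - (a + 4 - c); pose s := expR y; pose D := 1 + s ^+ 2.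
have s0 : 0 < s by exact: expR_gt0.
have D0 : 0 < D by rewrite addr_gt0 // exprn_gt0.
(* Here [k] is the sign of [x0], and [xA - xB] has that sign or is zero. *)
have [k kw kx] : exists2 k : R, w = (0 +i* (- (k * s)))%C & (k = 1 \/ k = -1) /\ 0 <= k * (xA - xB).
  rewrite wE; case: H => [[-> [xA0 ->]]|[-> [-> xB0]]].
    exists 1; first by apply: complexP; rewrite ?Re_wf ?Im_wf /= ?cos_pihalf ?sin_pihalf ?mulr0 // mulr1 mul1r.
    by split; [left|rewrite subr0 mul1r].
  exists (-1); first by apply: complexP; rewrite ?Re_wf ?Im_wf /= ?cosN ?sinN ?cos_pihalf ?sin_pihalf ?mulr0 // mulrN1 mulN1r.
  by split; [right|rewrite sub0r mulN1r opprK].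
have [k1 kx0] := kx.
have k2 : k ^+ 2 = 1 by case: k1 => ->; ring.
pose ps := s ^+ 2 / D.
have qE : qf w = (ps +i* (- (k * s) / D))%C.
  have DE : (1 + 0) ^+ 2 + (0 - k * s) ^+ 2 = D by rewrite sub0r sqrrN exprMn k2 addr0 mul1r expr1n.
  have D'0 : D != 0 by rewrite gt_eqF.
  apply: complexP; rewrite /qf kw /= DE.
    transitivity (k ^+ 2 * s ^+ 2 / D); last by rewrite k2 mul1r.
    by field.
  by field.
have ps0 : 0 <= ps by rewrite divr_ge0 ?sqr_ge0 // ltW.
have ps1 : ps <= 1 by rewrite ler_pdivrMr // mul1r lerDr.
have tE : (- (k * s) / D) ^+ 2 = ps * (1 - ps).
  transitivity (k ^+ 2 * (s ^+ 2 / D ^+ 2)); first by field; rewrite gt_eqF.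
  by rewrite k2 /ps /D; field; rewrite gt_eqF.
have LE : Re (lf w) = 4 * ps ^+ 2 - ps.
  rewrite /lf qE CReD CReRM CReM /= -(expr2 (- (k * s) / D)) tE; ring.
have PR : Re (phi w) = ps ^+ 2.
  by rewrite /phi qE CReRM CReD CReM /= -(expr2 (- (k * s) / D)) tE; field.
have PI : Im (phi w) = - (k * (s / D * (1 + 2 * ps) / 2)).
  by rewrite /phi qE CImRM CImD CImM /=; field; rewrite gt_eqF.
rewrite CImM PR PI LE /=.
(* The unknown real parts [xA] and [xB] enter only here, and with a favourable sign. *)
have n1 : - (k * (s / D * (1 + 2 * ps) / 2)) * (xA - xB) <= 0.
  rewrite mulNr oppr_le0 mulrAC mulr_ge0 // divr_ge0 // mulr_ge0 ?divr_ge0 ?(ltW s0) ?(ltW D0) //.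
  by rewrite addr_ge0 // mulr_ge0.
have n2 : 0 <= ps * (1 + y * ps).
  rewrite mulr_ge0 // /ps (_ : 1 + _ = (1 + s ^+ 2 * (1 + y)) / D).
    by rewrite divr_ge0 ?(ltW D0) // exp_tangent.
  by rewrite /D; field; rewrite gt_eqF.
pose T := v0 + vA - vB - a.
(* Of the three terms, [T] is absorbed by its positive part, [- 4] matches the term [4 * ps ^+ 2] of
   [Re (lf w)], and [- y] is handled by [n2]. *)
have -> : vA - vB - c = T - 4 - y by rewrite /T /y; ring.
rewrite -/T; have n3 : ps ^+ 2 * T <= Num.max T 0.
  have [T0|T0] := lerP T 0; first by rewrite mulr_ge0_le0 // sqr_ge0.
  by rewrite ler_piMl ?(ltW T0) // expr_le1.
have -> : ps ^+ 2 * (T - 4 - y) = ps ^+ 2 * T - 4 * ps ^+ 2 + ps - ps * (1 + y * ps) by ring.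
by move: n1 n2 n3; set u1 := _ * (xA - xB); set u2 := ps * (1 + _); set u3 := ps ^+ 2 * T; lra.
Qed.

Lemma Re_pos_neq0 e A : 0 <= e -> 0 <= Re A -> 1 <= sqn (1 + e%:C%C * A).
Proof.
move=> e0 A0; apply: le_trans (sqn_1D_ge _); last by rewrite CReRM mulr_ge0.
by rewrite lerDl sqn_ge0.
Qed.

(** For [Re A >= 0] this factor has norm at most [1], tends to [1] with [e] tending to [0], and
    makes [reg e A * A] bounded by [1 / e]. *)
Definition reg e A := (1 + e%:C%C * A)^-1.

Lemma sqnV z : sqn z^-1 = (sqn z)^-1.
Proof. by rewrite -!normc_sqr normcV exprVn. Qed.

Lemma sqn_reg e A : sqn (reg e A) = (sqn (1 + e%:C%C * A))^-1.
Proof. exact: sqnV. Qed.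

Section Regularization.
Variables (e : R) (A B : R[i]).
Hypotheses (e0 : 0 < e) (A0 : 0 <= Re A) (B0 : 0 <= Re B).

Lemma sqn_reg_le1 z : 0 <= Re z -> sqn (reg e z) <= 1.
Proof.
move=> z0; have s1 := Re_pos_neq0 (ltW e0) z0.
by rewrite sqn_reg invf_le1 // (lt_le_trans _ s1).
Qed.

Lemma normc_reg_le1 z : 0 <= Re z -> normc (reg e z) <= 1.
Proof.
move=> z0; rewrite -ler_sqr ?nnegrE ?normc_ge0 // expr1n normc_sqr.
exact: sqn_reg_le1.
Qed.

Lemma regE z : 0 <= Re z -> reg e z = (sqn (reg e z))%:C%C * (1 + e%:C%C * z^*%C).
Proof.
move=> z0; have s1 := Re_pos_neq0 (ltW e0) z0; have sp := lt_le_trans ltr01 s1.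
rewrite sqn_reg /reg; apply: complexP.
  by rewrite CReV CReRM; move: (sqn _) => k; case: (z) => x y /=; ring.
by rewrite CImV CImRM; move: (sqn _) => k; case: (z) => x y /=; ring.
Qed.

(** The real excess in [reg e z * z = |reg e z|^2 z + reg_defect z]: it separates a positive
    multiple of [z], harmless in an inequality, from a nonnegative error. *)
Definition reg_defect z := e * sqn z * sqn (reg e z).

Lemma reg_mul z : 0 <= Re z ->
  reg e z * z = (sqn (reg e z))%:C%C * z + (reg_defect z)%:C%C.
Proof.
move=> z0; rewrite {1}regE // /reg_defect; move: (sqn (reg e z)) => m.
by case: (z) => x y; apply: complexP; rewrite /sqn /=; ring.
Qed.

Lemma reg_defect_ge0 z : 0 <= reg_defect z.
Proof. by rewrite /reg_defect !mulr_ge0 ?sqn_ge0 // ltW. Qed.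

Let m := sqn (reg e A) * sqn (reg e B).
Definition reg_error c := reg_defect A + reg_defect B +
  (2 * (e * m * `|Im (A * B^*%C)|) + `|c| * normc (reg e A * reg e B - m%:C%C)).

(** The regularizing factors are complex, but up to the remainder [E] they act on [A - B - i c] as
    the real number [m] in [[0, 1]]. Multiplication by [m] preserves the inequality, and [T >= 0]
    permits replacing [m * T] by [T]. *)
Lemma reg_ineq P c T l : normc P <= 1 -> 0 <= T ->
  Im (P * (A - B - ('i * c%:C)%C)) <= T - l ->
  Im (reg e A * reg e B * (P * (A - B - ('i * c%:C)%C))) <= T - m * l + reg_error c.
Proof.
move=> P1 T0 H.
pose E := reg e B * (reg_defect A)%:C%C - reg e A * (reg_defect B)%:C%C +
  (('i * (2 * (e * m * Im (A * B^*%C)))%:C)%C - ('i * c%:C)%C * (reg e A * reg e B - m%:C%C)).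
have G : reg e A * reg e B * (A - B - ('i * c%:C)%C) = m%:C%C * (A - B - ('i * c%:C)%C) + E.
  have h1 : reg e A * reg e B * A = reg e B * (sqn (reg e A))%:C%C * A + reg e B * (reg_defect A)%:C%C.
    transitivity (reg e B * (reg e A * A)); first by ring.
    by rewrite reg_mul //; ring.
  have h2 : reg e A * reg e B * B = reg e A * (sqn (reg e B))%:C%C * B + reg e A * (reg_defect B)%:C%C.
    transitivity (reg e A * (reg e B * B)); first by ring.
    by rewrite reg_mul //; ring.
  (* By [regE] the cross terms are [e * m] times [A B^*] minus its conjugate, which is purely
     imaginary. *)
  have h3 : reg e B * (sqn (reg e A))%:C%C * A - reg e A * (sqn (reg e B))%:C%C * B =
      m%:C%C * (A - B) + ('i * (2 * (e * m * Im (A * B^*%C)))%:C)%C.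
    have := regE A0; have := regE B0; rewrite /m.
    move: (reg e A) (reg e B) (sqn (reg e A)) (sqn (reg e B)) => ra rb ma mb -> ->.
    by case: (A) (B) => x y [x' y']; apply: complexP => /=; ring.
  rewrite mulrBr mulrBr h1 h2 /E.
  transitivity (reg e B * (sqn (reg e A))%:C%C * A - reg e A * (sqn (reg e B))%:C%C * B
    + (reg e B * (reg_defect A)%:C%C - reg e A * (reg_defect B)%:C%C)
    - reg e A * reg e B * ('i * c%:C)%C); first by ring.
  by rewrite h3; ring.
rewrite mulrCA G mulrDr CImD mulrCA CImRM.
have m0 : 0 <= m by rewrite mulr_ge0 ?sqn_ge0.
have m1 : m <= 1 by rewrite mulr_ile1 ?sqn_ge0 // sqn_reg_le1.
have H1 : m * Im (P * (A - B - ('i * c%:C)%C)) <= T - m * l.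
  apply: le_trans (ler_wpM2l m0 H) _.
  by rewrite mulrBr lerD2r ler_piMl.
apply: lerD H1 _; apply: le_trans (ler_norm _) _; apply: le_trans (normIm_le _) _.
rewrite normcM; apply: le_trans (ler_piMl (normc_ge0 _) P1) _.
rewrite /E; apply: le_trans (le_normcD _ _) _.
have ni (x : R) : normc ('i * x%:C)%C = `|x|.
  by rewrite normcM normcR {1}/normc /= expr0n expr1n add0r sqrtr1 mul1r.
apply: lerD.
  apply: le_trans (le_normcD _ _) _; rewrite normcN !normcM !normcR.
  by apply: lerD; rewrite ger0_norm ?reg_defect_ge0 // ler_piMl ?reg_defect_ge0 // normc_reg_le1.
apply: le_trans (le_normcD _ _) _; rewrite normcN (normcM ('i * c%:C)%C) !ni lerD2r.
by rewrite (normrM 2) (normrM (e * m)) (normrM e m) (ger0_norm (ltW e0)) (ger0_norm m0) ger0_norm.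
Qed.

(** The cross term tends to zero pointwise; this majorant, integrable and independent of [e], is
    what dominated convergence needs. It rests on [e |reg e z|^2 |Im z| <= 1]. *)
Lemma reg_cross_le : e * m * `|Im (A * B^*%C)| <= Re A + Re B.
Proof.
have key z : 0 <= Re z -> e * sqn (reg e z) * `|Im z| <= 1.
  move=> z0; have s1 := Re_pos_neq0 (ltW e0) z0.
  rewrite sqn_reg mulrAC ler_pdivrMr ?(lt_le_trans _ s1) // mul1r.
  have : `|Im z| ^+ 2 = Im z ^+ 2 by rewrite real_normK ?num_real.
  have := normr_ge0 (Im z); move: z0 s1; case: (z) => x y /= x0 _ ny ny2.
  rewrite /sqn /= !mul0r subr0 add0r addr0 exprMn -ny2.
  have := mulr_ge0 (ltW e0) x0; nra.
have -> : Im (A * B^*%C) = Im A * Re B - Re A * Im B.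
  by case: (A) (B) => x y [x' y'] /=; ring.
have m0 : 0 <= e * m by rewrite mulr_ge0 ?(ltW e0) // mulr_ge0 ?sqn_ge0.
apply: le_trans (ler_wpM2l m0 (ler_normB _ _)) _.
rewrite !normrM (ger0_norm A0) (ger0_norm B0).
rewrite (_ : e * m * _ = sqn (reg e A) * (e * sqn (reg e B) * `|Im B|) * Re A +
  sqn (reg e B) * (e * sqn (reg e A) * `|Im A|) * Re B); last by rewrite /m; ring.
have e1 : 0 <= e by exact: ltW.
by apply: lerD; apply: ler_piMl => //; apply: mulr_ile1; rewrite ?sqn_ge0 ?sqn_reg_le1 ?key //
  mulr_ge0 // mulr_ge0 // sqn_ge0.
Qed.

Lemma reg_prod_le2 : normc (reg e A * reg e B - m%:C%C) <= 2.
Proof.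
apply: le_trans (le_normcD _ _) _; rewrite normcN normcM normcR.
have m0 : 0 <= m by rewrite mulr_ge0 ?sqn_ge0.
have m1 : m <= 1 by rewrite mulr_ile1 ?sqn_ge0 // sqn_reg_le1.
rewrite (ger0_norm m0) (_ : 2 = 1 + 1) // lerD // mulr_ile1 ?normc_ge0 //.
  exact: normc_reg_le1.
exact: normc_reg_le1.
Qed.

End Regularization.

End PointwiseBounds.

(** * The exponential lower bound *)

Section Preparation.
Variable R : realType.
Notation mu := (@lebesgue_measure R).
Implicit Types (f g : R -> R) (z p c : R[i]) (r s t e h : R).
Implicit Types (u v : nat -> R[i]) (X Y : R[i] -> R[i]) (x y : R -> R[i]).
Notation L1 f := (mu.-integrable (circle R) (EFin \o f)).

(** The parameter [(1 - cos t) / 2] is smooth and stays in [[0, 1]] for every real [t], so the curve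
    never leaves the segment and its endpoints need no separate treatment. *)
Lemma holo_segment X z1 z2 t : holo X -> normc z1 < 1 -> normc z2 < 1 ->
  ccont (fun t => X (z1 + ((1 - cos t) / 2)%:C%C * (z2 - z1))) t.
Proof.
move=> [X' [dX _]] h1 h2.
pose r := Num.max (normc z1) (normc z2).
have r1 : r < 1 by rewrite /r gt_max h1.
have cw : curve_in (t - 1) (t + 1) r (normc (z2 - z1))
    (fun t => z1 + ((1 - cos t) / 2)%:C%C * (z2 - z1))
    (fun t => (sin t / 2)%:C%C * (z2 - z1)).
  move=> x _; split.
  - pose k := (1 - cos x) / 2.
    have c1 := cos_le1 x; have c2 := cos_geN1 x.
    have k0 : 0 <= k by rewrite /k divr_ge0 // subr_ge0.
    have k1 : 0 <= 1 - k by rewrite /k; lra.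
    have -> : z1 + k%:C%C * (z2 - z1) = (1 - k)%:C%C * z1 + k%:C%C * z2.
      by rewrite rmorphB rmorph1; ring.
    apply: le_trans (le_normcD _ _) _.
    rewrite (normcM (1 - k)%:C%C) (normcM k%:C%C) !normcR (ger0_norm k0) (ger0_norm k1).
    have -> : r = (1 - k) * r + k * r by ring.
    by apply: lerD; rewrite ler_wpM2l // /r le_max lexx ?orbT.
  - rewrite (normcM (sin x / 2)%:C%C) normcR ler_piMl ?normc_ge0 //.
    by rewrite ler_norml; have := sin_geN1 x; have := sin_le1 x; lra.
  - have dk : is_derive x 1 (fun t : R => (1 - cos t) / 2) (sin x / 2).
      refine (is_derive_eq (fderiveM (fderiveD (is_derive_cst (1 : R) x 1)
        (fderiveN (is_derive_cos x))) (is_derive_cst (2^-1 : R) x 1)) _).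
      by rewrite mulr0 add0r sub0r opprK mulrC.
    apply: eq_cderive (cderiveD (cderive_cst z1 x)
      (cderiveM (cderiveR dk) (cderive_cst (z2 - z1) x))) _.
    by rewrite mulr0 addr0 add0r.
have [|k _] := dX _ _ _ _ _ _ r1 cw t; first by lra.
exact: cderive_ccont k.
Qed.

Lemma holo_IVT X z1 z2 : holo X -> normc z1 < 1 -> normc z2 < 1 ->
  Re (X z1) < 0 -> 0 < Re (X z2) -> exists2 p, normc p < 1 & Re (X p) = 0.
Proof.
move=> hX h1 h2 X1 X2.
pose w t := z1 + ((1 - cos t) / 2)%:C%C * (z2 - z1).
have w0 : w 0 = z1 by rewrite /w cos0 subrr mul0r rmorph0 mul0r addr0.
have wpi : w pi = z2.
  by rewrite /w cospi opprK -[1 + 1]/(2 : R) divff // rmorph1 mul1r addrC subrK.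
have [||k _ k0] := @IVT R (fun t => Re (X (w t))) 0 pi 0 (pi_ge0 R).
- apply: continuous_subspaceT => t.
  by have [] := @holo_segment X z1 z2 t hX h1 h2.
- by rewrite w0 wpi ge_min le_max (ltW X1) (ltW X2) orbT.
exists (w k) => //.
pose kk := (1 - cos k) / 2.
have c1 := cos_le1 k; have c2 := cos_geN1 k.
have kk0 : 0 <= kk by rewrite /kk divr_ge0 // subr_ge0.
have kk1 : 0 <= 1 - kk by rewrite /kk; lra.
have -> : w k = (1 - kk)%:C%C * z1 + kk%:C%C * z2.
  by rewrite /w -/kk rmorphB rmorph1; ring.
apply: le_lt_trans (le_normcD _ _) _.
rewrite (normcM (1 - kk)%:C%C) (normcM kk%:C%C) !normcR (ger0_norm kk0) (ger0_norm kk1).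
pose r := Num.max (normc z1) (normc z2).
have r1 : r < 1 by rewrite /r gt_max h1.
apply: le_lt_trans r1.
have -> : r = (1 - kk) * r + kk * r by ring.
by apply: lerD; rewrite ler_wpM2l // /r le_max lexx ?orbT.
Qed.

Lemma ae_exists (A : set R) (P : R -> Prop) : measurable A -> (0 < mu A)%E ->
  {ae mu, forall s, P s} -> exists2 s, A s & P s.
Proof.
move=> mA A0 [N [mN N0 NP]]; apply: contrapT => h.
have : (mu A <= mu N)%E.
  apply: le_measure; rewrite ?inE // => s As; apply: NP => /= Ps.
  by apply: h; exists s.
by rewrite N0 leNgt A0.
Qed.

Lemma reg_cvg z : ccvg (fun k => reg k.+2%:R^-1 z) 1.
Proof.
rewrite -[X in ccvg _ X]invr1.
apply: ccvgV; first exact: oner_neq0.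
rewrite -[X in ccvg _ X]addr0; apply: ccvgD; first exact: ccvg_cst.
rewrite -[X in ccvg _ X](mul0r z); apply: ccvgM; last exact: ccvg_cst.
split => /=; last exact: cvg_cst.
apply: (@cvg_right_seq R id 0).
by apply: cvg_within_filter; exact: cvg_id.
Qed.

Lemma eps_gt0 k : 0 < (k.+2%:R^-1 : R).
Proof. by rewrite invr_gt0 ltr0n. Qed.

Lemma bval_reg X x e : 0 < e -> (forall z, normc z < 1 -> 0 <= Re (X z)) ->
  bval X x -> bval (fun z => reg e (X z)) (fun s => reg e (x s)).
Proof.
move=> e0 X0 b; apply: (@bvalV R _ _ 1) => //.
  by move=> z z1; apply: normc_1D_ge1; rewrite CReRM mulr_ge0 ?(ltW e0) // X0.
by apply: bvalD; [exact: bval_cst|apply: bvalM => //; exact: bval_cst].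
Qed.

Lemma normc_reg_mul e z : 0 < e -> 0 <= Re z -> normc (reg e z * z) <= e^-1.
Proof.
move=> e0 z0; have e0' := ltW e0.
have w0 : 0 <= Re (e%:C%C * z) by rewrite CReRM mulr_ge0.
have := normc_qf_le1 w0; rewrite /qf -/(reg e z) -mulrA normcM normcR (ger0_norm e0').
by rewrite [z * _]mulrC -ler_pdivlMl // mulr1.
Qed.

Section Kernel.
Variable p : R[i].
Hypothesis p1 : normc p < 1.
Let P s := Re (herg_kernel p s).

Lemma kernel_bound s : `|P s| <= 2 / (1 - normc p).
Proof. exact: le_trans (normRe_le _) (herg_kernel_bound s p1). Qed.

Lemma kernel_measurable : measurable_fun (circle R) P.
Proof. by have [] := herg_kernel_cmeas p1. Qed.

Lemma L1_kernel g : L1 g -> L1 (fun s => g s * P s).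
Proof.
move=> gi; apply: (circ_integrableM gi kernel_measurable) => s _; exact: kernel_bound.
Qed.

Lemma kernel_DCT (F : nat -> R -> R) f g :
  (forall n, measurable_fun (circle R) (F n)) -> measurable_fun (circle R) f ->
  {ae mu, forall t, circle R t -> F ^~ t @ \oo --> f t} -> L1 g ->
  (forall n t, circle R t -> `|F n t| <= g t) ->
  \int[mu]_(t in circle R) (F n t * P t) @[n --> \oo] -->
    \int[mu]_(t in circle R) (f t * P t).
Proof.
move=> mF mf Ff gi Fg.
have gi2 : L1 (fun t => 2 / (1 - normc p) * g t) by exact: L1Z.
have [||||_ cv] := @circ_DCT R (fun n t => F n t * P t) (fun t => f t * P t) _ _ _ _ gi2.
- by move=> n; apply: measurable_funM => //; exact: kernel_measurable.
- by apply: measurable_funM => //; exact: kernel_measurable.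
- by apply: aeS Ff => t h ct; apply: cvgM; [exact: h|exact: cvg_cst].
- move=> n t ct; rewrite normrM mulrC ler_pM // ?kernel_bound // Fg //.
exact: cv.
Qed.

(** The defect is the difference of [Re (reg G * G)] and [g * |reg G|^2]. The first is the boundary
    value of a bounded function, so its integral is evaluated at [p]; the second converges
    dominatedly. Both limits are the Poisson integral of [g] at [p]. *)
Lemma defect_cvg g V : L1 g -> (forall s, 0 <= g s) ->
  bval (herg g) (fun s => (g s +i* V s)%C) ->
  (forall k, L1 (fun s => reg_defect k.+2%:R^-1 (g s +i* V s)%C * P s)) /\
  \int[mu]_(s in circle R) (reg_defect k.+2%:R^-1 (g s +i* V s)%C * P s) @[k --> \oo] --> 0.
Proof.
move=> gi g0 bg; pose G s := (g s +i* V s)%C; pose e k : R := k.+2%:R^-1.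
have e0 k : 0 < e k := eps_gt0 k.
have G0 z : normc z < 1 -> 0 <= Re (herg g z) by move=> z1; apply: herg_ge0.
have [_ mG _] := bg.
have br k := bval_reg (e0 k) G0 bg.
have mr k : measurable_fun (circle R) (fun s => sqn (reg (e k) (G s))).
  by apply: measurable_sqn; have [] := br k.
have r1 k s : sqn (reg (e k) (G s)) <= 1.
  exact: (sqn_reg_le1 (e0 k) (g0 s : 0 <= Re (G s))).
have gr k : L1 (fun s => g s * sqn (reg (e k) (G s))).
  by apply: (circ_integrableM gi (mr k) (B := 1)) => s _; rewrite ger0_norm ?sqn_ge0.
have [xi xI] : (forall k, L1 (fun s => Re (reg (e k) (G s) * G s) * P s)) /\
    (forall k, \int[mu]_(s in circle R) (Re (reg (e k) (G s) * G s) * P s) =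
      2 * pi * Re (reg (e k) (herg g p) * herg g p)).
  have H k : L1 (fun s => Re (reg (e k) (G s) * G s) * P s) /\
      \int[mu]_(s in circle R) (Re (reg (e k) (G s) * G s) * P s) =
      2 * pi * Re (reg (e k) (herg g p) * herg g p).
    apply: (bval_poisson (bvalM (br k) bg) (M := (e k)^-1) _ p1) => z z1.
    by apply: normc_reg_mul => //; exact: G0.
  by split=> k; have [] := H k.
have dE k s : reg_defect (e k) (G s) * P s =
    Re (reg (e k) (G s) * G s) * P s - g s * sqn (reg (e k) (G s)) * P s.
  rewrite (reg_mul (e0 k) (g0 s : 0 <= Re (G s))) CReD CReRM.
    rewrite -[Re (G s)]/(g s) -[Re (reg_defect _ _)%:C%C]/(reg_defect (e k) (G s)); ring.
have Pi k := L1_kernel (gr k).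
split=> [k|]; first by under eq_fun do rewrite dE; exact: L1B.
have E k : \int[mu]_(s in circle R) (reg_defect (e k) (G s) * P s) =
    2 * pi * Re (reg (e k) (herg g p) * herg g p) -
    \int[mu]_(s in circle R) (g s * sqn (reg (e k) (G s)) * P s).
  by rewrite -xI -RintegralB //; apply: eq_Rintegral => s _; exact: dE.
suff cv : 2 * pi * Re (reg (e k) (herg g p) * herg g p) -
    \int[mu]_(s in circle R) (g s * sqn (reg (e k) (G s)) * P s) @[k --> \oo] --> 0.
  by apply: cvg_trans cv; apply: near_eq_cvg; apply: nearW => k; rewrite -E.
have E2 : 2 * pi * Re (1 * herg g p) = \int[mu]_(s in circle R) (g s * P s).
  by rewrite mul1r Re_herg mulrA divff ?mul1r // gt_eqF // two_pi_gt0.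
rewrite -[X in _ --> X](subrr (2 * pi * Re (1 * herg g p))); apply: cvgB.
  apply: cvgM; first exact: cvg_cst.
  by have [] := ccvgM (reg_cvg (herg g p)) (ccvg_cst (herg g p)).
rewrite E2; apply: (kernel_DCT _ _ _ (L1norm gi)).
- by move=> k; apply: measurable_funM => //; exact: L1_measurable.
- exact: L1_measurable.
- apply: aeW => s cs; rewrite -[X in _ --> X]mulr1; apply: cvgM; first exact: cvg_cst.
  have <- : sqn (1 : R[i]) = 1 by rewrite /sqn /= expr0n addr0 expr1n.
  exact: ccvg_sqn (reg_cvg _).
- by move=> k s cs; rewrite normrM ler_piMr // ger0_norm ?sqn_ge0.
Qed.

End Kernel.

Section WfBval.
Variables (F0 : R[i] -> R[i]) (x0 : R -> R[i]) (b : R).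
Hypothesis bF : bval F0 x0.
Hypothesis F0pi : forall z, normc z < 1 -> `|Re (F0 z)| <= pi / 2.

Lemma Re_wf_ge0 z : `|Re z| <= pi / 2 -> 0 <= Re (wf b z).
Proof.
by move=> zpi; rewrite Re_wf mulr_ge0 ?expR_ge0 // cos_ge0_pihalf // -ler_norml.
Qed.

Lemma bval_wf : bval (fun z => wf b (F0 z)) (fun s => wf b (x0 s)).
Proof.
apply: bval_cexp; apply: bvalD; last exact: bval_cst.
by apply: bvalN; apply: bvalM => //; exact: bval_cst.
Qed.

Lemma bval_qf : bval (fun z => qf (wf b (F0 z))) (fun s => qf (wf b (x0 s))).
Proof.
apply: bvalM; first exact: bval_wf.
apply: (@bvalV R _ _ 1) => //.
  by move=> z z1; apply: normc_1D_ge1; exact/Re_wf_ge0/F0pi.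
by apply: bvalD; [exact: bval_cst|exact: bval_wf].
Qed.

Lemma bval_phi : bval (fun z => phi (wf b (F0 z))) (fun s => phi (wf b (x0 s))).
Proof.
apply: bvalM; first exact: bval_cst.
by apply: bvalD; [exact: bval_qf|apply: bvalM; exact: bval_qf].
Qed.

Lemma bval_lf : bval (fun z => lf (wf b (F0 z))) (fun s => lf (wf b (x0 s))).
Proof.
apply: bvalD; first exact: bval_qf.
by apply: bvalM; [exact: bval_cst|apply: bvalM; exact: bval_qf].
Qed.

End WfBval.

End Preparation.

(** * The inequality at an interior zero of the real part *)

Section Core.
Variable R : realType.
Notation mu := (@lebesgue_measure R).
Notation L1 f := (mu.-integrable (circle R) (EFin \o f)).

Lemma Re_Ni (z : R[i]) : Re (- 'i%C * z) = Im z.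
Proof. by case: z => x y /=; ring. Qed.

Lemma normc_i : normc ('i%C : R[i]) = 1.
Proof. by rewrite /normc /= expr0n expr1n add0r sqrtr1. Qed.

Lemma normc_Ni (z : R[i]) : normc (- 'i%C * z) = normc z.
Proof. by rewrite normcM normcN normc_i mul1r. Qed.

Lemma herg_bounded (g : R -> R) (B : R) z : L1 g -> normc z < 1 ->
  (forall s, circle R s -> `|g s| <= B) -> `|Re (herg g z)| <= B.
Proof.
move=> gi z1 gB.
have h1 : 0 <= Re (herg (fun s => B - g s) z).
  by apply: herg_ge0 => // s cs; rewrite subr_ge0 (le_trans (ler_norm _)) ?gB.
have h2 : 0 <= Re (herg (fun s => B + g s) z).
  by apply: herg_ge0 => // s cs; have := gB s cs; rewrite ler_norml; lra.
move: h1 h2; rewrite (hergB (L1cst B) gi) // (hergD (L1cst B) gi) // !herg_cst // !CReD CReN /=.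
by rewrite ler_norml; lra.
Qed.

Section RegularizedLimits.
Variables (A B : R[i]) (c : R).
Let e k : R := k.+2%:R^-1.
Let m k := sqn (reg (e k) A) * sqn (reg (e k) B).

Lemma eps_cvg : e k @[k --> \oo] --> (0 : R).
Proof. by apply: (@cvg_right_seq R id 0); apply: cvg_within_filter; exact: cvg_id. Qed.

Lemma sqn_reg_cvg z : sqn (reg (e k) z) @[k --> \oo] --> (1 : R).
Proof.
have <- : sqn (1 : R[i]) = 1 by rewrite /sqn /= expr0n addr0 expr1n.
exact: ccvg_sqn (reg_cvg _).
Qed.

Lemma reg_prod_cvg : m k @[k --> \oo] --> (1 : R).
Proof. by rewrite -[X in _ --> X]mulr1; apply: cvgM; exact: sqn_reg_cvg. Qed.

Lemma normc_cvg (u : nat -> R[i]) l : ccvg u l -> normc (u n) @[n --> \oo] --> normc l.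
Proof.
move=> /ccvg_sqn ul; rewrite normcE; under eq_fun do rewrite normcE.
by apply: continuous_cvg ul; exact: sqrt_continuous.
Qed.

Lemma reg_error_cvg :
  2 * (e k * m k * `|Im (A * B^*%C)|) +
    `|c| * normc (reg (e k) A * reg (e k) B - (m k)%:C%C) @[k --> \oo] --> (0 : R).
Proof.
have z1 : e k * m k * `|Im (A * B^*%C)| @[k --> \oo] --> (0 : R).
  rewrite -[X in _ --> X](mul0r `|Im (A * B^*%C)|); apply: cvgM; last exact: cvg_cst.
  by rewrite -[X in _ --> X](mul0r 1); apply: cvgM; [exact: eps_cvg|exact: reg_prod_cvg].
have z2 : normc (reg (e k) A * reg (e k) B - (m k)%:C%C) @[k --> \oo] --> (0 : R).
  have -> : (0 : R) = normc (1 * 1 - 1 : R[i]) by rewrite mulr1 subrr normc0.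
  apply: normc_cvg; apply: ccvgD; first by apply: ccvgM; exact: reg_cvg.
  by apply: ccvgN; split; [exact: reg_prod_cvg|exact: cvg_cst].
rewrite -[X in _ --> X](addr0 0); apply: cvgD.
  by rewrite -[X in _ --> X](mulr0 2); apply: cvgM => //; exact: cvg_cst.
by rewrite -[X in _ --> X](mulr0 `|c|); apply: cvgM => //; exact: cvg_cst.
Qed.

End RegularizedLimits.

Section Inequality.
Variables (f0 fA fB V0 VA VB : R -> R) (p : R[i]) (a : R).
Hypotheses (f0i : L1 f0) (fAi : L1 fA) (fBi : L1 fB).
Hypotheses (f0pi : forall s, `|f0 s| <= pi / 2).
Hypotheses (fA0 : forall s, 0 <= fA s) (fB0 : forall s, 0 <= fB s).
Let G0 s := (f0 s +i* V0 s)%C.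
Let GA s := (fA s +i* VA s)%C.
Let GB s := (fB s +i* VB s)%C.
Hypotheses (b0 : bval (herg f0) G0) (bA : bval (herg fA) GA) (bB : bval (herg fB) GB).
Hypothesis sides : {ae mu, forall s, circle R s ->
  (f0 s = pi / 2 /\ fB s = 0) \/ (f0 s = - (pi / 2) /\ fA s = 0)}.
Hypothesis p1 : normc p < 1.
Hypothesis pz : Re (herg f0 p) + Re (herg fA p) - Re (herg fB p) = 0.
Let c := Im (herg fA p) - Im (herg fB p).
Let b := a + 4 - c.
Let P s := Re (herg_kernel p s).
Let Hp s := Num.max (V0 s + VA s - VB s - a) 0.
Hypothesis Hpi : L1 Hp.
Let w s := wf b (G0 s).
Let W z := wf b (herg f0 z).
Let e k : R := k.+2%:R^-1.
Let e0 k : 0 < e k := eps_gt0 R k.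
Let X z := phi (W z) * (herg fA z - herg fB z - ('i * c%:C)%C).
Let x s := phi (w s) * (GA s - GB s - ('i * c%:C)%C).
Let m k s := sqn (reg (e k) (GA s)) * sqn (reg (e k) (GB s)).

Let A0 z : normc z < 1 -> 0 <= Re (herg fA z).
Proof. by move=> z1; apply: herg_ge0. Qed.

Let B0 z : normc z < 1 -> 0 <= Re (herg fB z).
Proof. by move=> z1; apply: herg_ge0. Qed.

Let F0pi z : normc z < 1 -> `|Re (herg f0 z)| <= pi / 2.
Proof. by move=> z1; apply: herg_bounded. Qed.

Let W0 z : normc z < 1 -> 0 <= Re (W z).
Proof. by move=> z1; apply: Re_wf_ge0; exact: F0pi. Qed.

Let w0 s : 0 <= Re (w s).
Proof. by apply: Re_wf_ge0; exact: f0pi. Qed.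

Let bl := bval_lf b b0 F0pi.
Let bp := bval_phi b b0 F0pi.

(** The factor [- i] turns the imaginary part of the product into the real part that the Poisson
    formula deals with. *)
Let regX k z := - 'i%C * (reg (e k) (herg fA z) * reg (e k) (herg fB z) * X z).
Let regx k s := - 'i%C * (reg (e k) (GA s) * reg (e k) (GB s) * x s).

Lemma bval_regX k : bval (regX k) (regx k).
Proof.
apply: bvalM; first exact: bval_cst.
apply: bvalM.
  by apply: bvalM; apply: bval_reg.
apply: bvalM; first exact: bp.
apply: bvalD; last exact: bval_cst.
by apply: bvalD; [exact: bA|exact: bvalN].
Qed.

Lemma regX_bounded k z : normc z < 1 -> normc (regX k z) <= (e k)^-1 + (e k)^-1 + `|c|.
Proof.
move=> z1; rewrite normc_Ni /X.
set rA := reg (e k) (herg fA z); set rB := reg (e k) (herg fB z).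
have -> : rA * rB * (phi (W z) * (herg fA z - herg fB z - ('i * c%:C)%C)) =
    phi (W z) * (rB * (rA * herg fA z) - rA * (rB * herg fB z) - rA * rB * ('i * c%:C)%C) by ring.
rewrite normcM; apply: le_trans (ler_piMl (normc_ge0 _) (normc_phi_le1 (W0 z1))) _.
have rA1 : normc rA <= 1 by apply: normc_reg_le1 => //; exact: A0.
have rB1 : normc rB <= 1 by apply: normc_reg_le1 => //; exact: B0.
apply: le_trans (le_normcD _ _) _; apply: lerD.
  apply: le_trans (le_normcD _ _) _; rewrite normcN (normcM rB) (normcM rA (rB * _)).
  apply: lerD.
    by apply: le_trans (ler_piMl (normc_ge0 _) rB1) (normc_reg_mul (e0 k) (A0 z1)).
  by apply: le_trans (ler_piMl (normc_ge0 _) rA1) (normc_reg_mul (e0 k) (B0 z1)).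
rewrite normcN (normcM (rA * rB)) (normcM 'i%C) normcR normc_i mul1r.
by apply: ler_piMl => //; rewrite normcM mulr_ile1 ?normc_ge0.
Qed.

Lemma regx_le k : {ae mu, forall s, circle R s ->
  Re (regx k s) <= Hp s - m k s * Re (lf (w s)) + reg_error (e k) (GA s) (GB s) c}.
Proof.
apply: aeS sides => s H /H {}H; rewrite Re_Ni /x.
apply: reg_ineq => //; [exact: fA0|exact: fB0|exact: normc_phi_le1| |].
  by rewrite le_max lexx orbT.
have -> : GA s - GB s - ('i * c%:C)%C = ((fA s - fB s) +i* (VA s - VB s - c))%C.
  by apply: complexP => /=; ring.
apply: (@bdry_ineq R (f0 s) (V0 s) _ _ _ _ a c) => //.
by case: H => [[-> ->]|[-> ->]]; [left|right].
Qed.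

(** This is [reg_error] without its two defects. The defects are integrated by [defect_cvg]; the
    rest is dominated pointwise by [dom], through [reg_cross_le] and [reg_prod_le2]. *)
Let err k s := 2 * (e k * m k s * `|Im (GA s * (GB s)^*%C)|) +
    `|c| * normc (reg (e k) (GA s) * reg (e k) (GB s) - (m k s)%:C%C).
Let G k s := Hp s - m k s * Re (lf (w s)) + err k s.
Let dom s := Hp s + 3 + (2 * (fA s + fB s) + `|c| * 2).

Let dom_int : L1 dom.
Proof.
apply: L1D; first by apply: L1D => //; exact: L1cst.
by apply: L1D; [apply: L1Z; exact: L1D|exact: L1cst].
Qed.

Let m01 k s : 0 <= m k s <= 1.
Proof.
by rewrite mulr_ge0 ?sqn_ge0 //= mulr_ile1 ?sqn_ge0 // sqn_reg_le1 //; [exact: fA0|exact: fB0].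
Qed.

Let l3 s : `|Re (lf (w s))| <= 3.
Proof. by apply: le_trans (normRe_le _) _; exact: normc_lf_le3. Qed.

Let G_dom k s : `|G k s| <= dom s.
Proof.
have /andP[m0 m1] := m01 k s.
have H0 : 0 <= Hp s by rewrite le_max lexx orbT.
apply: le_trans (ler_normD _ _) _; apply: lerD.
  apply: le_trans (ler_normB _ _) _; rewrite (ger0_norm H0) lerD2l normrM (ger0_norm m0).
  by apply: le_trans (ler_piMl _ m1) (l3 s).
have h1 := reg_cross_le (e0 k) (fA0 s : 0 <= Re (GA s)) (fB0 s : 0 <= Re (GB s)).
have h2 := reg_prod_le2 (e0 k) (fA0 s : 0 <= Re (GA s)) (fB0 s : 0 <= Re (GB s)).
have ek := ltW (e0 k).
rewrite ger0_norm; last first.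
  rewrite /err; apply: addr_ge0; first by rewrite mulr_ge0 // mulr_ge0 // mulr_ge0.
  by rewrite mulr_ge0 // normc_ge0.
by apply: lerD; [rewrite ler_pM2l|rewrite ler_wpM2l].
Qed.

Let mG k : measurable_fun (circle R) (G k).
Proof.
have brA := bval_reg (e0 k) A0 bA; have brB := bval_reg (e0 k) B0 bB.
have [_ cA _] := brA; have [_ cB _] := brB; have [_ [ml _] _] := bl.
have mm : measurable_fun (circle R) (m k).
  by apply: measurable_funM; apply: measurable_sqn.
have [_ [_ mVA] _] := bA; have [_ [_ mVB] _] := bB.
have mA := L1_measurable fAi; have mB := L1_measurable fBi.
apply: measurable_funD; first apply: measurable_funB.
- exact: L1_measurable.
- exact: measurable_funM.
apply: measurable_funD; apply: measurable_funM => //; first apply: measurable_funM.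
- by apply: measurable_funM => //; exact: measurable_cst.
- apply: measurableT_comp => //=.
  by apply: measurable_funD; apply: measurable_funM => //; exact: measurableT_comp.
under eq_fun do rewrite normcE.
apply: measurableT_comp.
  by apply: continuous_measurable_fun; exact: sqrt_continuous.
apply: measurable_sqn; apply: cmeasD; first exact: cmeasM.
by apply: cmeasN; split => //=; exact: measurable_cst.
Qed.

(** For each [k] the bounded function [regX k] obeys the Poisson formula, and [regx_le] bounds its
    boundary values. The limit in [k] removes the regularization on both sides. *)
Lemma core_limit : 2 * pi * Im (X p) <=
  \int[mu]_(s in circle R) ((Hp s - Re (lf (w s))) * P s).
Proof.
have [dA dA0] := defect_cvg p1 fAi fA0 bA.
have [dB dB0] := defect_cvg p1 fBi fB0 bB.
have Gi k : L1 (G k).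
  apply: (le_integrable (@measurable_circleR R) _ _ dom_int); first by apply/measurable_EFinP; exact: mG.
  move=> s _; rewrite /= lee_fin; apply: le_trans (G_dom k s) (ler_norm _).
have P0 s : 0 <= P s by exact: Re_herg_kernel_ge0.
have cG : \int[mu]_(s in circle R) (G k s * P s) @[k --> \oo] -->
    \int[mu]_(s in circle R) ((Hp s - Re (lf (w s))) * P s).
  apply: (kernel_DCT p1 _ _ _ dom_int) => //.
  - have [_ [ml _] _] := bl.
    by apply: measurable_funB => //; exact: L1_measurable.
  - apply: aeW => s cs; rewrite -[X in _ --> X]addr0; apply: cvgD; last exact: reg_error_cvg.
    apply: cvgB; first exact: cvg_cst.
    rewrite -[X in _ --> X]mul1r; apply: cvgM; last exact: cvg_cst.
    exact: reg_prod_cvg.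
have cX : 2 * pi * Im (reg (e k) (herg fA p) * reg (e k) (herg fB p) * X p) @[k --> \oo] -->
    2 * pi * Im (1 * 1 * X p).
  apply: cvgM; first exact: cvg_cst.
  have [] // := ccvgM (ccvgM (reg_cvg (herg fA p)) (reg_cvg (herg fB p))) (ccvg_cst (X p)).
rewrite !mul1r in cX.
pose IA k := \int[mu]_(s in circle R) (reg_defect (e k) (GA s) * P s).
pose IB k := \int[mu]_(s in circle R) (reg_defect (e k) (GB s) * P s).
pose IG k := \int[mu]_(s in circle R) (G k s * P s).
have cS : IA k + IB k + IG k @[k --> \oo] -->
    0 + 0 + \int[mu]_(s in circle R) ((Hp s - Re (lf (w s))) * P s).
  exact: cvgD (cvgD dA0 dB0) cG.
rewrite !add0r in cS; apply: (ler_cvg_to cX cS); apply: nearW => k.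
have [xi xI] := bval_poisson (bval_regX k) (@regX_bounded k) p1.
have -> : 2 * pi * Im (reg (e k) (herg fA p) * reg (e k) (herg fB p) * X p) =
  \int[mu]_(s in circle R) (Re (regx k s) * Re (herg_kernel p s)) by rewrite xI Re_Ni.
rewrite /IA /IB /IG.
have Gk := L1_kernel p1 (Gi k).
have D1 := L1D (dA k) (dB k).
rewrite -(RintegralD _ (dA k) (dB k)) // -(RintegralD _ D1 Gk) //.
apply: circ_le_ae => //; first exact: L1D.
apply: aeS (regx_le k) => s H cs.
have := ler_wpM2r (P0 s) (H cs); rewrite /reg_error -/(m k s) -/(err k s).
by move/le_trans; apply; rewrite /G -!mulrDl; apply: ler_wpM2r => //; lra.
Qed.

Lemma core : 2 * pi * Re (lf (W p)) <= \int[mu]_(s in circle R) (Hp s * P s).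
Proof.
have [li lI] := bval_poisson bl (fun z z1 => normc_lf_le3 (W0 z1)) p1.
have := core_limit; under eq_Rintegral do rewrite mulrBl.
rewrite RintegralB //; last exact: L1_kernel.
rewrite lI => H.
suff : 0 <= 2 * pi * Im (X p) by move: H; rewrite -/(W p); lra.
rewrite mulr_ge0 ?(ltW (two_pi_gt0 R)) //.
(* The choice of [c] cancels the imaginary part at [p]. *)
rewrite /X; have -> : herg fA p - herg fB p - ('i * c%:C)%C = (Re (herg fA p) - Re (herg fB p))%:C%C.
  rewrite /c; case: (herg fA p) (herg fB p) => x1 y1 [x2 y2].
  by apply: complexP => /=; ring.
rewrite mulrC CImRM mulrC; apply: Im_phi_sign; first exact: W0.
have -> : Re (herg fA p) - Re (herg fB p) = - Re (herg f0 p) by move: pz; lra.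
(* What remains is [sin u * u >= 0] for [|u| <= pi / 2]. *)
rewrite Im_wf mulrNN -mulrA mulr_ge0 ?expR_ge0 //.
have := F0pi p1; rewrite ler_norml => /andP[q1 q2].
have pp := pi_gt0 R.
have [t0|t0] := lerP 0 (Re (herg f0 p)).
  by rewrite mulr_ge0 // sin_ge0_pi //; lra.
rewrite -mulrNN -sinN mulr_ge0 ?oppr_ge0 ?(ltW t0) // sin_ge0_pi //; lra.
Qed.

End Inequality.

End Core.

(** * The tail of the conjugate function *)

Section Tail.
Variable R : realType.
Notation mu := (@lebesgue_measure R).
Notation L1 f := (mu.-integrable (circle R) (EFin \o f)).

Lemma ccvg_unique (u : nat -> R[i]) l k : ccvg u l -> ccvg u k -> l = k.
Proof.
by move=> [a b] [c d]; apply: complexP; [exact: cvg_unique a c|exact: cvg_unique b d].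
Qed.

Lemma L1_dom (f g : R -> R) : measurable_fun (circle R) f -> L1 g ->
  (forall s, circle R s -> `|f s| <= g s) -> L1 f.
Proof.
move=> mf gi fg; apply: (le_integrable (@measurable_circleR R) _ _ gi).
  exact/measurable_EFinP.
by move=> s cs; rewrite /= lee_fin (le_trans (fg s cs)) // ler_norm.
Qed.

Lemma Re_herg_kernel_lower (p : R[i]) : normc p < 1 ->
  exists2 k : R, 0 < k & forall s, k <= Re (herg_kernel p s).
Proof.
move=> p1; have p0 := normc_ge0 p.
have q0 : 0 < 1 - sqn p by rewrite subr_gt0 -normc_sqr expr_lt1.
exists ((1 - sqn p) / 4); first by rewrite divr_gt0.
move=> s; rewrite Re_herg_kernel ler_pM2l //.
have l1 : 1 - normc p <= normc (cis s - p).
  by have := le_normcB (cis s) p; rewrite normc_cis.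
have l2 : normc (cis s - p) <= 2.
  apply: le_trans (le_normcD _ _) _; rewrite normcN normc_cis.
  by rewrite (_ : 2 = 1 + 1) // lerD2l ltW.
have l3 : 0 < normc (cis s - p) by apply: lt_le_trans l1; rewrite subr_gt0.
rewrite lef_pV2 ?posrE //; last by rewrite -normc_sqr exprn_gt0.
by rewrite -normc_sqr (_ : 4 = 2 ^+ 2) ?ler_sqr ?nnegrE ?normc_ge0 // -natrX.
Qed.

(** The kernel at a fixed [p] is bounded below by a positive constant, so a vanishing Poisson
    integral would force [g = 0] almost everywhere, also on [N]. *)
Lemma herg_gt0 (g : R -> R) (N : set R) p : L1 g -> (forall s, circle R s -> 0 <= g s) ->
  measurable N -> (0 < mu N)%E -> N `<=` circle R ->
  {ae mu, forall s, N s -> g s != 0} -> normc p < 1 -> 0 < Re (herg g p).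
Proof.
move=> gi g0 mN N0 Nc gN p1.
have h0 : 0 <= Re (herg g p) by exact: herg_ge0.
rewrite lt_neqAle h0 andbT; apply/eqP => /esym E.
have [k k0 kP] := Re_herg_kernel_lower p1.
have I0 : \int[mu]_(s in circle R) g s = 0.
  apply/eqP; rewrite eq_le; apply/andP; split; last exact: Rintegral_ge0.
  move/eqP: E; rewrite Re_herg mulf_eq0 invr_eq0 gt_eqF ?two_pi_gt0 //= => /eqP E.
  rewrite -(pmulr_rle0 _ k0) -(RintegralZl k (@measurable_circleR R) gi).
  apply: (@le_trans _ _ (\int[mu]_(s in circle R) (g s * Re (herg_kernel p s)))); last by rewrite E.
  apply: (le_Rintegral (@measurable_circleR R)); [exact: L1Z|exact: L1_kernel|].
  by move=> s cs; rewrite mulrC ler_wpM2l ?g0.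
have : {ae mu, forall s, circle R s -> g s = 0}.
  have mg : measurable_fun (circle R) (EFin \o g) by apply/measurable_EFinP; exact: L1_measurable.
  have /(ae_eq_integral_abs mu (@measurable_circleR R) mg) : (\int[mu]_(x in circle R) `|(EFin \o g) x| = 0)%E.
    rewrite -[RHS]/(0 : R)%:E -I0 /Rintegral fineK; last exact: integrable_fin_num.
    by apply: eq_integral => s /set_mem cs; rewrite /= ger0_norm // g0.
  by apply: aeS => s H /H [].
move=> /(aeI gN) /(ae_exists mN N0)[s Ns [H1 H2]].
by move: (H1 Ns); rewrite H2 ?eqxx //; exact: Nc.
Qed.

(** The integrability of the tail function is a premise of the bound because the real-valued
    integral of a nonnegative function with infinite integral is [0] by convention. *)
Lemma conj_tail (f : R -> R) : L1 f ->
  (0 < mu (circle R `&` f @^-1` `[(pi / 2)%R, +oo[))%E ->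
  (mu (circle R `&` f @^-1` `[(pi / 2)%R, +oo[) < (2 * pi)%:E)%E ->
  mu (circle R `&` f @^-1` `](- (pi / 2)), (pi / 2)[) = 0%E ->
  exists V : R -> R, [/\ measurable_fun (circle R) V,
    {ae mu, forall s, circle R s -> V s = conj_fun f s} &
    exists2 k : R, 0 < k & exists a0 : R, forall a, a0 <= a ->
      L1 (fun s => Num.max (V s - a) 0) ->
      k * expR (- a) <= \int[mu]_(s in circle R) Num.max (V s - a) 0].
Proof.
move=> fi pos lt gap; have pp := pi_gt0 R.
have mf := L1_measurable fi.
pose S := circle R `&` f @^-1` `[pi / 2, +oo[.
have mS : measurable S by exact: (mf (@measurable_circleR R) _ (measurable_itv _)).
pose N := circle R `\` S; have mN : measurable N.
  exact: (measurableD (@measurable_circleR R) mS).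
have N0 : (0 < mu N)%E.
  rewrite lt0e measure_ge0 andbT; apply/eqP => N0.
  have : (mu (circle R) <= mu S + mu N)%E.
    apply: le_trans (mu_setU_le mS mN); apply: le_measure; rewrite ?inE.
    - exact: measurable_circleR.
    - exact: measurableU.
    - by move=> s cs; have [Ss|Ss] := pselect (S s); [left|right].
  by rewrite N0 adde0 mu_circle leNgt lt.
have aef : {ae mu, forall s, circle R s -> f s <= - (pi / 2) \/ pi / 2 <= f s}.
  exists (circle R `&` f @^-1` `](- (pi / 2)), (pi / 2)[); split;
    [exact: (mf (@measurable_circleR R) _ (measurable_itv _))|exact: gap|].
  move=> s /= /not_implyP[cs /not_orP[/negP a /negP b]]; split => //=.
  by rewrite in_itv /= !ltNge a b.
(* Clamping [f] to [[- pi / 2, pi / 2]] gives a function equal to one of the two endpoints almost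
   everywhere, since [f] avoids the open interval. *)
pose f0 s := Num.max (- (pi / 2)) (Num.min (pi / 2) (f s)).
pose fA s := Num.max (f s - pi / 2) 0; pose fB s := Num.max (- f s - pi / 2) 0.
have fE s : f s = f0 s + fA s - fB s.
  rewrite /f0 /fA /fB /Order.max /Order.min.
  by do ![case: ifPn]; rewrite -?leNgt; lra.
have f0pi s : `|f0 s| <= pi / 2.
  by rewrite ler_norml /f0 le_max lexx /= ge_max ge_min lexx /=; lra.
have fA0 s : 0 <= fA s by rewrite le_max lexx orbT.
have fB0 s : 0 <= fB s by rewrite le_max lexx orbT.
have m0 : measurable_fun (circle R) f0.
  by apply: measurable_maxr => //; apply: measurable_minr.
have mA : measurable_fun (circle R) fA.
  by apply: measurable_maxr => //; apply: measurable_funB.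
have mB : measurable_fun (circle R) fB.
  by apply: measurable_maxr => //; apply: measurable_funB => //; exact: measurableT_comp.
have f0i : L1 f0 by apply: (circ_integrable_bounded m0 (B := pi / 2)).
have fAi : L1 fA.
  apply: (L1_dom mA (L1norm fi)) => s _; rewrite ger0_norm // ge_max normr_ge0 andbT.
  by apply: le_trans (ler_norm _); lra.
have fBi : L1 fB.
  apply: (L1_dom mB (L1norm fi)) => s _; rewrite ger0_norm // ge_max normr_ge0 andbT.
  by rewrite -normrN; apply: le_trans (ler_norm _); lra.
have [V [mV Vc bV]] := bval_herg fi.
have [V0 [mV0 _ b0]] := bval_herg f0i.
have [VA [mVA _ bA]] := bval_herg fAi.
have [VB [mVB _ bB]] := bval_herg fBi.
have hE z : normc z < 1 -> herg f z = herg f0 z + herg fA z - herg fB z.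
  move=> z1; rewrite -hergD // -hergB //; last exact: L1D.
  by congr (herg _ _); apply/funext.
have VE : {ae mu, forall s, circle R s -> V s = V0 s + VA s - VB s}.
  have [_ _ c] := bV; have [_ _ c0] := b0; have [_ _ cA] := bA; have [_ _ cB] := bB.
  apply: aeS (aeI c (aeI c0 (aeI cA cB))) => s [H [H0 [HA HB]]] cs.
  have := ccvgD (ccvgD (H0 cs) (HA cs)) (ccvgN (HB cs)).
  have -> : (fun n => herg f0 (rpt n.+2%:R^-1 s) + herg fA (rpt n.+2%:R^-1 s) -
      herg fB (rpt n.+2%:R^-1 s)) = (fun n => herg f (rpt n.+2%:R^-1 s)).
    by apply/funext => n; rewrite hE // rpt_disc.
  by move=> /(ccvg_unique (H cs))[].
(* This sum, rather than the representative obtained from [f], is what [core] integrates; the two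
   agree almost everywhere. *)
exists (fun s => V0 s + VA s - VB s); split.
- by apply: measurable_funB => //; exact: measurable_funD.
- by apply: aeS (aeI VE Vc) => s [H1 H2] cs; rewrite -H1 // H2.
have [p p1 pz] : exists2 p, normc p < 1 & Re (herg f p) = 0.
  have [_ _ c] := bV.
  have [s1 [cs1 fs1] H1] := ae_exists mS pos c.
  have [s2 [cs2 fs2] [H2 f2]] := ae_exists mN N0 (aeI c aef).
  have f1p : 0 < f s1 by move: fs1; rewrite /= in_itv /= andbT; lra.
  have f2n : f s2 < 0.
    have [|h] := f2 cs2; first by lra.
    by exfalso; apply: fs2; split => //=; rewrite in_itv /= h.
  have [/= c1 _] := H1 cs1; have [/= c2 _] := H2 cs2.
  have [n1 _ /(_ n1 (leqnn _)) /= hn1] := cvgr_gt _ c1 _ f1p.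
  have [n2 _ /(_ n2 (leqnn _)) /= hn2] := cvgr_lt _ c2 _ f2n.
  by apply: (holo_IVT (holo_herg fi) (rpt_disc n2 s2) (rpt_disc n1 s1)).
pose x0 := Re (herg f0 p).
(* Strictness comes from [f0] differing from either endpoint on a set of positive measure; it makes
   [K = cos x0] positive. *)
have x0lt : `|x0| < pi / 2.
  rewrite ltr_norml; apply/andP; split.
    have : 0 < Re (herg (fun s => f0 s - - (pi / 2)) p).
      apply: (@herg_gt0 _ S) => //.
      - by apply: L1B => //; exact: L1cst.
      - by move=> s _; have := f0pi s; rewrite ler_norml; lra.
      - by move=> s [].
      - apply: aeW => s [_]; rewrite /= in_itv /= andbT /f0 => h.
        by rewrite min_l // max_r; [rewrite gt_eqF //; lra|lra].
    by rewrite (hergB f0i (L1cst _)) // herg_cst // CReD CReN -/x0 subr_gt0.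
  have : 0 < Re (herg (fun s => pi / 2 - f0 s) p).
    apply: (@herg_gt0 _ N) => //.
    - by apply: L1B => //; exact: L1cst.
    - by move=> s _; have := f0pi s; rewrite ler_norml; lra.
    - by move=> s [].
    - apply: aeS aef => s H [cs nS]; have [h|h] := H cs; last first.
        by exfalso; apply: nS; split => //=; rewrite in_itv /= h.
      by rewrite /f0 min_r ?max_l; [rewrite gt_eqF //; lra|lra|lra].
  by rewrite (hergB (L1cst _) f0i) // herg_cst // CReD CReN -/x0 subr_gt0.
have sides : {ae mu, forall s, circle R s ->
    (f0 s = pi / 2 /\ fB s = 0) \/ (f0 s = - (pi / 2) /\ fA s = 0)}.
  apply: aeS aef => s H cs; rewrite /f0 /fA /fB; have [h|h] := H cs.
    right; split; last by rewrite max_r //; lra.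
    by rewrite min_r; [rewrite max_l //; lra|lra].
  left; split; last by rewrite max_r //; lra.
  by rewrite min_l // max_r //; lra.
have pz' : Re (herg f0 p) + Re (herg fA p) - Re (herg fB p) = 0.
  by rewrite -pz hE // !CReD CReN.
pose c := Im (herg fA p) - Im (herg fB p).
pose K := cos x0.
have K0 : 0 < K by rewrite /K cos_gt0_pihalf // -ltr_norml.
pose D := expR (Im (herg f0 p) + c - 4).
have D0 : 0 < D by exact: expR_gt0.
pose C := 2 / (1 - normc p).
have C0 : 0 < C by rewrite divr_gt0 // subr_gt0.
exists (pi * D * K / C); first by rewrite divr_gt0 // mulr_gt0 // mulr_gt0.
(* Above this threshold [6 * E <= K], so the quadratic error [3 * E ^+ 2] in [Re_lf_ge] takes at
   most half of the main term [E * K]. *)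
exists (- ln (K / (6 * D))) => a aa Hi.
have := core f0i fAi fBi f0pi fA0 fB0 b0 bA bB sides p1 pz' Hi.
rewrite -/c; set w := wf _ _ => H.
pose E := D * expR (- a).
have wE : normc w = E.
  by rewrite normc_wf /E /D -expRD; congr expR; rewrite -/c; ring.
have Rw : Re w = E * K.
  by rewrite Re_wf -[expR _]normc_wf -/w wE.
have w0 : 0 <= Re w by apply: Re_wf_ge0; exact: ltW.
have E6 : 6 * E <= K.
  have : expR (- a) <= K / (6 * D).
    rewrite -[leRHS]lnK ?posrE ?divr_gt0 ?mulr_gt0 // ler_expR; lra.
  by rewrite ler_pdivlMr ?mulr_gt0 // /E mulrC mulrA.
have E0 : 0 < E by rewrite mulr_gt0 // expR_gt0.
have lfE : E * K / 2 <= Re (lf w).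
  apply: le_trans (Re_lf_ge w0); rewrite wE Rw expr2.
  have := ler_wpM2l (ltW E0) E6; lra.
rewrite mulrAC ler_pdivrMr // [leRHS]mulrC.
have H2 : 2 * pi * (E * K / 2) <= \int[mu]_(s in circle R)
    (Num.max (V0 s + VA s - VB s - a) 0 * Re (herg_kernel p s)).
  by apply: le_trans H; rewrite ler_pM2l ?two_pi_gt0.
have H3 : \int[mu]_(s in circle R) (Num.max (V0 s + VA s - VB s - a) 0 * Re (herg_kernel p s)) <=
    C * \int[mu]_(s in circle R) (Num.max (V0 s + VA s - VB s - a) 0).
  rewrite -RintegralZl //; apply: (le_Rintegral (@measurable_circleR R)).
  - exact: L1_kernel.
  - exact: L1Z.
  - move=> s _; rewrite mulrC ler_wpM2r ?le_max ?lexx ?orbT //.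
    exact: le_trans (ler_norm _) (kernel_bound p1 s).
apply: le_trans (le_trans H2 H3); rewrite le_eqVlt; apply/orP; left; apply/eqP.
by rewrite /E; field.
Qed.

End Tail.

(** * Convex functions *)

Section ConvexTail.
Variable R : realType.
Notation mu := (@lebesgue_measure R).
Notation L1 f := (mu.-integrable (circle R) (EFin \o f)).
Variable Y : R -> R.
Hypothesis Y_ge0 : forall x, 0 <= Y x.
Hypothesis Y_convex : convex_function [set: R^o] (Y : R^o -> R^o).

Lemma convex_chord (x y z : R) : x <= y <= z ->
  Y y * (z - x) <= (z - y) * Y x + (y - x) * Y z.
Proof.
move=> /andP[xy yz]; have [xz|xz] := ltrP x z; last first.
  have -> : z = x by lra.
  by rewrite subrr mulr0 (_ : y = x) ?subrr ?mul0r ?addr0 //; lra.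
have d0 : 0 < z - x by rewrite subr_gt0.
have t0 : 0 <= (z - y) / (z - x) by rewrite divr_ge0 // ?subr_ge0 // ltW.
have t1 : (z - y) / (z - x) <= 1 by rewrite ler_pdivrMr // mul1r lerD2l lerN2.
pose t := (z - y) / (z - x).
have H : Y (t * x + (1 - t) * z) <= t * Y x + (1 - t) * Y z.
  exact: (@Y_convex (Itv01 t0 t1) x z (in_setT _) (in_setT _)).
have E : t * x + (1 - t) * z = y.
  by rewrite /t; field; rewrite gt_eqF.
rewrite E in H; rewrite -ler_pdivlMr //; apply: le_trans H _.
by rewrite le_eqVlt; apply/orP; left; apply/eqP; rewrite /t; field; rewrite gt_eqF.
Qed.

(** The strict sublevel sets of a convex function are intervals. *)
Lemma convex_measurable (D : set R) : measurable D -> measurable_fun D Y.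
Proof.
move=> mD; apply: (measurability (@RGenInftyO.G R)) => [|/= _ [_] [r] -> <-].
  exact: RGenInftyO.measurableE.
apply: measurableI => //; apply: is_interval_measurable => s t/=.
rewrite !in_itv/= => fs ft u /andP[su ut]; rewrite in_itv /=.
have [E|st] := eqVneq s t.
  by rewrite (_ : u = s) //; move: ut; rewrite -E => us; apply/eqP; rewrite eq_le us su.
have st' : 0 < t - s by rewrite subr_gt0 lt_neqAle st (le_trans su).
have := @convex_chord s u t; rewrite su ut => /(_ isT) H.
rewrite -(ltr_pM2r st'); apply: le_lt_trans H _.
have -> : r * (t - s) = (t - u) * r + (u - s) * r by ring.
have [us|us] := eqVneq u s.
  by rewrite us subrr !mul0r !addr0 ltr_pM2l.
apply: ler_ltD; first by rewrite ler_wpM2l ?subr_ge0 // ltW.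
by rewrite ltr_pM2l // subr_gt0 lt_neqAle eq_sym us.
Qed.

Lemma convex_itv_le (x y z : R) : x <= y <= z -> Y y <= Y x + Y z.
Proof.
move=> /andP[xy yz]; have [xz|xz] := ltrP x z; last first.
  by rewrite (_ : y = x) ?lerDl ?Y_ge0 //; lra.
have := @convex_chord x y z; rewrite xy yz => /(_ isT) H.
have d0 : 0 < z - x by rewrite subr_gt0.
rewrite -(ler_pM2r d0); apply: le_trans H _; rewrite [leRHS]mulrDl.
by apply: lerD; rewrite mulrC ler_wpM2l ?Y_ge0 //; lra.
Qed.

Let W n := \sum_(0 <= j < n) Y j%:R * expR (- j%:R).

Let W0 : W 0 = 0. Proof. by rewrite /W big_nil. Qed.

Let WS n : W n.+1 = W n + Y n%:R * expR (- n%:R).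
Proof. by rewrite /W big_nat_recr. Qed.

(** On [[i, i + 1[] the integrand is at most [(Y i + Y (i + 1)) * exp (- i)]; the shifted index in
    the second term costs the factor [expR 1]. *)
Lemma exp_integral_fin (C : R) : (forall n, W n <= C) ->
  (\int[mu]_(x in `[0%R, +oo[) (Y x * expR (- x))%:E < +oo)%E.
Proof.
move=> WC; pose F (i : nat) : set R := `[i%:R, i.+1%:R[%classic.
have mF i : measurable (F i) by exact: measurable_itv.
have UF : \bigcup_i F i = `[0%R, +oo[%classic.
  apply/seteqP; split => [x [i _]|x]; rewrite /F /= !in_itv /= ?andbT.
    by move=> /andP[+ _]; apply: le_trans; rewrite ler0n.
  move=> x0; exists (Num.trunc x) => //=; rewrite /F /= in_itv /=.
  exact: truncn_itv.
have tF : trivIset setT F.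
  apply/trivIsetP => i j _ _ ij; apply/seteqP; split => // x []; rewrite /F /=.
  rewrite !in_itv /= => /andP[a b] /andP[c d].
  move: ij; apply/negP; rewrite negbK eqn_leq.
  by rewrite -ltnS -[X in _ && X]ltnS -!(ltr_nat R) (le_lt_trans a d) (le_lt_trans c b).
have mf D : measurable D -> measurable_fun D (fun x => (Y x * expR (- x))%:E).
  move=> mD; apply/measurable_EFinP; apply: measurable_funM; first exact: convex_measurable.
  by apply: measurableT_comp => //; exact: measurableT_comp.
have f0 x : (0 <= (Y x * expR (- x))%:E)%E by rewrite lee_fin mulr_ge0 ?expR_ge0.
have mU : measurable (\bigcup_i F i) by rewrite UF; exact: measurable_itv.
have IE := @ge0_integral_bigcup _ _ _ mu F _ mF (mf _ mU) (fun x _ => f0 x) tF.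
rewrite /= UF in IE; rewrite IE.
apply: (@le_lt_trans _ _ (C + expR 1 * C)%:E); last exact: ltry.
apply: lime_le; first by apply: is_cvg_nneseries => n _ _; exact: integral_ge0.
apply: nearW => n.
have muF i : mu (F i) = 1%E.
  have := lebesgue_measure_itv `[(i%:R : R), i.+1%:R[; rewrite /= lte_fin ltr_nat ltnSn => ->.
  by rewrite -EFinB -natrB // subSnn.
have step i : (\int[mu]_(x in F i) (Y x * expR (- x))%:E <=
    ((Y i%:R + Y i.+1%:R) * expR (- i%:R))%:E)%E.
  have -> : ((Y i%:R + Y i.+1%:R) * expR (- i%:R))%:E =
      (\int[mu]_(x in F i) (cst ((Y i%:R + Y i.+1%:R) * expR (- i%:R))%:E x))%E.
    by have -> := integral_cst mu (mF i); rewrite [X in (_ * X)%E](muF i) mule1.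
  apply: ge0_le_integral.
  - exact: mF.
  - by move=> x _; exact: f0.
  - exact: mf (mF i).
  - exact: measurable_cst.
  move=> x; rewrite /F /= in_itv /= => /andP[a b].
  rewrite lee_fin ler_pM ?expR_ge0 //; last by rewrite ler_expR lerN2.
  by apply: convex_itv_le; rewrite a ltW.
apply: (@le_trans _ _ (\sum_(0 <= i < n) ((Y i%:R + Y i.+1%:R) * expR (- i%:R))%:E)%E).
  by apply: lee_sum => i _; exact: step.
rewrite sumEFin lee_fin.
have -> : \sum_(0 <= i < n) ((Y i%:R + Y i.+1%:R) * expR (- i%:R)) =
    W n + expR 1 * (W n.+1 - Y 0).
  elim: (n) => [|k IH]; first by rewrite WS W0 big_nil add0r oppr0 expR0 mulr1 add0r subrr mulr0.
  have eE : expR 1 * expR (- k.+1%:R) = expR (- k%:R) :> R.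
    by rewrite -expRD; congr expR; rewrite -natr1; ring.
  by rewrite big_nat_recr //= IH !WS -eE; ring.
by rewrite lerD // ler_pM2l ?expR_gt0 // lerBlDr (le_trans (WC _)) // lerDl.
Qed.

Lemma W_le n k : (n <= k)%N -> W n <= W k.
Proof.
move=> nk; rewrite -(subnK nk); elim: (k - n)%N => [//|j IH].
by rewrite addSn WS (le_trans IH) // lerDl mulr_ge0 // expR_ge0.
Qed.

Let r1 : R := expR (-1).

Let r1_lt1 : r1 < 1.
Proof. by rewrite /r1 expR_lt1 ltrN10. Qed.

Let expS n : expR (- n.+1%:R) = r1 * expR (- n%:R) :> R.
Proof. by rewrite /r1 -expRD; congr expR; rewrite -natr1; ring. Qed.

Hypothesis Y_int : (\int[mu]_(x in `[0%R, +oo[) (Y x * expR (- x))%:E = +oo)%E.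

Lemma W_unbounded C : exists n, C < W n.
Proof.
apply: contrapT => /forallNP H; have : forall n, W n <= C.
  by move=> n; rewrite leNgt; apply/negP; exact: H.
by move=> /exp_integral_fin; rewrite Y_int ltxx.
Qed.

(** Otherwise [Y] would be bounded along the integers beyond [N0], and [W] would be dominated by a
    convergent geometric series. *)
Lemma slope_gt0 N0 : exists2 N, (N0 <= N)%N & 0 < Y N.+1%:R - Y N%:R.
Proof.
apply: contrapT => H.
have Yd N : (N0 <= N)%N -> Y N.+1%:R <= Y N%:R.
  by move=> NN; rewrite leNgt; apply/negP => h; apply: H; exists N; rewrite // subr_gt0.
have YN k : Y (N0 + k)%:R <= Y N0%:R.
  elim: k => [|k IH]; first by rewrite addn0.
  by rewrite addnS (le_trans _ IH) // Yd // leq_addr.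
(* With this [c], the quantity [c * expR (- n)] is the sum of the geometric tail [Y N0 * expR (- j)]
   over [j >= n], so the sum in [B] below does not increase. *)
pose c := Y N0%:R / (1 - r1).
have cr : c * (1 - r1) = Y N0%:R by rewrite /c divfK // gt_eqF // subr_gt0.
have c0 : 0 <= c by rewrite divr_ge0 // subr_ge0 ltW.
have B k : W (N0 + k) + c * expR (- (N0 + k)%:R) <= W N0 + c * expR (- N0%:R).
  elim: k => [|k IH]; first by rewrite addn0.
  apply: le_trans IH; rewrite addnS WS expS.
  have := ler_wpM2r (expR_ge0 (- (N0 + k)%:R)) (YN k); rewrite -cr; lra.
have [n nW] := W_unbounded (W N0 + c * expR (- N0%:R)).
have := B n; rewrite leNgt => /negP; apply.
apply: lt_le_trans nW _; apply: le_trans (W_le (leq_addl N0 n)) _.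
by rewrite lerDl mulr_ge0 // expR_ge0.
Qed.

Section Hats.
Variable N : nat.
Let q n : R := (N + n).+1%:R.
Let d n := Y (q n) - Y (N + n)%:R.
Hypothesis d0 : 0 < d 0.

(** A piecewise affine minorant of [Y], zero up to [q 0]. Its slope just after each node [q k] is
    that of the chord of [Y] just before the node, so by convexity it stays below; the coefficients
    are the second differences of [Y]. *)
Fixpoint hats n x := if n is k.+1 then hats k x + (d k.+1 - d k) * Num.max (x - q k.+1) 0
  else d 0 * Num.max (x - q 0) 0.

Let qS n : q n.+1 = q n + 1.
Proof. by rewrite /q addnS -natr1. Qed.

Let qE n : (N + n)%:R = q n - 1.
Proof. by rewrite /q -natr1 addrK. Qed.

(** Continued to the right of [q n], the chord over the unit interval ending there lies below a
    convex function. *)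
Lemma support_line n x : q n <= x -> d n * (x - q n) <= Y x - Y (q n).
Proof.
move=> qx; have := @convex_chord (q n - 1) (q n) x.
rewrite qx andbT lerBlDr lerDl ler01 => /(_ isT); rewrite /d qE; lra.
Qed.

Lemma slope_mono n : d n <= d n.+1.
Proof.
have := @support_line n (q n.+1); rewrite qS lerDl ler01 => /(_ isT).
by rewrite addrAC subrr add0r mulr1 /d addnS -/(q n) qS.
Qed.

Lemma slope_ge0 n : 0 <= d n.
Proof. by elim: n => [|n IH]; [exact: ltW|rewrite (le_trans IH) // slope_mono]. Qed.

Let q_le n : q 0 <= q n.
Proof. by rewrite /q ler_nat ltnS addn0 leq_addr. Qed.

Lemma hats_affine n x : q n <= x -> hats n x = hats n (q n) + d n * (x - q n).
Proof.
elim: n x => [|n IH] x qx /=.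
  by rewrite max_l ?subr_ge0 // subrr maxxx mulr0 add0r.
have qq : q n <= q n.+1 by rewrite qS lerDl.
rewrite (IH x) ?(le_trans qq) // (IH (q n.+1)) // max_l ?subr_ge0 // subrr maxxx; ring.
Qed.

Lemma hats_le_shift n x : q 0 <= x -> hats n x <= Y x - Y (q 0).
Proof.
elim: n x => [|n IH] x qx /=; first by rewrite max_l ?subr_ge0 // support_line.
have [xq|xq] := lerP x (q n.+1).
  by rewrite max_r ?subr_le0 // mulr0 addr0 IH.
have := hats_affine (ltW xq) => /= ->.
rewrite subrr maxxx mulr0 addr0.
have := IH _ (q_le n.+1); have := support_line (ltW xq); lra.
Qed.

Lemma hats_le n x : hats n x <= Y x.
Proof.
have [qx|qx] := lerP (q 0) x.
  by apply: le_trans (hats_le_shift n qx) _; rewrite lerBlDr lerDl.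
suff -> : hats n x = 0 by [].
elim: n => [|n IH] /=; first by rewrite max_r ?mulr0 // subr_le0 ltW.
by rewrite IH max_r ?mulr0 ?addr0 // subr_le0 (le_trans (ltW qx)).
Qed.

(** Each hat [(x - q)^+] of [hats] is replaced by [exp (- q)], which up to the constant [k] bounds
    its integral from below. *)
Fixpoint hats_exp n := if n is k.+1 then hats_exp k + (d k.+1 - d k) * expR (- q k.+1)
  else d 0 * expR (- q 0).

(* Abel summation, twice: first from the second differences of [Y] to its
   differences, then from these to [Y] itself. *)
Lemma hats_exp_lower n : (1 - r1) * (W (N + n) - W N - (1 - r1)^-1 * (Y N%:R * expR (- N%:R))) <=
  (1 - r1)^-1 * hats_exp n.
Proof.
have r0 : 0 < 1 - r1 by rewrite subr_gt0.
pose T n := \sum_(0 <= j < n) d j * expR (- q j).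
have T0 : T 0 = 0 by rewrite /T big_nil.
have TS k : T k.+1 = T k + d k * expR (- q k) by rewrite /T big_nat_recr.
have qe k : expR (- q k.+1) = r1 * expR (- q k) by rewrite /q addnS expS.
have E1 k : hats_exp k = d k * expR (- q k) + (1 - r1) * T k.
  elim: k => [|k IH] /=; first by rewrite T0 mulr0 addr0.
  by rewrite IH TS qe; ring.
have E2 k : T k = W (N + k).+1 - W N - Y N%:R * expR (- N%:R) - r1 * (W (N + k) - W N).
  elim: k => [|k IH]; first by rewrite T0 addn0 WS; ring.
  by rewrite TS IH addnS !WS /d /q expS; ring.
have h1 : (1 - r1) * (W (N + n) - W N) - Y N%:R * expR (- N%:R) <= T n.
  rewrite E2; have := W_le (leqnSn (N + n)); lra.
have h2 : T n <= (1 - r1)^-1 * hats_exp n.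
  by rewrite ler_pdivlMl // E1 lerDr mulr_ge0 ?slope_ge0 // expR_ge0.
by apply: le_trans h2; apply: le_trans h1; rewrite mulrBr mulVKf // gt_eqF.
Qed.

End Hats.

Lemma hats_exp_unbounded N C : 0 < Y (N + 0).+1%:R - Y (N + 0)%:R -> exists n, C < hats_exp N n.
Proof.
move=> d0; have r0 : 0 < 1 - r1 by rewrite subr_gt0.
pose B := W N + (1 - r1)^-1 * (Y N%:R * expR (- N%:R)) + (1 - r1)^-1 * ((1 - r1)^-1 * C).
have [n nB] := W_unbounded B; exists n; rewrite ltNge; apply/negP => H.
have := hats_exp_lower d0 n; rewrite leNgt => /negP; apply.
apply: (@le_lt_trans _ _ ((1 - r1)^-1 * C)); first by rewrite ler_pM2l ?invr_gt0.
rewrite -ltr_pdivrMl //; have := lt_le_trans nB (W_le (leq_addl N n)); rewrite /B; lra.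
Qed.

Lemma L1_dom_ae (f g : R -> R) : measurable_fun (circle R) f -> L1 g ->
  (forall s, 0 <= f s) -> (forall s, 0 <= g s) ->
  {ae mu, forall s, circle R s -> f s <= g s} -> L1 f.
Proof.
move=> mf gi f0 g0 fg; have mg := L1_measurable gi.
have [||||//] := @circ_DCT R (fun _ s => Num.min (f s) (g s)) f _ _ _ _ gi.
- by move=> _; exact: measurable_minr.
- by [].
- by apply: aeS fg => s H cs; rewrite min_l ?H //; exact: cvg_cst.
- by move=> _ s _; rewrite ger0_norm; [rewrite ge_min lexx orbT|rewrite le_min f0 g0].
Qed.

(** If [Y \o F] were integrable, so would be every tail function of [V], as
    [d 0 * (x - q 0)^+ <= Y x]. The lower bounds for the tails then add up with nonnegative weights
    to a multiple of [hats_exp N n], which is unbounded, while [hats N n <= Y] keeps the integrals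
    bounded. *)
Lemma convex_not_integrable (V F : R -> R) k (a0 : R) : measurable_fun (circle R) V ->
  {ae mu, forall s, circle R s -> V s = F s} -> 0 < k ->
  (forall a, a0 <= a -> L1 (fun s => Num.max (V s - a) 0) ->
    k * expR (- a) <= \int[mu]_(s in circle R) Num.max (V s - a) 0) ->
  ~ L1 (Y \o F).
Proof.
move=> mV VF k0 tail YF.
(* Starting beyond [a0] puts every node [q n] in the range of the tail bound. *)
have [N NN0 dN] := slope_gt0 (Num.trunc a0).+1.
have d0 : 0 < Y (N + 0).+1%:R - Y (N + 0)%:R by rewrite addn0.
pose q n : R := (N + n).+1%:R; pose d n := Y (q n) - Y (N + n)%:R.
have aq n : a0 <= q n.
  apply: le_trans (ltW (truncnS_gt a0)) _; rewrite ler_nat.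
  by rewrite (leq_trans NN0) // (leq_trans (leq_addr n N)).
have mh a : measurable_fun (circle R) (fun s => Num.max (V s - a) 0).
  by apply: measurable_maxr => //; exact: measurable_funB.
have h0 a s : 0 <= Num.max (V s - a) 0 by rewrite le_max lexx orbT.
have i0 : L1 (fun s => Num.max (V s - q 0) 0).
  apply: (@L1_dom_ae _ (fun s => (d 0)^-1 * Y (F s))) => //.
  - exact: L1Z.
  - by move=> s; rewrite mulr_ge0 // invr_ge0 ltW.
  - apply: aeS VF => s H cs; rewrite -(H cs) ler_pdivlMl //.
    have := hats_le N 0%N (V s); rewrite /= => hl.
    exact: hl.
have ih n : L1 (fun s => Num.max (V s - q n) 0).
  apply: (L1_dom (mh _) i0) => s _; rewrite ger0_norm //.
  rewrite ge_max !le_max lexx !orbT andbT lerD2l lerN2 /q ler_nat ltnS addn0 leq_addr //.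
have hn n : L1 (fun s => hats N n (V s)) /\
    k * hats_exp N n <= \int[mu]_(s in circle R) hats N n (V s).
  elim: n => [|n [IHi IH]].
    rewrite -[hats N 0]/(fun x => d 0 * Num.max (x - q 0) 0).
    rewrite -[hats_exp N 0]/(d 0 * expR (- q 0)); split; first exact: L1Z.
    rewrite (RintegralZl (d 0) (@measurable_circleR R) (ih 0%N)) mulrCA ler_pM2l //.
    exact: tail.
  have dn : 0 <= d n.+1 - d n by rewrite subr_ge0 slope_mono.
  rewrite -[hats N n.+1]/(fun x => hats N n x + (d n.+1 - d n) * Num.max (x - q n.+1) 0).
  rewrite -[hats_exp N n.+1]/(hats_exp N n + (d n.+1 - d n) * expR (- q n.+1)).
  have Zi := L1Z (d n.+1 - d n) (ih n.+1).
  split; first exact: L1D.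
  rewrite (RintegralD (@measurable_circleR R) IHi Zi).
  rewrite (RintegralZl _ (@measurable_circleR R) (ih n.+1)) mulrDr; apply: lerD => //.
  by rewrite mulrCA ler_wpM2l //; exact: tail.
pose M := \int[mu]_(s in circle R) (Y \o F) s.
have [n nM] := hats_exp_unbounded (M / k) d0.
have [Hi Hn] := hn n.
have : \int[mu]_(s in circle R) hats N n (V s) <= M.
  apply: circ_le_ae => //.
  by apply: aeS VF => s H cs; rewrite /= -(H cs); exact: hats_le.
move=> /(le_trans Hn); rewrite -ler_pdivlMl // mulrC leNgt nM //.
Qed.

End ConvexTail.

Theorem theorem3p4 (R : realType) (Y : R -> R) (f : R -> R)
  (Y_ge0 : forall x : R, 0 <= Y x)
  (Y_convex : convex_function [set: R^o] (Y : R^o -> R^o))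
  (Y_int : (\int[@lebesgue_measure R]_(x in `[0%R, +oo[)
              (Y x * expR (- x))%:E = +oo)%E)
  (f_L1 : (@lebesgue_measure R).-integrable (circle R) (EFin \o f))
  (f_large_pos :
    (0 < @lebesgue_measure R (circle R `&` f @^-1` `[(pi / 2)%R, +oo[))%E)
  (f_large_lt :
    (@lebesgue_measure R (circle R `&` f @^-1` `[(pi / 2)%R, +oo[)
      < (2 * pi)%:E)%E)
  (f_gap :
    @lebesgue_measure R (circle R `&` f @^-1` `]- (pi / 2), pi / 2[) = 0%E) :
  ~ (@lebesgue_measure R).-integrable (circle R) (EFin \o (Y \o conj_fun f)).
Proof.
have [V [mV VE [k k0 [a0 tail]]]] := conj_tail f_L1 f_large_pos f_large_lt f_gap.
exact: (convex_not_integrable Y_ge0 Y_convex Y_int mV VE k0 tail).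
Qed.
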